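(* Let $\alpha>0$, $0<\beta<1$, and let $$\mathcal{M}^{\alpha,\beta}(t)=\frac1{\Gamma(\alpha)}\int_0^t(t-s)^{\alpha-1}M^\beta(s)\,\mathrm{d}s,\qquad t\ge0,$$ where $M^\beta(t)=M(Y_\beta(t))$ is the generalized fractional counting process with positive rates $\lambda_1,\dots,\lambda_k$. Then $$\begin{aligned}\operatorname{Var}(\mathcal{M}^{\alpha,\beta}(t))&=\frac{2c_2B(\beta+1,2\alpha)}{(\Gamma(\alpha))^2\Gamma(\beta+1)\alpha}t^{2\alpha+\beta}+\Big(\frac{2B(2\beta+1,2\alpha)}{(\Gamma(\alpha))^2\Gamma(2\beta+1)\alpha}-\frac1{(\Gamma(\alpha+\beta+1))^2}\Big)c_1^2t^{2\alpha+2\beta}\\&\quad+\frac{2c_1^2\beta}{(\Gamma(\alpha)\Gamma(\beta+1))^2}\int_0^t\int_s^t(t-s)^{\alpha-1}(t-w)^{\alpha-1}w^{2\beta}B(\beta,\beta+1;s/w)\,\mathrm{d}w\,\mathrm{d}s,\end{aligned}$$ where $c_1=\sum_{j=1}^kj\lambda_j$ and $c_2=\sum_{j=1}^kj^2\lambda_j$.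
   Context: Generalized counting process (GCP): for $k\ge1$ and $\lambda_1,\dots,\lambda_k>0$, it is the non-negative integer valued Lévy process $\{M(t)\}_{t\ge0}$, $M(0)=0$, with $\Pr\{M(t+h)=n+j\mid M(t)=n\}=1-\Lambda h+o(h)$ for $j=0$, $=\lambda_jh+o(h)$ for $1\le j\le k$, $=o(h)$ for $j\ge k+1$, where $\Lambda=\sum_{j=1}^k\lambda_j$. Equivalently $\mathbb{E}(u^{M(t)})=\exp(-t\sum_{j=1}^k\lambda_j(1-u^j))$ for $|u|\le1$. Stable subordinator $D_\beta$, $0<\beta<1$: non-decreasing Lévy process with $\mathbb{E}(e^{-sD_\beta(t)})=e^{-ts^\beta}$, $s>0$. Inverse stable subordinator: $Y_\beta(t)=\inf\{x>0:D_\beta(x)>t\}$. The generalized fractional counting process is $M^\beta(t)=M(Y_\beta(t))$ with $Y_\beta$ independent of $M$. $B(a,b)=\int_0^1u^{a-1}(1-u)^{b-1}\,\mathrm{d}u$ is the beta function and $B(a,b;x)=\int_0^xu^{a-1}(1-u)^{b-1}\,\mathrm{d}u$ the incomplete beta function. *)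

(* Defs.v *)
From HB Require Import structures.
From mathcomp Require Export all_boot all_order all_algebra.
From mathcomp Require Export all_classical all_reals all_analysis.
Export Order.TTheory GRing.Theory Num.Theory.
Export numFieldNormedType.Exports.

Set Implicit Arguments.
Unset Strict Implicit.
Unset Printing Implicit Defensive.

Local Open Scope classical_set_scope.
Local Open Scope ring_scope.

Section special_functions.
Context {R : realType}.
Local Notation mu := (@lebesgue_measure R).

Definition Gamma (a : R) : R :=
  \int[mu]_(x in `]0, +oo[) (x `^ (a - 1) * expR (- x)).

(* The library's beta_fun only takes natural parameters. *)
Definition Beta (a b : R) : R :=
  \int[mu]_(u in `]0, 1[) (u `^ (a - 1) * (1 - u) `^ (b - 1)).

Definition incomplete_Beta (a b x : R) : R :=
  \int[mu]_(u in `]0, x[) (u `^ (a - 1) * (1 - u) `^ (b - 1)).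

(* Riemann-Liouville fractional integral of order a. *)
Definition RL_integral (a : R) (f : R -> R) (t : R) : R :=
  (Gamma a)^-1 * \int[mu]_(s in `[0, t]) ((t - s) `^ (a - 1) * f s).

End special_functions.

(* Processes are indexed by R, but every condition below (and every use)
   only concerns times t >= 0. *)
Section processes.
Context d (T : measurableType d) (R : realType) (P : probability T R).

Definition mutually_independent (I : finType) (X : I -> T -> R) : Prop :=
  forall (J : {set I}) (B : I -> set R), (forall i, measurable (B i)) ->
    P (\bigcap_(i in [set` J]) (X i @^-1` B i)) =
    (\prod_(i in J) P (X i @^-1` B i))%E.

Definition process_sigma_algebra (X : R -> T -> R) : set (set T) :=
  <<s \bigcup_(t in [set t : R | 0 <= t])
        preimage_set_system setT (X t) measurable >>.

Definition independent_processes (X Y : R -> T -> R) : Prop :=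
  forall A B : set T, process_sigma_algebra X A -> process_sigma_algebra Y B ->
    P (A `&` B) = (P A * P B)%E.

(* As usual a Levy process is a cadlag process: every path is cadlag, whereas
   X(0) = 0 is only required almost surely.  This makes first-passage times and
   pathwise integrals of X measurable without completing P. *)
Record levy_process (X : R -> {RV P >-> R}) : Prop := LevyProcess {
  levy_start : {ae P, forall w, X 0 w = 0} ;
  levy_indep : forall (n : nat) (t : nat -> R), 0 <= t 0%N ->
    (forall i, (i < n)%N -> t i < t i.+1) ->
    mutually_independent (fun (i : 'I_n) w => X (t i.+1) w - X (t i) w) ;
  levy_stationary : forall s t h : R, 0 <= s -> 0 <= t -> 0 <= h ->
    forall B : set R, measurable B ->
      P [set w | B (X (s + h) w - X s w)] =
      P [set w | B (X (t + h) w - X t w)] ;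
  levy_right_continuous : forall w (t : R), 0 <= t -> X ^~ w @ t^'+ --> X t w ;
  levy_left_limits : forall w (t : R), 0 < t -> cvg (X ^~ w @ t^'-) }.

Definition cond_prob (A B : set T) : R := fine (P (A `&` B)) / fine (P B).

Definition gcp_transition (k : nat) (lam : nat -> R) (j : nat) (h : R) : R :=
  if j == 0%N then 1 - (\sum_(1 <= i < k.+1) lam i) * h
  else if (j <= k)%N then lam j * h else 0.

Record generalized_counting_process (k : nat) (lam : nat -> R)
    (M : R -> {RV P >-> R}) : Prop := GeneralizedCountingProcess {
  gcp_levy : levy_process M ;
  gcp_nat : forall (t : R) w, 0 <= t -> M t w \is a Num.nat ;
  gcp_rates : forall (t : R) (n j : nat), 0 <= t ->
    (0 < P [set w | M t w = n%:R])%E ->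
    (fun h : R =>
       cond_prob [set w | M (t + h) w = (n + j)%:R] [set w | M t w = n%:R]
       - gcp_transition k lam j h) =o_ (0^'+) (fun h : R => h) }.

Record stable_subordinator (b : R) (D : R -> {RV P >-> R}) : Prop :=
  StableSubordinator {
  stable_levy : levy_process D ;
  stable_nondecreasing : {ae P, forall w, forall s t : R,
    0 <= s -> s <= t -> D s w <= D t w} ;
  stable_laplace : forall t s : R, 0 <= t -> 0 < s ->
    ('E_P[fun w => expR (- (s * D t w))] = (expR (- (t * s `^ b)))%:E)%E }.

(* D is almost surely unbounded; inf set0 = 0 on the exceptional null set. *)
Definition inverse_subordinator (D : R -> T -> R) (t : R) (w : T) : R :=
  inf [set x : R | 0 < x /\ t < D x w].

Definition time_changed (M Y : R -> T -> R) (t : R) (w : T) : R := M (Y t w) w.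

End processes.

(* Main.v *)
(** Write [r_c(x) = x^(c-1) / Gamma(c)] for [x > 0], so that [r_c * r_d = r_(c+d)].
    The potential measure of [D] has Laplace transform [l^-beta], hence density
    [r_beta]; together with [{Y(t) > x} = {D(x) <= t}] and the independence of
    the increments of [D] this gives [E Y(t) = r_(beta+1)(t)] and, for [s <= t],
    [E Y(s)Y(t) = r_(2beta+1)(s) + int_0^s r_beta(y) r_(beta+1)(t-y) dy].
    Since [E M(x) = c1 x] and [E M(x)M(y) = c2 x + c1^2 x y] for [x <= y],
    conditioning on [Y] yields the first two moments of [M(Y(t))].  By Tonelli
    the second moment of the Riemann-Liouville integral is twice an integral
    over [s < w] of the product moments; the terms [r_(beta+1)(s)] and
    [r_(2beta+1)(s)] integrate to beta functions, and the remaining term is an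
    incomplete beta function.  The Laplace transform of the potential is
    inverted by hand: with [u = exp(-D)] it determines the integrals of
    polynomials in [u], and Bernstein polynomials approximate indicators. *)
From HB Require Import structures.
Require Import Defs.
From mathcomp Require Import measurable_realfun ring lra.

Set Implicit Arguments.
Unset Strict Implicit.
Unset Printing Implicit Defensive.

Local Open Scope classical_set_scope.
Local Open Scope ring_scope.

(** * Gamma and beta integrals, fractional kernels *)

(** The rates control the probability of each single state up to o(h) and say nothing directly about
    moments of M. They do determine its Laplace transform, by cutting [0, t] into many equal steps;
    the moments then come from the approximation n (1 - exp(-M/n)) of M from below, without
    differentiating under the integral sign. The inverse subordinator is handled as an occupation
    length: almost surely Y(s) is the Lebesgue measure of the set of x > 0 with D(x) <= s, so
    Tonelli turns its moments into potentials of D and the law of Y is never computed. Integrals of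
    nonnegative functions stay in [0, +oo] as long as possible: Tonelli then applies freely, and
    finiteness is read off the closed form. Functions are extended by zero to the whole line, so
    that shifts and scalings need no bookkeeping of domains. Nonnegativity and monotonicity of D,
    and Y(s) <= Y(t), hold only almost surely; this is why clipped values, absolute values and
    minima appear in integrands. *)

Section affine_change_of_variable.
Local Open Scope ereal_scope.
Context {R : realType}.
Local Notation mu := (@lebesgue_measure R).

Let aff (c d : R) : measurableTypeR R -> measurableTypeR R := fun x => (c * x + d)%R.

Let measurable_aff (c d : R) : measurable_fun setT (aff c d).
Proof. by apply: measurable_funD => //; exact: measurable_funM. Qed.

(** The scaled pushforward gives every half-open interval its length, so uniqueness of Lebesgue
    measure applies. *)
Let lebesgue_measure_aff (c d : R) (A : set R) : (0 < c)%R -> measurable A ->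
  c%:E * pushforward mu (aff c d) A = mu A.
Proof.
move=> c0 mA.
have c0' : (0 <= c)%R by exact: ltW.
pose m : {measure set (measurableTypeR R) -> \bar R} :=
  mscale (NngNum c0') (pushforward mu (aff c d)).
rewrite (_ : _ * _ = m (@measurable_aff c d) A)//.
apply/esym/lebesgue_measure_unique => //= _ [[a b]] _ <-.
rewrite /m /mscale /pushforward; cbn beta.
rewrite [X in _ = _ * X](_ : _ = mu [set` `](a - d) / c, (b - d) / c]%R]); last first.
  congr (mu _); apply/seteqP; split => x /=; rewrite !in_itv/= /aff ltr_pdivrMr// ler_pdivlMr//;
  by rewrite ltrBlDr lerBrDr mulrC.
rewrite !lebesgue_measure_itv/= !lte_fin ltr_pM2r ?invr_gt0// ltrD2r.
case: ifPn => ab; last by rewrite mule0.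
by rewrite -!EFinD -EFinM; congr EFin; rewrite -mulrBl mulrCA divff ?gt_eqF// mulr1; ring.
Qed.

Lemma ge0_integral_affine (c d : R) (f : R -> \bar R) : (0 < c)%R ->
  measurable_fun setT f -> (forall x, 0 <= f x) ->
  \int[mu]_x f x = c%:E * \int[mu]_x f (c * x + d)%R.
Proof.
move=> c0 mf f0.
have c0' : (0 <= c)%R by exact: ltW.
rewrite -[X in _ = _ * X](@ge0_integral_pushforward _ _ _ _ _ (aff c d)
  (@measurable_aff c d) _ setT f)//.
rewrite -[RHS](ge0_integral_mscale _ measurableT (NngNum c0'))//.
apply: eq_measure_integral => // A mA _.
exact/esym/lebesgue_measure_aff.
Qed.

Lemma ge0_integral_shift (d : R) (f : R -> \bar R) :
  measurable_fun setT f -> (forall x, 0 <= f x) ->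
  \int[mu]_x f (x + d)%R = \int[mu]_x f x.
Proof.
move=> mf f0; rewrite [RHS](@ge0_integral_affine 1 d)// mul1e.
by apply: eq_integral => x _; rewrite mul1r.
Qed.

Lemma ge0_integral_opp (f : R -> \bar R) :
  measurable_fun setT f -> (forall x, 0 <= f x) ->
  \int[mu]_x f (- x)%R = \int[mu]_x f x.
Proof.
move=> mf f0.
have mN : measurable_fun setT (-%R : measurableTypeR R -> measurableTypeR R).
  exact: oppr_measurable.
rewrite -[LHS](@ge0_integral_pushforward _ _ _ _ _
  (-%R : measurableTypeR R -> measurableTypeR R) mN _ setT f)//.
by apply: eq_measure_integral => // A mA _; exact: lebesgue_measureN.
Qed.

Lemma ge0_integral_reflect (t : R) (f : R -> \bar R) :
  measurable_fun setT f -> (forall x, 0 <= f x) ->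
  \int[mu]_x f (t - x)%R = \int[mu]_x f x.
Proof.
move=> mf f0; rewrite -[RHS](ge0_integral_shift t)//.
rewrite -[RHS]ge0_integral_opp//; last by apply: measurableT_comp => //; exact: measurable_funD.
by apply: eq_integral => x _; rewrite addrC.
Qed.

End affine_change_of_variable.

Lemma tonelli d1 d2 (T1 : measurableType d1) (T2 : measurableType d2) (R : realType)
    (m1 : {sigma_finite_measure set T1 -> \bar R})
    (m2 : {sigma_finite_measure set T2 -> \bar R}) (f : T1 -> T2 -> \bar R) :
  measurable_fun setT (fun z : T1 * T2 => f z.1 z.2) ->
  (forall x y, (0 <= f x y)%E) ->
  (\int[m1]_x \int[m2]_y f x y = \int[m2]_y \int[m1]_x f x y)%E.
Proof. by move=> mf f0; rewrite (fubini_tonelli (fun z => f z.1 z.2)). Qed.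

Section gamma_beta.
Context {R : realType}.
Local Notation mu := (@lebesgue_measure R).
Implicit Types a b c s t x y : R.

(** The integrand of gamma and beta integrals with its domain built in; [pw 1] is the indicator of
    the positive half-line. *)
Definition pw a x : R := if 0 < x then x `^ (a - 1) else 0.

Lemma pw_ge0 a x : 0 <= pw a x.
Proof. by rewrite /pw; case: ifP => // _; exact: powR_ge0. Qed.

Lemma pw_gt0E a x : 0 < x -> pw a x = x `^ (a - 1).
Proof. by rewrite /pw => ->. Qed.

Lemma pw_le0 a x : x <= 0 -> pw a x = 0.
Proof. by rewrite /pw leNgt => /negbTE ->. Qed.

Lemma pw1 x : pw 1 x = (0 < x)%R%:R.
Proof. by rewrite /pw subrr powRr0; case: ifP. Qed.

Lemma pw_patch a : pw a = (@powR R ^~ (a - 1)) \_ `]0, +oo[.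
Proof.
by apply/funext => x; rewrite patchE mem_setE in_itv/= andbT.
Qed.

Lemma measurable_pw a : measurable_fun setT (pw a).
Proof.
rewrite pw_patch; apply/(measurable_restrictT _ _).1 => //.
by apply: measurable_funTS; exact: measurable_powR.
Qed.

Lemma pwM a c x : 0 < c -> pw a (c * x) = c `^ (a - 1) * pw a x.
Proof.
move=> c0; rewrite /pw pmulr_rgt0//; case: ifP => x0; last by rewrite mulr0.
by rewrite powRM// ltW.
Qed.

Definition conv (f g : R -> R) t : \bar R := (\int[mu]_x (f x * g (t - x))%:E)%E.

Definition betaE a b : \bar R := conv (pw a) (pw b) 1.

Definition gammaE a : \bar R := (\int[mu]_x (pw a x * expR (- x))%:E)%E.

Lemma conv_ge0 (f g : R -> R) t : (forall x, 0 <= f x) -> (forall x, 0 <= g x) ->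
  (0 <= conv f g t)%E.
Proof. by move=> f0 g0; apply: integral_ge0 => x _; rewrite lee_fin mulr_ge0. Qed.

Lemma measurable_convf (f g : R -> R) t :
  measurable_fun setT f -> measurable_fun setT g ->
  measurable_fun setT (fun x => f x * g (t - x)).
Proof.
move=> mf mg; apply: measurable_funM => //.
by apply: measurableT_comp => //; exact: measurable_funB.
Qed.

(** An identity in [0, +oo]: for t > 0, substituting t * x for x pulls out t^(1 + (a - 1) + (b -
    1)); for t <= 0 the two factors have disjoint supports. *)
Lemma conv_pw a b t : conv (pw a) (pw b) t = (betaE a b * (pw (a + b) t)%:E)%E.
Proof.
have [t0|t0] := ltP 0 t; last first.
  rewrite (pw_le0 (a + b))// mule0; apply: integral0_eq => x _.
  have [x0|x0] := ltP 0 x; last by rewrite pw_le0// mul0r.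
  by rewrite [pw b _]pw_le0 ?mulr0// subr_le0 (le_trans t0)// ltW.
rewrite /conv (@ge0_integral_affine _ t 0)//; last 2 first.
- by apply/measurable_EFinP; apply: measurable_convf; exact: measurable_pw.
- by move=> x; rewrite lee_fin mulr_ge0// pw_ge0.
under eq_integral => x _.
  rewrite addr0 (_ : t - t * x = t * (1 - x)); last by rewrite mulrBr mulr1.
  rewrite !pwM// mulrACA EFinM; over.
rewrite ge0_integralZl//.
- rewrite muleA -EFinM muleC; congr (_ * _%:E)%E.
  rewrite (pw_gt0E _ t0) -[X in X * _ = _]powRr1 ?ltW// -!powRD; last 2 first.
    by rewrite (gt_eqF t0) implybT.
    by rewrite (gt_eqF t0) implybT.
  by congr (_ `^ _); ring.
- by apply/measurable_EFinP; apply: measurable_convf; exact: measurable_pw.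
- by move=> x _; rewrite lee_fin mulr_ge0// pw_ge0.
- by rewrite lee_fin mulr_ge0// powR_ge0.
Qed.

Lemma gammaE_ge0 a : (0 <= gammaE a)%E.
Proof. by apply: integral_ge0 => x _; rewrite lee_fin mulr_ge0// ?pw_ge0 ?expR_ge0. Qed.

Lemma measurable_pwexp a : measurable_fun setT (fun x => pw a x * expR (- x)).
Proof.
apply: measurable_funM; first exact: measurable_pw.
by apply: measurableT_comp => //; exact: measurable_expR.
Qed.

(** Shifting y by x in the double integral merges the exponentials into exp(-y); after exchanging
    the integrals, the inner one is the convolution computed by [conv_pw]. *)
Lemma gammaEM a b : (gammaE a * gammaE b = betaE a b * gammaE (a + b))%E.
Proof.
transitivity (\int[mu]_x \int[mu]_y (pw a x * pw b (y - x) * expR (- y))%:E)%E.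
  rewrite muleC -ge0_integralZl//; last 3 first.
  - by apply/measurable_EFinP; exact: measurable_pwexp.
  - by move=> x _; rewrite lee_fin mulr_ge0 ?pw_ge0 ?expR_ge0.
  - exact: gammaE_ge0.
  apply: eq_integral => x _; rewrite muleC.
  rewrite /gammaE -(ge0_integral_shift (- x)); last 2 first.
  - by apply/measurable_EFinP; exact: measurable_pwexp.
  - by move=> y; rewrite lee_fin mulr_ge0 ?pw_ge0 ?expR_ge0.
  rewrite -ge0_integralZl//; last 3 first.
  - apply/measurable_EFinP; apply: (measurableT_comp (measurable_pwexp b)).
    exact: measurable_funD.
  - by move=> y _; rewrite lee_fin mulr_ge0 ?pw_ge0 ?expR_ge0.
  - by rewrite lee_fin mulr_ge0 ?pw_ge0 ?expR_ge0.
  apply: eq_integral => y _; rewrite -EFinM; congr EFin.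
  rewrite mulrACA -expRD; congr (_ * expR _); ring.
rewrite tonelli; last 2 first.
- apply/measurable_EFinP; apply: measurable_funM; last first.
    apply: measurableT_comp; first exact: measurable_expR.
    by apply: measurableT_comp => //; exact: measurable_snd.
  apply: measurable_funM; first exact: (measurableT_comp (measurable_pw a) measurable_fst).
  apply: (measurableT_comp (measurable_pw b)).
  exact: measurable_funB.
- by move=> x y; rewrite lee_fin !mulr_ge0 ?pw_ge0 ?expR_ge0.
transitivity (\int[mu]_y (betaE a b * (pw (a + b) y * expR (- y))%:E))%E.
  apply: eq_integral => y _; rewrite EFinM muleA -conv_pw muleC /conv.
  rewrite -ge0_integralZl//.
  - by apply: eq_integral => x _; rewrite -EFinM mulrC.
  - by apply/measurable_EFinP; apply: measurable_convf; exact: measurable_pw.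
  - by move=> x _; rewrite lee_fin mulr_ge0// pw_ge0.
rewrite ge0_integralZl//.
- by apply/measurable_EFinP; exact: measurable_pwexp.
- by move=> x _; rewrite lee_fin mulr_ge0 ?pw_ge0 ?expR_ge0.
- by apply: conv_ge0 => x; exact: pw_ge0.
Qed.

End gamma_beta.

Section gamma_values.
Context {R : realType}.
Local Notation mu := (@lebesgue_measure R).
Implicit Types a b c e s t x y : R.

Lemma derivable_cvg_powR a x : 0 < x -> y `^ a @[y --> x] --> x `^ a.
Proof.
move=> x0; have : {for x, continuous (@powR R ^~ a)}; last by [].
apply: differentiable_continuous; apply/derivable1_diffP.
by apply: derivable_powR; rewrite in_itv/= x0.
Qed.

Lemma integral_powRB1 a e : 0 < e < 1 ->
  (\int[mu]_(x in `[e, 1%R]) (a * x `^ (a - 1))%:E = (1 - e `^ a)%R%:E)%E.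
Proof.
move=> /andP[e0 e1].
rewrite (@continuous_FTC2 R _ (@powR R ^~ a))//; first by rewrite powR1.
- apply: (@derivable_within_continuous R R) => x; rewrite in_itv/= => /andP[ex _].
  apply: derivableM => //; apply: derivable_powR; by rewrite in_itv/= andbT (lt_le_trans e0 ex).
- split=> [x||].
  + rewrite in_itv/= => /andP[ex _]; apply: derivable_powR.
    by rewrite in_itv/= (lt_trans e0 ex).
  + exact/cvg_at_right_filter/derivable_cvg_powR.
  + exact/cvg_at_left_filter/derivable_cvg_powR.
- move=> x; rewrite in_itv/= => /andP[ex _]; apply: powR_derive1.
  by rewrite in_itv/= (lt_trans e0 ex).
Qed.

(** The integrand may blow up at 0, so the fundamental theorem is applied on compact intervals that
    exhaust ]0, 1]. *)
Lemma betaE1 a : 0 < a -> betaE a 1 = (a^-1)%:E.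
Proof.
move=> a0.
pose f x : \bar R := (a * x `^ (a - 1))%:E.
have mf (D : set R) : measurable D -> measurable_fun D f.
  move=> mD; apply: measurable_funTS; apply/measurable_EFinP.
  by apply: measurable_funM => //; exact: measurable_powR.
have f0 x : (0 <= f x)%E by rewrite lee_fin mulr_ge0 ?powR_ge0// ltW.
have h : (a%:E * betaE a 1 = \int[mu]_(x in `]0%R, 1%R]) f x)%E.
  rewrite -integral_itv_bndo_bndc; last exact: mf.
  rewrite /betaE /conv -ge0_integralZl//.
  - rewrite [RHS]integral_mkcond; apply: eq_integral => x _.
    rewrite patchE mem_setE in_itv/= pw1 subr_gt0 /pw /f -EFinM.
    by case: ifPn => x0; case: ltP => x1 //=; rewrite ?(mul0r, mulr0, mulr1).
  - by apply/measurable_EFinP; apply: measurable_convf; exact: measurable_pw.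
  - by move=> x _; rewrite lee_fin mulr_ge0 ?pw_ge0.
  - by rewrite lee_fin ltW.
(* Starting at 1/2 keeps the left end strictly below 1, as [integral_powRB1] asks. *)
pose F (n : nat) : set R := `[n.+2%:R^-1, 1]%classic.
have UF : \bigcup_n F n = `]0, 1]%classic.
  apply/seteqP; split => x /=.
    move=> [n _]; rewrite /F/= !in_itv/= => /andP[nx ->]; rewrite andbT.
    by apply: lt_le_trans nx; rewrite invr_gt0 ltr0n.
  rewrite in_itv/= => /andP[x0 x1].
  exists (Num.truncn x^-1) => //; rewrite /F/= in_itv/= x1 andbT.
  rewrite -[leRHS]invrK lef_pV2 ?posrE ?invr_gt0// ltW//.
  apply: lt_trans (truncnS_gt _) _; by rewrite ltr_nat.
have : (\int[mu]_(x in F n) f x @[n --> \oo] --> \int[mu]_(x in \bigcup_n F n) f x)%E.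
  apply: ge0_nondecreasing_set_cvg_integral => //.
  - move=> m n mn; apply/subsetPset => x; rewrite /F/= !in_itv/= => /andP[mx ->].
    rewrite andbT; apply: le_trans mx; rewrite lef_pV2 ?posrE ?ltr0n//.
    by rewrite ler_nat !ltnS.
  - by move=> n; exact: measurable_itv.
  - by move=> n; apply: (mf (F n)); exact: measurable_itv.
rewrite UF -h; under eq_fun.
  move=> n; rewrite /F /f integral_powRB1; last first.
    by rewrite invr_gt0 ltr0n/= invf_lt1// ltr1n.
  over.
move=> cv1.
have cv2 : ((1 - (n.+2%:R^-1 : R) `^ a)%:E @[n --> \oo] --> 1%:E)%E.
  apply: cvg_EFin; first by near=> n.
  rewrite -[X in _ --> X]subr0; apply: cvgB; first exact: cvg_cst.
  have /cvg_at_rightP := powR_cvg0 a0; apply; split.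
    by move=> n; rewrite invr_gt0 ltr0n.
  have := @cvg_harmonic R; rewrite -(cvg_shiftn 1).
  by apply: cvg_trans; apply: near_eq_cvg; near=> n; rewrite /= addn1.
have : (a%:E * betaE a 1 = 1%:E)%E by exact: (cvg_unique (@ereal_hausdorff R) cv1 cv2).
have : (0 <= betaE a 1)%E by apply: conv_ge0 => x; exact: pw_ge0.
case: (betaE a 1) => [r|_|]//.
- move=> _ [ar]; congr EFin; apply: (mulfI (lt0r_neq0 a0)).
  by rewrite ar divff// lt0r_neq0.
- by rewrite gt0_muley// lte_fin.
Unshelve. all: by end_near. Qed.

Lemma gammaE1 : gammaE 1 = 1%:E :> \bar R.
Proof.
rewrite -(integral_exponential_pdf (@ltr01 R)).
have mf : measurable_fun setT (fun x : R => (expR (- x))%:E).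
  by apply/measurable_EFinP; apply: measurableT_comp => //; exact: measurable_expR.
transitivity (\int[mu]_(x in `]0%R, +oo[) (expR (- x))%:E)%E.
  rewrite [RHS]integral_mkcond; apply: eq_integral => x _.
  by rewrite patchE mem_setE in_itv/= andbT pw1; case: ifP; rewrite ?mul1r ?mul0r.
rewrite integral_itv_obnd_cbnd; last exact: measurable_funTS.
rewrite integral_mkcond; apply: eq_integral => x _.
by rewrite /exponential_pdf !patchE; case: ifP => // _; rewrite mul1r mulN1r.
Qed.

(** An integrable majorant of the gamma integrand: the integrand of B(a, 1) below 1, and beyond 1 a
    multiple of the exponential density of rate 1/2, half of the decay being spent on absorbing the
    power. *)
Lemma pwexp_le a : 0 < a -> exists2 C : R, 0 <= C & forall x,
  pw a x * expR (- x) <= pw a x * pw 1 (1 - x) + C * exponential_pdf 2^-1 x.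
Proof.
move=> a0; set n := Num.truncn a.
have cE x : 0 <= exponential_pdf (2^-1 : R) x by apply: exponential_pdf_ge0.
(* The outer 2 cancels the rate in the density; the rest comes from (x/2)^(n+1) / (n+1)! <=
   exp(x/2), with a - 1 <= n + 1. *)
exists (2 * (2 ^+ n.+1 * n.+1`!%:R)); first by rewrite !mulr_ge0 ?exprn_ge0.
move=> x; have [x1|x1] := ltP x 1.
  rewrite pw1 subr_gt0 x1 mulr1; apply: ler_wpDr.
    by rewrite mulr_ge0 ?mulr_ge0 ?exprn_ge0.
  have [x0|x0] := ltP 0 x; last by rewrite pw_le0// mul0r.
  by rewrite ler_piMr ?pw_ge0// expR_le1 oppr_le0 ltW.
apply: ler_wpDl; first by rewrite mulr_ge0 ?pw_ge0.
have x0 : 0 < x by exact: lt_le_trans x1.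
rewrite /exponential_pdf patchE mem_set; last by rewrite /= in_itv/= andbT ltW.
set K := _ * _%:R; rewrite (_ : 2 * K * _ = K * expR (- 2^-1 * x)); last by field.
rewrite {}/K.
rewrite (_ : expR (- x) = expR (- 2^-1 * x) * expR (- 2^-1 * x)); last first.
  by rewrite -expRD; congr expR; field.
rewrite mulrA ler_wpM2r ?expR_ge0//.
rewrite mulNr expRN ler_pdivrMr ?expR_gt0// pw_gt0E//.
have xn : x `^ (a - 1) <= x ^+ n.+1.
  rewrite -powR_mulrn ?(ltW x0)//; apply: ler_powR => //.
  by rewrite (@le_trans _ _ a)// ?gerBl// ltW// truncnS_gt.
apply: le_trans xn _.
have h : (2^-1 * x) ^+ n.+1 / n.+1`!%:R <= expR (2^-1 * x).
  apply: (@le_trans _ _ (1 + (2^-1 * x) ^+ n.+1 / n.+1`!%:R)); first by rewrite lerDr.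
  by apply: expR_ge1Dxn; rewrite mulr_ge0// (ltW x0).
move: h; rewrite ler_pdivrMr ?ltr0n ?fact_gt0// exprMn => h.
rewrite -mulrA -ler_pdivrMl ?exprn_gt0// -exprVn.
by rewrite [n.+1`!%:R * _]mulrC.
Qed.

Lemma gammaE_fin_num a : 0 < a -> gammaE a \is a fin_num.
Proof.
move=> a0; rewrite ge0_fin_numE ?gammaE_ge0//.
have [C C0 h] := pwexp_le a0.
have me : measurable_fun setT (exponential_pdf (2^-1 : R)) by exact: measurable_exponential_pdf.
have e0 x : 0 <= exponential_pdf (2^-1 : R) x by apply: exponential_pdf_ge0.
have mb : measurable_fun setT (fun x => pw a x * pw 1 (1 - x)).
  by apply: measurable_convf; exact: measurable_pw.
apply: (@le_lt_trans _ _ (betaE a 1 + C%:E)%E); last by rewrite betaE1// ltry.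
rewrite -[X in (_ <= _ + X)%E]mule1 -(@integral_exponential_pdf R 2^-1)//.
rewrite -ge0_integralZl//; last 2 first.
- exact/measurable_EFinP.
- by move=> x _; rewrite lee_fin.
rewrite -ge0_integralD//; last 4 first.
- by move=> x _; rewrite lee_fin mulr_ge0// pw_ge0.
- exact/measurable_EFinP.
- by move=> x _; rewrite -EFinM lee_fin mulr_ge0.
- by apply/measurable_EFinP; exact: measurable_funM.
apply: ge0_le_integral => //.
- by move=> x _; rewrite lee_fin mulr_ge0 ?pw_ge0 ?expR_ge0.
- by apply/measurable_EFinP; exact: measurable_pwexp.
- by apply/measurable_EFinP; apply: measurable_funD => //; exact: measurable_funM.
- by move=> x _; rewrite lee_fin.
Qed.

Lemma gammaE_gt0 a : 0 < a -> (0 < gammaE a)%E.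
Proof.
(* On [1, 2] one has x^(a-1) >= 1/x >= 1/2 and exp(-x) >= exp(-2). *)
move=> a0; apply: (@lt_le_trans _ _ ((expR (- 2) / 2)%:E * mu `[1%R, 2%R])%E).
  by rewrite lebesgue_measure_itv/= lte_fin ltr1n -EFinD mule_gt0// lte_fin ?divr_gt0 ?expR_gt0// subr_gt0 ltr1n.
rewrite -integral_cst// integral_mkcond; apply: ge0_le_integral => //.
- by move=> x _; rewrite patchE; case: ifP => // _; rewrite lee_fin divr_ge0// expR_ge0.
- by apply/(measurable_restrictT _ _).1.
- by apply/measurable_EFinP; exact: measurable_pwexp.
move=> x _; rewrite patchE; case: ifPn => [|_]; last first.
  by rewrite lee_fin mulr_ge0 ?pw_ge0 ?expR_ge0.
rewrite mem_setE in_itv/= => /andP[x1 x2].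
have x0 : 0 < x by exact: lt_le_trans x1.
rewrite lee_fin mulrC ler_pM ?expR_ge0 ?invr_ge0// ?ler_expR ?lerN2//.
rewrite pw_gt0E// powRB ?(gt_eqF x0) ?implybT// powRr1 ?(ltW x0)//.
rewrite ler_pdivlMr// (@le_trans _ _ 1)//; first by rewrite ler_pdivrMl// mulr1.
by rewrite -(powRr0 x) ler_powR// (ltW a0).
Qed.

End gamma_values.

Section fractional_kernel.
Context {R : realType}.
Local Notation mu := (@lebesgue_measure R).
Implicit Types a b c s t x y : R.

Lemma GammaE a : 0 < a -> (Gamma a)%:E = gammaE a.
Proof.
move=> a0; rewrite /Gamma /Rintegral.
have -> : (\int[mu]_(x in `]0%R, +oo[) (x `^ (a - 1) * expR (- x))%:E = gammaE a)%E.
  rewrite integral_mkcond; apply: eq_integral => x _.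
  by rewrite patchE mem_setE in_itv/= andbT /pw; case: ifP => // _; rewrite mul0r.
by rewrite fineK// gammaE_fin_num.
Qed.

Lemma Gamma_gt0 a : 0 < a -> 0 < Gamma a.
Proof. by move=> a0; rewrite -lte_fin GammaE// gammaE_gt0. Qed.

Lemma Gamma1 : Gamma 1 = 1 :> R.
Proof. by have := GammaE (@ltr01 R); rewrite gammaE1 => -[]. Qed.

(** The case b = 1 of [gammaEM], in place of an integration by parts. *)
Lemma GammaD1 a : 0 < a -> Gamma (a + 1) = a * Gamma a.
Proof.
move=> a0; have := gammaEM a 1.
rewrite betaE1// gammaE1 mule1 -!GammaE ?addr_gt0// -EFinM => -[->].
by rewrite mulVKf// gt_eqF.
Qed.

Lemma betaE_Gamma a b : 0 < a -> 0 < b ->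
  betaE a b = (Gamma a * Gamma b / Gamma (a + b))%:E.
Proof.
move=> a0 b0; have := gammaEM a b; rewrite -!GammaE ?addr_gt0//.
have gab : 0 < Gamma (a + b) by rewrite Gamma_gt0 ?addr_gt0.
rewrite -[X in X = _]EFinM => h; rewrite EFinM h -muleA -EFinM divff ?gt_eqF// mule1.
by [].
Qed.

Lemma Beta_Gamma a b : 0 < a -> 0 < b ->
  Beta a b = Gamma a * Gamma b / Gamma (a + b).
Proof.
move=> a0 b0; rewrite /Beta /Rintegral.
have -> : (\int[mu]_(u in `]0%R, 1%R[) (u `^ (a - 1) * (1 - u) `^ (b - 1))%:E = betaE a b)%E; last first.
  by rewrite betaE_Gamma.
rewrite integral_mkcond /betaE /conv; apply: eq_integral => x _.
rewrite patchE mem_setE in_itv/= /pw subr_gt0.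
by case: (0 < x) (x < 1) => [] []; rewrite /= ?mul0r ?mulr0.
Qed.

(** The Riemann-Liouville kernel of order a. As [rlk 1] is the indicator of the positive half-line,
    raising the order by one amounts to integrating from 0. *)
Definition rlk a x : R := pw a x / Gamma a.

Lemma measurable_rlk a : measurable_fun setT (rlk a).
Proof. by apply: measurable_funM => //; exact: measurable_pw. Qed.

Lemma rlk_ge0 a x : 0 < a -> 0 <= rlk a x.
Proof. by move=> a0; rewrite divr_ge0 ?pw_ge0// ltW// Gamma_gt0. Qed.

Lemma rlk_le0 a x : x <= 0 -> rlk a x = 0.
Proof. by move=> x0; rewrite /rlk pw_le0// mul0r. Qed.

Lemma rlk1 x : rlk 1 x = (0 < x)%R%:R.
Proof. by rewrite /rlk Gamma1 divr1 pw1. Qed.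

Lemma conv_rlk a b t : 0 < a -> 0 < b ->
  conv (rlk a) (rlk b) t = (rlk (a + b) t)%:E.
Proof.
move=> a0 b0; rewrite /conv.
have ga := Gamma_gt0 a0; have gb := Gamma_gt0 b0; have gab := Gamma_gt0 (addr_gt0 a0 b0).
have cf := conv_pw a b t; rewrite (betaE_Gamma a0 b0) in cf; rewrite /rlk.
move: (Gamma a) (Gamma b) (Gamma (a + b)) ga gb gab cf => A B C A0 B0 C0 cf.
have AB0 : 0 < A * B by exact: mulr_gt0.
under eq_integral => x _.
  rewrite (_ : _ * _ = (A * B)^-1 * (pw a x * pw b (t - x))); last first.
    by field; rewrite !gt_eqF.
  rewrite EFinM; over.
rewrite ge0_integralZl//; last 3 first.
- by apply/measurable_EFinP; apply: measurable_convf; exact: measurable_pw.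
- by move=> x _; rewrite lee_fin mulr_ge0// pw_ge0.
- by rewrite lee_fin invr_ge0 ltW.
rewrite [X in (_ * X)%E]cf -!EFinM; congr EFin.
by field; rewrite !gt_eqF.
Qed.

Lemma laplace_rlk b l : 0 < b -> 0 < l ->
  (\int[mu]_x (rlk b x * expR (- (l * x)))%:E = (l `^ (- b))%:E)%E.
Proof.
move=> b0 l0; have gb := Gamma_gt0 b0.
have : (Gamma b)%:E = (l%:E * \int[mu]_x (l `^ (b - 1) * Gamma b * (rlk b x * expR (- (l * x))))%:E)%E.
  rewrite GammaE// /gammaE (@ge0_integral_affine _ l 0)//; last 2 first.
  - by apply/measurable_EFinP; exact: measurable_pwexp.
  - by move=> x; rewrite lee_fin mulr_ge0 ?pw_ge0 ?expR_ge0.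
  congr (_ * _)%E; apply: eq_integral => x _; rewrite addr0 pwM//; congr EFin.
  by rewrite /rlk; field; rewrite !gt_eqF.
under eq_integral => x _ do rewrite EFinM.
have me : measurable_fun setT (fun x => rlk b x * expR (- (l * x))).
  apply: measurable_funM; first exact: measurable_rlk.
  by apply: measurableT_comp; [exact: measurable_expR|apply: measurableT_comp => //; exact: measurable_funM].
rewrite ge0_integralZl//; last 3 first.
- exact/measurable_EFinP.
- by move=> x _; rewrite lee_fin mulr_ge0 ?expR_ge0// rlk_ge0.
- by rewrite lee_fin mulr_ge0 ?powR_ge0// ltW.
rewrite muleA -EFinM mulrA -[X in X * (l `^ _)](powRr1 (ltW l0)) -powRD; last first.
  by rewrite (gt_eqF l0) implybT.
rewrite addrC subrK mulrC powRN => h.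
have lb : 0 < l `^ b by exact: powR_gt0.
have /(congr1 (fun z => (Gamma b * l `^ b)^-1%:E * z)%E) := h.
rewrite muleA -!EFinM mulVf ?mul1e; last by rewrite gt_eqF// mulr_gt0.
by move=> <-; congr EFin; field; rewrite !gt_eqF.
Qed.

End fractional_kernel.

(** * Bernstein approximation and uniqueness of moments *)

Section bernstein.
Context {R : realType}.
Implicit Types (f g : nat -> R) (u c : R) (n : nat).

(* [bern n f u] is the expectation of [f S] for [S] binomial of parameters
   [n] and [u]: the recursion conditions on the first trial, which avoids all
   computations with binomial coefficients. *)
Fixpoint bern n f u : R :=
  if n is n'.+1 then u * bern n' (f \o S) u + (1 - u) * bern n' f u else f 0%N.

Lemma bernD n f g u : bern n (fun k => f k + g k) u = bern n f u + bern n g u.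
Proof.
elim: n f g => [//|n IH] f g /=.
by rewrite -[_ \o S]/(fun k => (f \o S) k + (g \o S) k) !IH; ring.
Qed.

Lemma bernZ n f c u : bern n (fun k => c * f k) u = c * bern n f u.
Proof.
elim: n f => [//|n IH] f /=.
by rewrite -[_ \o S]/(fun k => c * (f \o S) k) !IH; ring.
Qed.

Lemma bern_cst n c u : bern n (fun=> c) u = c.
Proof. by elim: n => [//|n IH] /=; rewrite -[_ \o S]/(fun=> c) IH; ring. Qed.

(** The centre is arbitrary because composing with [S] moves it by one in the induction. For c = n u
    this is the binomial variance. *)
Lemma bern_sqr n c u :
  bern n (fun k => (k%:R - c) ^+ 2) u = (n%:R * u - c) ^+ 2 + n%:R * (u * (1 - u)).
Proof.
elim: n c => [|n IH] c /=; first by rewrite !mul0r addr0.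
have -> : (fun k => (k%:R - c) ^+ 2) \o S = (fun k : nat => (k%:R - (c - 1)) ^+ 2).
  by apply/funext => k /=; rewrite -natr1; ring.
by rewrite !IH -natr1; ring.
Qed.

Lemma ler_bern n f g u : 0 <= u <= 1 -> (forall k, (k <= n)%N -> f k <= g k) ->
  bern n f u <= bern n g u.
Proof.
move=> /andP[u0 u1]; elim: n f g => [|n IH] f g fg /=; first exact: fg.
apply: lerD; apply: ler_wpM2l; rewrite ?subr_ge0//; apply: IH => k kn /=.
  exact: fg.
by apply: fg; exact: leqW.
Qed.

Lemma ler_norm_bern n f u : 0 <= u <= 1 ->
  `|bern n f u| <= bern n (fun k => `|f k|) u.
Proof.
move=> u01; rewrite ler_norml -[- _]mulN1r -bernZ; apply/andP; split;
  apply: ler_bern => // k _; rewrite ?mulN1r; by [rewrite lerNl ler_normr lexx orbT|exact: ler_norm].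
Qed.

(** A binomial proportion over n trials fluctuates by about n^(-1/2), so (m+1)^2 trials give an
    error of order 1/(m+1). *)
Lemma bernstein_approx (h : R -> R) (L : R) m u : 0 <= L ->
  (forall x y, 0 <= x <= 1 -> 0 <= y <= 1 -> `|h x - h y| <= L * `|x - y|) ->
  0 <= u <= 1 ->
  `|h u - bern (m.+1 ^ 2) (fun k => h (k%:R / (m.+1 ^ 2)%:R)) u| <= 2 * L / m.+1%:R.
Proof.
move=> L0 hL u01; set n := (m.+1 ^ 2)%N.
have n0 : 0 < n%:R :> R by rewrite ltr0n expn_gt0.
have m0 : 0 < m.+1%:R :> R by rewrite ltr0n.
have nE : n%:R = m.+1%:R ^+ 2 :> R by rewrite natrX.
rewrite -[X in X - _](bern_cst n (h u) u) -[X in _ - X]mul1r -mulNr -bernZ -bernD.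
apply: le_trans (ler_norm_bern _ _ u01) _.
(* From y <= 1 + y^2 with y = (m+1) |u - k/n|: the distance is replaced by a quadratic function of
   k, whose mean [bern_sqr] evaluates. *)
pose g (k : nat) : R := L / m.+1%:R + L * m.+1%:R / n%:R ^+ 2 * (k%:R - n%:R * u) ^+ 2.
apply: (@le_trans _ _ (bern n g u)).
  apply: ler_bern => // k kn.
  rewrite mulN1r; apply: le_trans (hL _ _ u01 _) _.
    by rewrite divr_ge0//= ler_pdivrMr// mul1r ler_nat.
  rewrite /g (_ : _ + _ = L * (m.+1%:R^-1 + m.+1%:R * (u - k%:R / n%:R) ^+ 2)); last first.
    by field; rewrite !gt_eqF.
  apply: ler_wpM2l => //; set z := u - _.
  rewrite -(@ler_pM2l _ m.+1%:R)// mulrDr divff ?gt_eqF// mulrA -expr2 -exprMn.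
  rewrite (_ : (m.+1%:R * z) ^+ 2 = (m.+1%:R * `|z|) ^+ 2); last first.
    by rewrite !exprMn real_normK ?num_real.
  set y := _ * `|z|; rewrite -subr_ge0 (_ : _ - _ = (y - 2^-1) ^+ 2 + 3 / 4); last by field.
  by rewrite addr_ge0// ?sqr_ge0.
rewrite bernD bern_cst bernZ bern_sqr subrr expr0n/= add0r.
rewrite (_ : 2 * L / _ = L / m.+1%:R + L / m.+1%:R); last by ring.
rewrite lerD2l nE (_ : _ * _ = L / m.+1%:R * (u * (1 - u))); last by field; rewrite gt_eqF.
move: u01 => /andP[u0 u1]; rewrite ler_piMr ?divr_ge0// mulr_ile1 ?subr_ge0//.
by rewrite gerBl.
Qed.

End bernstein.

Lemma Rintegral_dist d (S : measurableType d) (R : realType)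
    (m : {measure set S -> \bar R}) (w f g : S -> R) (e : R) :
  m.-integrable setT (EFin \o w) -> m.-integrable setT (EFin \o (w \* f)%R) ->
  m.-integrable setT (EFin \o (w \* g)%R) ->
  (forall x, 0 <= w x) -> (forall x, `|f x - g x| <= e) ->
  `|\int[m]_x (w x * f x) - \int[m]_x (w x * g x)| <= e * \int[m]_x w x.
Proof.
move=> iw iwf iwg w0 fg.
have ifg : m.-integrable setT (EFin \o (fun x => w x * f x - w x * g x)).
  exact: (integrableB _ iwf iwg).
rewrite -RintegralB// -RintegralZl//.
apply: le_trans (le_normr_Rintegral _ _) _ => //.
apply: le_Rintegral => //.
- exact: integrable_norm.
- exact: (integrableZl _ e iw).
- by move=> x _; rewrite -mulrBr normrM ger0_norm// mulrC ler_wpM2r.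
Qed.

Section moment_uniqueness.
Context d1 d2 (S1 : measurableType d1) (S2 : measurableType d2) {R : realType}.
Variables (m1 : {measure set S1 -> \bar R}) (m2 : {measure set S2 -> \bar R}).
Variables (r1 u1 : S1 -> R) (r2 u2 : S2 -> R).
Hypotheses (mr1 : measurable_fun setT r1) (mr2 : measurable_fun setT r2).
Hypotheses (mu1 : measurable_fun setT u1) (mu2 : measurable_fun setT u2).
Hypotheses (r1_ge0 : forall x, 0 <= r1 x) (r2_ge0 : forall x, 0 <= r2 x).
Hypotheses (u1_01 : forall x, 0 <= u1 x <= 1) (u2_01 : forall x, 0 <= u2 x <= 1).
Hypothesis mom_fin : (\int[m1]_x (r1 x * u1 x)%:E < +oo)%E.
Hypothesis mom_eq : forall n,
  (\int[m1]_x (r1 x * u1 x ^+ n.+1)%:E = \int[m2]_x (r2 x * u2 x ^+ n.+1)%:E)%E.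

Let w1 (g : R -> R) x := r1 x * u1 x * g (u1 x).
Let w2 (g : R -> R) x := r2 x * u2 x * g (u2 x).

(** The test functions that the two weighted measures integrate alike. The class is enlarged from
    monomials to Bernstein polynomials, then to Lipschitz functions. *)
Let agree (g : R -> R) := [/\ m1.-integrable setT (EFin \o w1 g),
  m2.-integrable setT (EFin \o w2 g) &
  \int[m1]_x w1 g x = \int[m2]_x w2 g x].

Let agreeD f g : agree f -> agree g -> agree (f \+ g).
Proof.
move=> [f1 f2 fE] [g1 g2 gE].
have e1 : w1 (f \+ g) = w1 f \+ w1 g by apply/funext => x /=; rewrite /w1 mulrDr.
have e2 : w2 (f \+ g) = w2 f \+ w2 g by apply/funext => x /=; rewrite /w2 mulrDr.
split.
- by rewrite e1; exact: (integrableD _ f1 g1).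
- by rewrite e2; exact: (integrableD _ f2 g2).
- by rewrite e1 e2 !RintegralD// fE gE.
Qed.

Let agreeZ (c : R) f : agree f -> agree (fun x => c * f x).
Proof.
move=> [f1 f2 fE].
have e1 : w1 (fun x => c * f x) = fun x => c * w1 f x.
  by apply/funext => x; rewrite /w1; ring.
have e2 : w2 (fun x => c * f x) = fun x => c * w2 f x.
  by apply/funext => x; rewrite /w2; ring.
split.
- by rewrite e1; exact: (integrableZl _ c f1).
- by rewrite e2; exact: (integrableZl _ c f2).
- by rewrite e1 e2 !RintegralZl// fE.
Qed.

Let agreeX n : agree (fun x => x ^+ n).
Proof.
have le1 m : (\int[m1]_x (r1 x * u1 x ^+ m.+1)%:E < +oo)%E.
  apply: le_lt_trans mom_fin; apply: ge0_le_integral => //.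
  - by move=> x _; rewrite lee_fin mulr_ge0// exprn_ge0// (andP (u1_01 x)).1.
  - by apply/measurable_EFinP; apply: measurable_funM => //; exact: measurable_funX.
  - by apply/measurable_EFinP; exact: measurable_funM.
  - move=> x _; have /andP[u0 u1'] := u1_01 x.
    by rewrite lee_fin ler_wpM2l// exprS ler_piMr// exprn_ile1.
have e1 : w1 (fun x => x ^+ n) = fun x => r1 x * u1 x ^+ n.+1.
  by apply/funext => x; rewrite /w1 exprS mulrA.
have e2 : w2 (fun x => x ^+ n) = fun x => r2 x * u2 x ^+ n.+1.
  by apply/funext => x; rewrite /w2 exprS mulrA.
split.
- rewrite e1; apply/integrableP; split.
    by apply/measurable_EFinP; apply: measurable_funM => //; exact: measurable_funX.
  under eq_integral => x _.
    rewrite gee0_abs; last by rewrite lee_fin mulr_ge0// exprn_ge0// (andP (u1_01 x)).1.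
    over.
  exact: le1.
- rewrite e2; apply/integrableP; split.
    by apply/measurable_EFinP; apply: measurable_funM => //; exact: measurable_funX.
  under eq_integral => x _.
    rewrite gee0_abs; last by rewrite lee_fin mulr_ge0// exprn_ge0// (andP (u2_01 x)).1.
    over.
  by rewrite -mom_eq.
- by rewrite e1 e2 /Rintegral mom_eq.
Qed.

(** The power x^j is carried along because each step of the recursion multiplies by x or 1 - x. *)
Let agree_bern n j f : agree (fun x => x ^+ j * bern n f x).
Proof.
elim: n j f => [|n IH] j f /=.
  rewrite (_ : (fun _ => _) = fun x => f 0%N * x ^+ j); first exact: agreeZ.
  by apply/funext => x; rewrite mulrC.
rewrite (_ : (fun _ => _) = (fun x => x ^+ j.+1 * bern n (f \o S) x) \+
    ((fun x => x ^+ j * bern n f x) \+ (fun x => -1 * (x ^+ j.+1 * bern n f x)))).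
  by apply: agreeD => //; apply: agreeD => //; exact: agreeZ.
by apply/funext => x /=; rewrite exprS; ring.
Qed.

(** A Bernstein polynomial is uniformly within 2L/(m+1) of h, and both weighted measures have the
    same finite mass I, so the two integrals of h differ by at most 4LI/(m+1) for every m. *)
Let agree_lipschitz (h : R -> R) (L : R) : 0 <= L -> measurable_fun setT h ->
  (forall x y, 0 <= x <= 1 -> 0 <= y <= 1 -> `|h x - h y| <= L * `|x - y|) ->
  agree h.
Proof.
move=> L0 mh hL.
have hb x : 0 <= x <= 1 -> `|h x| <= `|h 0| + L.
  move=> x01; rewrite -[h x](subrK (h 0)) addrC (le_trans (ler_normD _ _))// lerD2l.
  apply: le_trans (hL _ _ x01 _) _; first by rewrite lexx ler01.
  by rewrite subr0 ler_piMr// ger0_norm; case/andP: x01.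
have [i1 i2 agE] := agreeX 0.
have ih1 : m1.-integrable setT (EFin \o w1 h).
  apply: (@le_integrable _ _ _ _ _ _ _ (EFin \o (fun x => (`|h 0| + L) * w1 (fun x => x ^+ 0) x))) => //.
  - apply/measurable_EFinP; apply: measurable_funM; first exact: measurable_funM.
    exact: measurableT_comp mh mu1.
  - move=> x _; rewrite /= lee_fin /w1 expr0 mulr1 mulrC !normrM.
    by rewrite !ler_wpM2r// (le_trans (hb _ (u1_01 x)))// ler_norm.
  - exact: (integrableZl _ (`|h 0| + L) i1).
have ih2 : m2.-integrable setT (EFin \o w2 h).
  apply: (@le_integrable _ _ _ _ _ _ _ (EFin \o (fun x => (`|h 0| + L) * w2 (fun x => x ^+ 0) x))) => //.
  - apply/measurable_EFinP; apply: measurable_funM; first exact: measurable_funM.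
    exact: measurableT_comp mh mu2.
  - move=> x _; rewrite /= lee_fin /w2 expr0 mulr1 mulrC !normrM.
    by rewrite !ler_wpM2r// (le_trans (hb _ (u2_01 x)))// ler_norm.
  - exact: (integrableZl _ (`|h 0| + L) i2).
split => //; apply/eqP; rewrite -subr_eq0 -normr_le0 leNgt; apply/negP.
set dd := `|_| => dd0.
set I := \int[m1]_x w1 (fun x => x ^+ 0) x.
have bound m : dd <= 2 * L / m.+1%:R * (2 * I).
  pose B := fun x => x ^+ 0 * bern (m.+1 ^ 2) (fun k => h (k%:R / (m.+1 ^ 2)%:R)) x.
  have [B1 B2 BE] : agree B by exact: agree_bern.
  have hB x : 0 <= x <= 1 -> `|h x - B x| <= 2 * L / m.+1%:R.
    by move=> x01; rewrite /B expr0 mul1r; exact: bernstein_approx.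
  have w1E : r1 \* u1 = w1 (fun x => x ^+ 0) by apply/funext => x; rewrite /w1 expr0 mulr1.
  have w2E : r2 \* u2 = w2 (fun x => x ^+ 0) by apply/funext => x; rewrite /w2 expr0 mulr1.
  have D1 := @Rintegral_dist _ _ _ m1 (r1 \* u1) (h \o u1) (B \o u1) (2 * L / m.+1%:R).
  have D2 := @Rintegral_dist _ _ _ m2 (r2 \* u2) (h \o u2) (B \o u2) (2 * L / m.+1%:R).
  have {}D1 : `|\int[m1]_x w1 h x - \int[m1]_x w1 B x| <= 2 * L / m.+1%:R * I.
    rewrite /I -w1E; apply: D1 => //; first by rewrite w1E.
      by move=> x; rewrite /= mulr_ge0// (andP (u1_01 x)).1.
    by move=> x; exact: hB.
  have {}D2 : `|\int[m2]_x w2 h x - \int[m2]_x w2 B x| <= 2 * L / m.+1%:R * I.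
    rewrite /I agE -w2E; apply: D2 => //; first by rewrite w2E.
      by move=> x; rewrite /= mulr_ge0// (andP (u2_01 x)).1.
    by move=> x; exact: hB.
  rewrite /dd mulrCA mulr2n mulrDl mul1r; apply: le_trans (lerD D1 D2).
  rewrite [`|\int[m2]_x w2 h x - _|]distrC -BE; apply: le_trans (ler_normD _ _).
  by rewrite addrA subrK.
have := truncnS_gt (2 * L * (2 * I) / dd).
rewrite ltr_pdivrMr// ltNge => /negP; apply.
have := bound (Num.truncn (2 * L * (2 * I) / dd)).
by rewrite mulrAC ler_pdivlMr ?ltr0n// mulrC.
Qed.

(** For a > 0 the product x * bump a n x increases to the indicator of x > a: the cap 1/x undoes the
    weight u, and the maximum with a keeps the function Lipschitz. *)
Let bump (a : R) (n : nat) (x : R) : R :=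
  Num.min (n%:R * Num.max (x - a) 0) (Num.max x a)^-1.

Let measurable_bump a n : 0 < a -> measurable_fun setT (bump a n).
Proof.
move=> a0; rewrite (_ : bump a n =
    fun x => Num.min (n%:R * Num.max (x - a) 0) (Num.max x a `^ (-1))); last first.
  by apply/funext => x; rewrite powR_inv1// le_max (ltW a0) orbT.
apply: measurable_minr.
  by apply: measurable_funM => //; apply: measurable_maxr => //; exact: measurable_funB.
apply: (measurableT_comp (measurable_powR (-1))).
exact: measurable_maxr.
Qed.

(** The ramp has slope n and 1/max(x, a) has Lipschitz constant a^-2. It suffices to bound one value
    by the other plus the error and to exchange x and y. *)
Let bump_lipschitz a n x y : 0 < a ->
  `|bump a n x - bump a n y| <= (n%:R + a ^- 2) * `|x - y|.
Proof.
move=> a0; pose K := n%:R + a ^- 2.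
have a2 : 0 <= a ^- 2 by rewrite invr_ge0 exprn_ge0 ?(ltW a0).
have one z t : bump a n z <= bump a n t + K * `|z - t|.
  rewrite {2}/bump minEle; case: ifP => _.
    apply: (@le_trans _ _ (n%:R * Num.max (z - a) 0)); first by rewrite /bump ge_min lexx.
    apply: (@le_trans _ _ (n%:R * (Num.max (t - a) 0 + `|z - t|))).
      apply: ler_wpM2l => //; rewrite ge_max; apply/andP; split.
        rewrite (_ : z - a = (t - a) + (z - t)); last by ring.
        by apply: lerD; rewrite ?le_max ?lexx// ler_norm.
      by rewrite addr_ge0// le_max lexx orbT.
    by rewrite mulrDr lerD2l ler_wpM2r// lerDl.
  apply: (@le_trans _ _ (Num.max z a)^-1); first by rewrite /bump ge_min lexx orbT.
  have mz : 0 < Num.max z a by rewrite lt_max a0 orbT.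
  have mt : 0 < Num.max t a by rewrite lt_max a0 orbT.
  rewrite -lerBlDl (_ : _ - _ = (Num.max z a * Num.max t a)^-1 * (Num.max t a - Num.max z a)); last first.
    by field; rewrite !gt_eqF.
  have d : Num.max t a - Num.max z a <= `|z - t|.
    rewrite lerBlDr ge_max; apply/andP; split.
      rewrite distrC -[leLHS](subrK z); apply: lerD; first exact: ler_norm.
      by rewrite le_max lexx.
    by rewrite ler_wpDl// le_max lexx orbT.
  apply: (@le_trans _ _ (a ^- 2 * `|z - t|)); last by rewrite ler_wpM2r// lerDr.
  apply: (@le_trans _ _ ((Num.max z a * Num.max t a)^-1 * `|z - t|)).
    by rewrite ler_wpM2l// invr_ge0 mulr_ge0// ltW.
  rewrite ler_wpM2r// lef_pV2 ?posrE ?mulr_gt0// ?exprn_gt0// expr2.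
  by rewrite ler_pM// ?(ltW a0)// le_max lexx orbT.
have h1 := one x y; have h2 := one y x; rewrite [`|y - x|]distrC in h2.
by rewrite ler_norml -/K; apply/andP; split; lra.
Qed.

Let bump_le a n x : 0 < a -> 0 <= bump a n x.
Proof.
move=> a0; rewrite /bump le_min mulr_ge0 ?le_max ?lexx ?orbT//=.
by rewrite invr_ge0 le_max (ltW a0) orbT.
Qed.

Let bump_cvg a x : 0 < a -> x * bump a n x @[n --> \oo] --> ((a < x)%R%:R : R).
Proof.
move=> a0; have [ax|xa] := ltP a x; last first.
  rewrite (_ : (fun _ => _) = fun=> 0); first exact: cvg_cst.
  apply/funext => n; rewrite /bump [Num.max (x - a) 0]max_r ?subr_le0// mulr0.
  by rewrite min_l ?mulr0// invr_ge0 le_max (ltW a0) orbT.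
have x0 : 0 < x by exact: lt_trans ax.
have xa : 0 < x - a by rewrite subr_gt0.
apply: (@cvg_near_cst _ _ _ _ _ _); near=> n.
rewrite /bump [Num.max (x - a) 0]max_l ?(ltW xa)// [Num.max x a]max_l ?(ltW ax)//.
rewrite min_r ?divff ?gt_eqF// -ler_pdivrMr//.
by near: n; exact: nbhs_infty_ger.
Unshelve. all: by end_near. Qed.

Let bump_nd a x : 0 < a -> {homo bump a ^~ x : n m / (n <= m)%N >-> n <= m}.
Proof.
move=> a0 n m nm; rewrite /bump le_min ge_min ge_min lexx orbT andbT.
by rewrite ler_wpM2r ?ler_nat// le_max lexx orbT.
Qed.

(* Weighting by [u] keeps the measures [r u dm] finite although [m] is not. *)
Lemma moments_unique a : 0 < a ->
  (\int[m1]_x (r1 x * (a < u1 x)%R%:R)%:E = \int[m2]_x (r2 x * (a < u2 x)%R%:R)%:E)%E.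
Proof.
move=> a0.
have ag n : agree (bump a n).
  apply: (@agree_lipschitz _ (n%:R + a ^- 2)).
  - by rewrite addr_ge0// invr_ge0 exprn_ge0// ltW.
  - exact: measurable_bump.
  - by move=> x y _ _; exact: bump_lipschitz.
have cv d (S : measurableType d) (m : {measure set S -> \bar R}) (r u : S -> R) :
    measurable_fun setT r -> measurable_fun setT u ->
    (forall x, 0 <= r x) -> (forall x, 0 <= u x <= 1) ->
    (\int[m]_x (r x * u x * bump a n (u x))%:E @[n --> \oo] -->
     \int[m]_x (r x * (a < u x)%R%:R)%:E)%E.
  move=> mr mu r0 u0.
  rewrite (_ : (\int[m]_x (r x * (a < u x)%R%:R)%:E)%E =
     (\int[m]_x (fun x => limn (fun n => (r x * u x * bump a n (u x))%:E)) x)%E).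
    apply: cvg_monotone_convergence => //.
    - move=> n; apply/measurable_EFinP; apply: measurable_funM; first exact: measurable_funM.
      by apply: (measurableT_comp _ mu); exact: measurable_bump.
    - by move=> n x _; rewrite lee_fin !mulr_ge0 ?bump_le// (andP (u0 x)).1.
    - move=> x _ i j ij; rewrite lee_fin ler_wpM2l ?bump_nd//.
      by rewrite mulr_ge0// (andP (u0 x)).1.
  apply: eq_integral => x _; apply/esym/cvg_lim => //.
  apply: cvg_EFin; first by near=> n.
  under eq_fun do rewrite -mulrA.
  by apply: cvgMr; exact: bump_cvg.
have c1 := cv _ _ m1 _ _ mr1 mu1 r1_ge0 u1_01.
have c2 := cv _ _ m2 _ _ mr2 mu2 r2_ge0 u2_01.
apply: (cvg_unique (@ereal_hausdorff R) c1).
rewrite (_ : (fun n => _) = (fun n => \int[m2]_x (r2 x * u2 x * bump a n (u2 x))%:E)%E)//.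
apply/funext => n; have [i1 i2 i3] := ag n; have := congr1 EFin i3.
by rewrite /Rintegral !fineK//; exact: integrable_fin_num.
Unshelve. all: by end_near. Qed.

End moment_uniqueness.

(** * Joint measurability of right-continuous processes, and independence *)

Section countable_cases.
Context d (S : measurableType d) (R : realType).

Lemma measurable_fun_countable_cases (N : S -> nat) (F : nat -> S -> R) :
  (forall k, measurable (N @^-1` [set k])) ->
  (forall k, measurable_fun setT (F k)) ->
  measurable_fun setT (fun z => F (N z) z).
Proof.
move=> mN mF _ Y mY; rewrite setTI.
rewrite (_ : _ @^-1` _ = \bigcup_k ((N @^-1` [set k]) `&` F k @^-1` Y)).
  apply: bigcupT_measurable => k; apply: measurableI => //.
  by rewrite -[X in measurable X]setTI; exact: mF.
by apply/seteqP; split => z /= => [Yz|[k _ [->]]//]; exists (N z).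
Qed.

End countable_cases.

Section right_continuous.
Context d (S : measurableType d) (R : realType).

Lemma cvg_truncn_right (x : R) : 0 <= x ->
  (Num.truncn (n.+1%:R * x)).+1%:R / n.+1%:R @[n --> \oo] --> x.
Proof.
move=> x0.
apply: (@squeeze_cvgr _ _ _ _ (fun=> x) (fun n => x + n.+1%:R^-1)).
- near=> n; have nx : 0 <= n.+1%:R * x by rewrite mulr_ge0.
  have /andP[h1 h2] := truncn_itv nx.
  rewrite ler_pdivlMr ?ltr0n// ler_pdivrMr ?ltr0n// mulrDl mulVf//.
  by rewrite mulrC (ltW h2)/= mulrC -natr1 lerD2r mulrC.
- exact: cvg_cst.
- by rewrite -[X in _ --> X]addr0; apply: cvgD; [exact: cvg_cst|exact: cvg_harmonic].
Unshelve. all: by end_near. Qed.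

(** Reading the path at the first point of the grid of mesh 1/(n+1) strictly to the right of |x|
    gives a function with countably many measurable cases; right continuity gives the limit. *)
Lemma measurable_right_continuous (X : R -> S -> R) :
  (forall t, 0 <= t -> measurable_fun setT (X t)) ->
  (forall s t, 0 <= t -> X ^~ s @ t^'+ --> X t s) ->
  measurable_fun setT (fun z : R * S => X `|z.1| z.2).
Proof.
move=> mX rX.
pose a n k : R := k.+1%:R / n.+1%:R.
apply: (@measurable_fun_cvg _ _ _ _
  (fun n (z : R * S) => X (a n (Num.truncn (n.+1%:R * `|z.1|))) z.2)).
- move=> n; apply: (@measurable_fun_countable_cases _ (R * S)%type _
    (fun z => Num.truncn (n.+1%:R * `|z.1|)) (fun k z => X (a n k) z.2)).
    move=> k; rewrite (_ : _ @^-1` _ =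
        (fun z : R * S => n.+1%:R * `|z.1|) @^-1` `[k%:R, k.+1%:R[%classic); last first.
      apply/seteqP; split => z /=; have h : 0 <= n.+1%:R * `|z.1| by rewrite mulr_ge0.
        by move=> <-; rewrite in_itv/= truncn_itv.
      by rewrite in_itv/= => /truncn_def.
    rewrite -[X in measurable X]setTI.
    have : measurable_fun setT (fun z : R * S => n.+1%:R * `|z.1|).
      by apply: measurable_funM => //; exact: measurableT_comp.
    by apply => //; exact: measurable_itv.
  move=> k; apply: (measurableT_comp (mX _ _)); last exact: measurable_snd.
  by rewrite divr_ge0.
- move=> [x s] _ /=; have /cvg_at_rightP := rX s _ (normr_ge0 x); apply; split.
    move=> n; rewrite ltr_pdivlMr ?ltr0n// mulrC.
    by have /andP[] := truncn_itv (mulr_ge0 (ler0n R n.+1) (normr_ge0 x)).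
  exact: cvg_truncn_right.
Qed.

End right_continuous.

Section independence.
Context d d1 d2 (T : measurableType d) (T1 : measurableType d1) (T2 : measurableType d2).
Context (R : realType) (P : probability T R).
Variables (X : {mfun T >-> T1}) (Y : {mfun T >-> T2}).

Let XY w := (X w, Y w).
Let mXY : measurable_fun setT XY.
Proof. exact: measurable_fun_pair. Qed.
Let XY_mixin := isMeasurableFun.Build _ _ _ _ _ mXY.
Let XY_pack : {mfun T >-> (T1 * T2)%type} := HB.pack XY XY_mixin.

(** Independence says that the law of the pair is the product of the two laws; Tonelli does the
    rest. *)
Lemma indep_integral (phi : T1 * T2 -> \bar R) :
  (forall A B, measurable A -> measurable B ->
    P (X @^-1` A `&` Y @^-1` B) = P (X @^-1` A) * P (Y @^-1` B))%E ->
  measurable_fun setT phi -> (forall z, 0 <= phi z)%E ->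
  (\int[P]_w phi (X w, Y w) = \int[P]_w' \int[P]_w phi (X w, Y w'))%E.
Proof.
move=> ind mphi phi0.
have -> : (\int[P]_w phi (X w, Y w) = \int[distribution P XY_pack]_z phi z)%E.
  by rewrite ge0_integral_distribution.
transitivity (\int[(distribution P X \x distribution P Y)%E]_z phi z)%E.
  apply: eq_measure_integral => A mA _; apply/esym.
  apply: (@product_measure_unique _ _ _ _ _ (distribution P X) (distribution P Y)
    (distribution P XY_pack)) => // A1 A2; exact: ind.
rewrite fubini_tonelli2// ge0_integral_distribution//; last 2 first.
- exact: measurable_fun_fubini_tonelli_G.
- by move=> y; apply: integral_ge0.
apply: eq_integral => w' _ /=; rewrite /fubini_G.
rewrite (@ge0_integral_distribution _ _ _ _ _ _ X (fun x => phi (x, Y w')))//.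
exact: measurableT_comp.
Qed.

End independence.

(** Fatou's lemma gives one inequality and the domination by the limit gives the other. *)
Lemma integral_cvg_below d (S : measurableType d) (R : realType)
    (m : {measure set S -> \bar R}) (f_ : (S -> \bar R)^nat) (f : S -> \bar R) (L : \bar R) :
  (forall n, measurable_fun setT (f_ n)) -> measurable_fun setT f ->
  (forall n x, 0 <= f_ n x <= f x)%E -> (forall x, f_ n x @[n --> \oo] --> f x) ->
  (\int[m]_x f_ n x @[n --> \oo] --> L)%E -> (\int[m]_x f x = L)%E.
Proof.
move=> mf_ mf f_f cf cL; apply/le_anti/andP; split.
  have := @fatou _ _ _ m _ measurableT f_ mf_ (fun n x _ => (andP (f_f n x)).1).
  rewrite (cvg_limn_einf_sup cL).1; apply: le_trans.
  rewrite le_eqVlt; apply/orP; left; apply/eqP/eq_integral => x _.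
  by rewrite (cvg_limn_einf_sup (cf x)).1.
apply: (cvge_le _ cL); near=> n; apply: ge0_le_integral => // x _.
- by have /andP[] := f_f n x.
- by have /andP[] := f_f n x.
Unshelve. all: by end_near. Qed.

Lemma ge0_ae_integral d (T : measurableType d) (R : realType)
    (m : {measure set T -> \bar R}) (f g : T -> \bar R) :
  measurable_fun setT f -> measurable_fun setT g ->
  (forall x, 0 <= f x)%E -> (forall x, 0 <= g x)%E ->
  {ae m, forall x, f x = g x} -> (\int[m]_x f x = \int[m]_x g x)%E.
Proof.
move=> mf mg f0 g0 fg; apply: ge0_ae_eq_integral => //.
by apply: filterS fg => x fgx _.
Qed.

(** * Levy processes *)

Section levy.
Context d (T : measurableType d) (R : realType) (P : probability T R).
Variable X : R -> {RV P >-> R}.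
Hypothesis hX : levy_process X.

Lemma measurable_joint_levy : measurable_fun setT (fun z : R * T => X `|z.1| z.2).
Proof.
apply: (@measurable_right_continuous _ _ _ (fun t => X t : T -> R)) => //.
exact: levy_right_continuous hX.
Qed.

(** Independence concerns the increment X s - X 0, whereas X 0 vanishes only almost surely. *)
Lemma levy_start_at0 (f : R -> \bar R) (Y : T -> R) :
  measurable_fun setT Y -> measurable_fun setT f -> (forall x, 0 <= f x)%E ->
  (\int[P]_w f (Y w - X 0 w)%R = \int[P]_w f (Y w))%E.
Proof.
move=> mY mf f0; apply: ge0_ae_integral => //.
- by apply: (measurableT_comp mf); exact: measurable_funB.
- exact: measurableT_comp.
- by apply: filterS (levy_start hX) => w ->; rewrite subr0.
Qed.

Lemma levy_increment (s h : R) (f : R -> \bar R) : 0 <= s -> 0 <= h ->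
  measurable_fun setT f -> (forall x, 0 <= f x)%E ->
  (\int[P]_w f (X (s + h)%R w - X s w)%R = \int[P]_w f (X h w))%E.
Proof.
move=> s0 h0 mf f0.
rewrite -[RHS]levy_start_at0//.
have mB a b : measurable_fun setT (fun w => X a w - X b w) by exact: measurable_funB.
rewrite -[LHS](@ge0_integral_pushforward _ _ _ _ _ _ (mB (s + h) s) P setT f)//.
rewrite -[RHS](@ge0_integral_pushforward _ _ _ _ _ _ (mB h 0) P setT f)//.
apply: eq_measure_integral => A mA _; rewrite /pushforward.
by have := levy_stationary hX s0 (lexx 0) h0 mA; rewrite add0r.
Qed.

Lemma levy_indep2 (s h : R) (A B : set R) : 0 < s -> 0 < h ->
  measurable A -> measurable B ->
  (P ((fun w => X (s + h)%R w - X s w)%R @^-1` A `&` (fun w => X s w - X 0 w)%R @^-1` B) =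
   P ((fun w => X (s + h)%R w - X s w)%R @^-1` A) * P ((fun w => X s w - X 0 w)%R @^-1` B))%E.
Proof.
move=> s0 h0 mA mB.
(* The partition 0 < s < s + h, with its two increments. *)
pose t (n : nat) : R := if n is n'.+1 then (if n' is _.+1 then s + h else s) else 0.
have := @levy_indep _ _ _ _ _ hX 2 t (lexx 0).
have tlt (i : nat) : (i < 2)%N -> t i < t i.+1.
  by case: i => [|[|]]//= _; rewrite ?ltrDl.
move=> /(_ tlt [set: 'I_2]%SET (fun i : 'I_2 => if val i == 0%N then B else A)).
have mC (i : 'I_2) : measurable (if val i == 0%N then B else A) by case: ifP.
move=> /(_ mC).
rewrite (eq_bigl xpredT) => [|i]; last by rewrite inE.
rewrite big_ord_recl big_ord1 /= => h2; rewrite muleC; apply: etrans h2; congr (P _).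
apply/seteqP; split => w /=.
  by move=> [Aw Bw] [[|[|]]//= i _ _].
by move=> h1; split; [apply: (h1 (lift ord0 ord0))|apply: (h1 ord0)]; rewrite /= inE.
Qed.

(** The Markov property at time s: the outer integral carries the past, and the inner one a fresh
    increment distributed as X h. *)
Lemma levy_split (s h : R) (phi : R * R -> \bar R) : 0 < s -> 0 < h ->
  measurable_fun setT phi -> (forall z, 0 <= phi z)%E ->
  (\int[P]_w phi (X s w, X (s + h)%R w) =
   \int[P]_w' \int[P]_w phi (X s w', (X s w' + X h w)%R))%E.
Proof.
move=> s0 h0 mphi phi0.
have mB a b : measurable_fun setT (fun w => X a w - X b w) by exact: measurable_funB.
pose Z1 : {mfun T >-> R} := HB.pack (fun w => X (s + h) w - X s w)
  (isMeasurableFun.Build _ _ _ _ _ (mB (s + h) s)).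
pose Z2 : {mfun T >-> R} := HB.pack (fun w => X s w - X 0 w)
  (isMeasurableFun.Build _ _ _ _ _ (mB s 0)).
pose psi (z : R * R) := phi (z.2, z.2 + z.1).
have mpsi : measurable_fun setT psi.
  apply: (measurableT_comp mphi); apply: measurable_fun_pair; first exact: measurable_snd.
  by apply: measurable_funD; [exact: measurable_snd|exact: measurable_fst].
have ind := @indep_integral _ _ _ _ _ _ _ P Z1 Z2 psi.
transitivity (\int[P]_w psi (Z1 w, Z2 w))%E.
  apply: ge0_ae_integral => //.
  - by apply: (measurableT_comp mphi); exact: measurable_fun_pair.
  - by apply: (measurableT_comp mpsi); exact: measurable_fun_pair.
  - by move=> w; exact: phi0.
  - apply: filterS (levy_start hX) => w /= X0.
    by rewrite /psi /= X0 subr0 [X s w + _]addrC subrK.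
rewrite ind; last 3 first.
- by move=> A B mA mB'; exact: (levy_indep2 s0 h0 mA mB').
- exact: mpsi.
- by move=> z; exact: phi0.
transitivity (\int[P]_w' \int[P]_w psi (X h w, Z2 w'))%E.
  apply: eq_integral => w' _.
  apply: (@levy_increment s h (fun x => psi (x, Z2 w'))); [exact: ltW|exact: ltW| |].
    by apply: (measurableT_comp mpsi); exact: measurable_fun_pair.
  by move=> x; exact: phi0.
have mh : measurable_fun setT (fun z : R => \int[P]_w psi (X h w, z))%E.
  apply: (@measurable_fun_fubini_tonelli_G _ _ T _ R P (fun z : T * R => psi (X h z.1, z.2))); last by move=> z; exact: phi0.
  apply: (measurableT_comp mpsi); apply: measurable_fun_pair => //.
  by apply: measurableT_comp => //.
apply: (@levy_start_at0 (fun z => \int[P]_w psi (X h w, z))%E (X s)) => //.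
by move=> x; apply: integral_ge0 => w _; exact: phi0.
Qed.

End levy.

Lemma ae_measure_eq d (T : measurableType d) (R : realType)
    (m : {measure set T -> \bar R}) (A B : set T) :
  measurable A -> measurable B -> {ae m, forall w, A w <-> B w} -> m A = m B.
Proof.
move=> mA mB AB; rewrite -[A]setIT -[B]setIT -!integral_indic//.
apply: ge0_ae_integral.
- by apply/measurable_EFinP; exact: measurable_indic.
- by apply/measurable_EFinP; exact: measurable_indic.
- by move=> w; rewrite lee_fin.
- by move=> w; rewrite lee_fin.
- apply: filterS AB => w AB; congr EFin; rewrite !indicE; congr ((_ : bool)%:R).
  by apply/idP/idP => /set_mem h; apply/mem_set/AB.
Qed.

(** * The Laplace transform of the counting process *)

Section exponential_estimates.
Context {R : realType}.
Implicit Types x y : R.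

Lemma expRN_lower x : 1 - x <= expR (- x).
Proof. exact: expR_ge1Dx. Qed.

(** From exp(-x) <= 1/(1 + x) and (1 - x + x^2)(1 + x) = 1 + x^3 >= 1. *)
Lemma expRN_upper x : 0 <= x -> expR (- x) <= 1 - x + x ^+ 2.
Proof.
move=> x0; have x1 : 0 < 1 + x by rewrite ltr_pwDl.
rewrite expRN; apply: (@le_trans _ _ (1 + x)^-1).
  by rewrite lef_pV2 ?posrE ?expR_gt0// expR_ge1Dx.
rewrite -[leLHS]mul1r ler_pdivrMr// (_ : _ * _ = 1 + x ^+ 3); last by ring.
by rewrite lerDl exprn_ge0.
Qed.

Lemma ler_norm_subrX (a b : R) n : 0 <= a <= 1 -> 0 <= b <= 1 ->
  `|a ^+ n - b ^+ n| <= n%:R * `|a - b|.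
Proof.
move=> /andP[a0 a1] /andP[b0 b1]; elim: n => [|n IH].
  by rewrite !expr0 subrr normr0 mul0r.
rewrite !exprS (_ : _ - _ = a * (a ^+ n - b ^+ n) + b ^+ n * (a - b)); last by ring.
rewrite (le_trans (ler_normD _ _))// -natr1 mulrDl mul1r; apply: lerD.
  by rewrite normrM ger0_norm// (le_trans _ IH)// ler_piMl.
by rewrite normrM ger0_norm ?exprn_ge0// ler_piMl// exprn_ile1.
Qed.

Lemma cvg_scaled_1BexpRN (N a : nat -> R) (L : R) : (forall n, 0 <= N n) ->
  (forall n, 0 <= a n) -> a n @[n --> \oo] --> 0 -> N n * a n @[n --> \oo] --> L ->
  N n * (1 - expR (- a n)) @[n --> \oo] --> L.
Proof.
move=> N0 a0 ca cNa.
apply: (@squeeze_cvgr _ _ _ _ (fun n => N n * a n - N n * a n * a n) (fun n => N n * a n)) => //.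
- near=> n; apply/andP; split.
    rewrite -mulrA -mulrBr ler_wpM2l//.
    by have := expRN_upper (a0 n); rewrite expr2; lra.
  by rewrite ler_wpM2l//; have := expRN_lower (a n); lra.
- rewrite -[X in _ --> X]subr0 -[X in _ - X](mulr0 L).
  by apply: cvgB => //; exact: cvgM.
Unshelve. all: by end_near. Qed.

Lemma cvg_invn (x : R) : x / n.+1%:R @[n --> \oo] --> 0.
Proof. by rewrite -(mulr0 x); apply: cvgMr; exact: cvg_harmonic. Qed.

Lemma cvg_1BexpRN (x : R) : 0 <= x ->
  n.+1%:R * (1 - expR (- (x / n.+1%:R))) @[n --> \oo] --> x.
Proof.
move=> x0; apply: cvg_scaled_1BexpRN => //.
- by move=> n; rewrite divr_ge0.
- exact: cvg_invn.
- rewrite (_ : (fun _ => _) = fun=> x); first exact: cvg_cst.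
  by apply/funext => n; rewrite mulrC divfK.
Qed.

End exponential_estimates.

Section counting_process.
Context d (T : measurableType d) (R : realType) (P : probability T R).
Variables (k : nat) (lam : nat -> R) (M : R -> {RV P >-> R}).
Hypothesis hlam : forall j : nat, (1 <= j <= k)%N -> 0 < lam j.
Hypothesis hM : generalized_counting_process k lam M.

Lemma counting_ge0 t w : 0 <= t -> 0 <= M t w.
Proof. by move=> t0; exact: natr_ge0 (gcp_nat hM w t0). Qed.

Let lap th t : R := \int[P]_w expR (- (th * M t w)).

Let measurable_explap th t : measurable_fun setT (fun w => expR (- (th * M t w))).
Proof.
apply: (measurableT_comp (@measurable_expR R)); apply: measurableT_comp => //.
by apply: measurable_funM => //; exact: measurable_funP.
Qed.

Let explap_01 th t w : 0 <= th -> 0 <= t -> 0 <= expR (- (th * M t w)) <= 1.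
Proof.
move=> th0 t0; rewrite expR_ge0/= expR_le1 oppr_le0 mulr_ge0//.
exact: counting_ge0.
Qed.

Let lap_le1 th t : 0 <= th -> 0 <= t -> (\int[P]_w (expR (- (th * M t w)))%:E <= 1)%E.
Proof.
move=> th0 t0; rewrite -(@probability_setT _ _ _ P) -[P setT]mul1e -integral_cst//.
apply: ge0_le_integral => //.
- by apply/measurable_EFinP; exact: measurable_explap.
- by move=> w _; rewrite lee_fin; case/andP: (explap_01 w th0 t0).
Qed.

Let lapE th t : 0 <= th -> 0 <= t ->
  (\int[P]_w (expR (- (th * M t w)))%:E = (lap th t)%:E)%E.
Proof.
move=> th0 t0; rewrite /lap /Rintegral fineK// ge0_fin_numE.
  by rewrite (le_lt_trans (lap_le1 th0 t0))// ltry.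
by apply: integral_ge0 => w _; rewrite lee_fin expR_ge0.
Qed.

Let lap_01 th t : 0 <= th -> 0 <= t -> 0 <= lap th t <= 1.
Proof.
move=> th0 t0; rewrite -!lee_fin -lapE// lap_le1// andbT.
by apply: integral_ge0 => w _; rewrite lee_fin expR_ge0.
Qed.

Let lapD th s h : 0 <= th -> 0 < s -> 0 < h ->
  lap th (s + h) = lap th s * lap th h.
Proof.
move=> th0 s0 h0; apply/EFin_inj.
have [s0' h0'] := (ltW s0, ltW h0).
rewrite EFinM -!lapE ?addr_ge0//.
have mphi : measurable_fun setT (fun z : R * R => (expR (- (th * z.2)))%:E).
  apply/measurable_EFinP; apply: (measurableT_comp (@measurable_expR R)).
  by apply: measurableT_comp => //; apply: measurable_funM => //; exact: measurable_snd.
rewrite (levy_split (gcp_levy hM) s0 h0 mphi); last by move=> z; rewrite lee_fin expR_ge0.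
have lap0 : (0 <= \int[P]_w (expR (- (th * M h w)))%:E)%E.
  by apply: integral_ge0 => w _; rewrite lee_fin expR_ge0.
have ml t : measurable_fun setT (fun w => (expR (- (th * M t w)))%:E).
  by apply/measurable_EFinP; exact: measurable_explap.
have l0 t w : (0 <= (expR (- (th * M t w)))%:E)%E by rewrite lee_fin expR_ge0.
rewrite /= muleC -(ge0_integralZl _ measurableT (ml s) (fun w _ => l0 s w) lap0).
apply: eq_integral => w' _.
rewrite muleC -(ge0_integralZl _ measurableT (ml h) (fun w _ => l0 h w) (l0 s w')).
by apply: eq_integral => w _; rewrite -EFinM -expRD; congr (expR _)%:E; ring.
Qed.

Let lapX th h n : 0 <= th -> 0 < h -> lap th (n.+1%:R * h) = lap th h ^+ n.+1.
Proof.
move=> th0 h0; elim: n => [|n IH]; first by rewrite mul1r expr1.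
by rewrite -natr1 mulrDl mul1r lapD ?mulr_gt0// IH [RHS]exprSr.
Qed.

Let p j h : R := fine (P [set w | M h w = j%:R]).

Let measurable_level j h : measurable [set w | M h w = j%:R].
Proof.
by rewrite (_ : [set w | _] = M h @^-1` [set j%:R]).
Qed.

Let start1 : P [set w | M 0 w = 0] = 1%E.
Proof.
rewrite -(@probability_setT _ _ _ P); apply: ae_measure_eq => //.
  exact: (measurable_level 0).
by apply: filterS (levy_start (gcp_levy hM)).
Qed.

(** The rates are conditional on M t = n. For t = n = 0 the conditioning event has probability one,
    so they describe the law of M h itself. *)
Let transition_near j e : 0 < e ->
  \forall h \near 0^'+, `|p j h - gcp_transition k lam j h| <= e * h.
Proof.
move=> e0.
have P0 : (0 < P [set w | M 0 w = 0%:R])%E by rewrite start1.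
have /eqoP/(_ e e0) := gcp_rates hM j (lexx 0) P0.
move=> hn; near=> h.
have h0 : 0 < h by near: h; exact: nbhs_right_gt.
have : `|cond_prob P [set w | M (0 + h) w = (0 + j)%:R] [set w | M 0 w = 0%:R]
    - gcp_transition k lam j h| <= e * `|h| by near: h.
rewrite (ger0_norm (ltW h0)) add0r add0n /cond_prob start1 divr1.
rewrite (_ : P (_ `&` _) = P [set w | M h w = j%:R])//.
apply: ae_measure_eq => //.
  by apply: measurableI => //; exact: (measurable_level 0).
by apply: filterS (levy_start (gcp_levy hM)) => w /= M0; split => [[]|].
Unshelve. all: by end_near. Qed.

Let pE j h : (p j h)%:E = P [set w | M h w = j%:R].
Proof. by rewrite fineK// fin_num_measure. Qed.

Let sum_levels (c : nat -> R) h : (forall j, 0 <= c j) ->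
  (\int[P]_w (\sum_(j < k.+1) c j * \1_[set w | M h w = j%:R] w)%:E =
   (\sum_(j < k.+1) c j * p j h)%:E)%E.
Proof.
move=> c0; rewrite -sumEFin.
under eq_integral do rewrite -sumEFin.
rewrite ge0_integral_sum//.
- apply: eq_bigr => j _; rewrite EFinM pE.
  under eq_integral do rewrite EFinM.
  rewrite ge0_integralZl//; first by rewrite integral_indic// setIT.
    by apply/measurable_EFinP; exact: measurable_indic.
  by rewrite lee_fin.
- by move=> j; apply/measurable_EFinP; apply: measurable_funM => //; exact: measurable_indic.
- by move=> j w _; rewrite lee_fin mulr_ge0.
Qed.

Let measurable_sum_levels (c : nat -> R) h :
  measurable_fun setT (fun w => \sum_(j < k.+1) c j * \1_[set w | M h w = j%:R] w).
Proof.
apply: measurable_sum => j; apply: measurable_funM => //; exact: measurable_indic.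
Qed.

Let sum_levels_pt (c : nat -> R) h w : (forall j, 0 <= c j) ->
  (exists2 j : nat, (j <= k)%N /\ M h w = j%:R &
     \sum_(j < k.+1) c j * \1_[set w | M h w = j%:R] w = c j) \/
  \sum_(j < k.+1) c j * \1_[set w | M h w = j%:R] w = 0.
Proof.
move=> c0.
have [[j jk Mj]|none] := pselect (exists2 j : nat, (j <= k)%N & M h w = j%:R).
  left; exists j; first by [].
  have jk' : (j < k.+1)%N by [].
  rewrite (bigD1 (Ordinal jk'))//= big1 ?addr0.
    by rewrite indicE mem_set// mulr1.
  move=> i ij; rewrite indicE memNset ?mulr0//= => Mi.
  move: ij; rewrite -val_eqE/=; move: Mj; rewrite Mi => /eqP.
  by rewrite eqr_nat => /eqP ->; rewrite eqxx.
right; rewrite big1// => i _; rewrite indicE memNset ?mulr0//= => Mi.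
by apply: none; exists i => //; rewrite -ltnS.
Qed.

Let ce th (j : nat) : R := expR (- (th * j%:R)).

Let ce_01 th j : 0 <= th -> 0 <= ce th j <= 1.
Proof. by move=> th0; rewrite expR_ge0 expR_le1 oppr_le0 mulr_ge0. Qed.

(** Dropping the states above k bounds the Laplace transform from below. Together with [lap_upper]
    it gives a two-sided estimate without any bound on the probability of those states. *)
Let lap_lower th h : 0 <= th -> 0 <= h -> \sum_(j < k.+1) ce th j * p j h <= lap th h.
Proof.
move=> th0 h0.
have c0 j : 0 <= ce th j by case/andP: (ce_01 j th0).
rewrite -lee_fin -sum_levels// -lapE//; apply: ge0_le_integral => //.
- by move=> w _; rewrite lee_fin sumr_ge0// => j _; rewrite mulr_ge0.
- by apply/measurable_EFinP; exact: measurable_sum_levels.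
- by apply/measurable_EFinP; exact: measurable_explap.
move=> w _; rewrite lee_fin; have [[j [_ Mj] ->]| ->] := sum_levels_pt h w c0.
  by rewrite /ce Mj.
exact: expR_ge0.
Qed.

(** The same truncation applied to the nonnegative variable 1 - exp(-th M). *)
Let lap_upper th h : 0 <= th -> 0 <= h ->
  lap th h + \sum_(j < k.+1) (1 - ce th j) * p j h <= 1.
Proof.
move=> th0 h0.
have c0 j : 0 <= 1 - ce th j by rewrite subr_ge0; case/andP: (ce_01 j th0).
rewrite -lee_fin EFinD -(@sum_levels (fun j => 1 - ce th j))// -lapE//.
rewrite -ge0_integralD//; last 3 first.
- by apply/measurable_EFinP; exact: measurable_explap.
- by move=> w _; rewrite lee_fin sumr_ge0// => j _; rewrite mulr_ge0.
- by apply/measurable_EFinP; exact: (measurable_sum_levels (fun j => 1 - ce th j)).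
rewrite -(@probability_setT _ _ _ P) -[P setT]mul1e -integral_cst//.
apply: ge0_le_integral => //.
- by move=> w _; rewrite -EFinD lee_fin addr_ge0 ?expR_ge0// sumr_ge0// => j _; rewrite mulr_ge0.
- apply: emeasurable_funD; apply/measurable_EFinP; first exact: measurable_explap.
  exact: (measurable_sum_levels (fun j => 1 - ce th j)).
move=> w _; rewrite -EFinD lee_fin.
have [[j [_ Mj] ->]| ->] := sum_levels_pt h w c0.
  by rewrite /ce Mj addrC subrK.
by rewrite addr0; case/andP: (explap_01 w th0 h0).
Qed.

Definition gcp_exponent th : R := \sum_(1 <= i < k.+1) lam i * (1 - expR (- (i%:R * th))).

Let sum_transition (c : nat -> R) h : \sum_(j < k.+1) c j * gcp_transition k lam j h =
  c 0%N - h * \sum_(1 <= i < k.+1) lam i * (c 0%N - c i).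
Proof.
rewrite big_ord_recl /= /gcp_transition/= !big_add1/= !big_mkord.
rewrite [X in _ + X = _](eq_bigr (fun i : 'I_k => c i.+1 * lam i.+1 * h)); last first.
  by move=> i _; rewrite /bump/= add1n ltn_ord mulrA.
rewrite -mulr_suml mulrBr mulr1 -addrA; congr (_ + _).
rewrite mulr_sumr !mulr_suml mulr_sumr -sumrN -big_split/= -sumrN.
by apply: eq_bigr => i _; ring.
Qed.

Let lap_near th e : 0 <= th -> 0 < e ->
  \forall h \near 0^'+, `|lap th h - (1 - h * gcp_exponent th)| <= e * h.
Proof.
(* The states 0, ..., k share the error e h equally. *)
move=> th0 e0; pose e' := e / k.+1%:R.
have e'0 : 0 < e' by rewrite divr_gt0.
near=> h.
have h0 : 0 < h by near: h; exact: nbhs_right_gt.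
have tr (j : 'I_k.+1) : `|p j h - gcp_transition k lam j h| <= e' * h.
  move: j; near: h; apply: filter_forall => j; exact: transition_near.
have bnd (c : nat -> R) : (forall j, 0 <= c j <= 1) ->
    `|\sum_(j < k.+1) c j * p j h - \sum_(j < k.+1) c j * gcp_transition k lam j h| <= e * h.
  move=> c01; rewrite -sumrB; apply: le_trans (ler_norm_sum _ _ _) _.
  rewrite (_ : e * h = \sum_(j < k.+1) (e' * h)); last first.
    by rewrite sumr_const card_ord -mulr_natl /e'; field.
  apply: ler_sum => j _; rewrite -mulrBr normrM ger0_norm; last by case/andP: (c01 j).
  by apply: le_trans (tr j); rewrite ler_piMl//; case/andP: (c01 j).
have b1 := bnd (ce th) (fun j => ce_01 j th0).
have b2 : `|\sum_(j < k.+1) (1 - ce th j) * p j h -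
    \sum_(j < k.+1) (1 - ce th j) * gcp_transition k lam j h| <= e * h.
  apply: (bnd (fun j => 1 - ce th j)) => j.
  by have := ce_01 j th0; lra.
have l1 := lap_lower th0 (ltW h0); have l2 := lap_upper th0 (ltW h0).
have ce0 : ce th 0 = 1 by rewrite /ce mulr0 oppr0 expR0.
rewrite (sum_transition (ce th)) ce0 in b1.
rewrite (sum_transition (fun j => 1 - ce th j)) /= ce0 subrr sub0r in b2.
have e1 : \sum_(1 <= i < k.+1) lam i * (1 - ce th i) = gcp_exponent th.
  by apply: eq_bigr => i _; rewrite /ce mulrC [th * _]mulrC mulrC.
have e2 : \sum_(1 <= i < k.+1) lam i * (0 - (1 - ce th i)) = - gcp_exponent th.
  by rewrite -e1 -sumrN; apply: eq_bigr => i _; ring.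
rewrite e1 in b1; rewrite e2 mulrN opprK in b2.
move: b1 b2; rewrite !ler_norml => /andP[b1 _] /andP[b2 _].
by apply/andP; split; lra.
Unshelve. all: by end_near. Qed.

(** Over n equal steps both sides are n-th powers of numbers in [0, 1]. Since |a^n - b^n| <= n |a -
    b|, an o(h) error per step adds up to o(1). *)
Lemma laplace_counting th t : 0 <= th -> 0 < t ->
  (\int[P]_w (expR (- (th * M t w)))%:E = (expR (- (t * gcp_exponent th)))%:E)%E.
Proof.
move=> th0 t0; rewrite lapE ?(ltW t0)//; congr EFin.
have g0 : 0 <= gcp_exponent th.
  rewrite /gcp_exponent big_nat_cond sumr_ge0// => i; rewrite andbT => ik.
  rewrite mulr_ge0//; first by rewrite ltW// hlam.
  by rewrite subr_ge0 expR_le1 oppr_le0 mulr_ge0.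
set g := gcp_exponent th in g0 *.
apply/eqP; rewrite -subr_eq0 -normr_le0; apply/ler_addgt0Pr => e e0; rewrite add0r.
pose e' := e / (2 * t).
have e'0 : 0 < e' by rewrite divr_gt0// mulr_gt0.
have [del /= del0 hdel] := lap_near th0 e'0.
(* Below this mesh the linearisation of [lap] costs e/2 in total, and the quadratic error of the
   exponential costs t h g^2 <= e/2. The + 1 covers g = 0. *)
pose m := Num.min del (e / (2 * t * (g ^+ 2 + 1))).
have g2 : 0 < g ^+ 2 + 1 by rewrite ltr_wpDl ?sqr_ge0.
have m0 : 0 < m by rewrite lt_min del0 divr_gt0// !mulr_gt0.
pose n := Num.truncn (t / m); pose h := t / n.+1%:R.
have h0 : 0 < h by rewrite divr_gt0.
have hm : h < m by rewrite ltr_pdivrMr// mulrC -ltr_pdivrMr// truncnS_gt.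
have tE : t = n.+1%:R * h by rewrite mulrC divfK.
have lh : `|lap th h - (1 - h * g)| <= e' * h.
  apply: hdel => //; rewrite /= sub0r normrN gtr0_norm//.
  by apply: lt_le_trans hm _; rewrite ge_min lexx.
have eh : `|expR (- (h * g)) - (1 - h * g)| <= (h * g) ^+ 2.
  have hg0 : 0 <= h * g by rewrite mulr_ge0// ltW.
  have := expRN_lower (h * g); have := expRN_upper hg0 => u l.
  by rewrite ler_norml; apply/andP; split; have := sqr_ge0 (h * g); lra.
rewrite {1}tE lapX// (_ : expR (- (t * g)) = expR (- (h * g)) ^+ n.+1); last first.
  by rewrite -expRM_natl {1}tE; congr expR; ring.
apply: le_trans (ler_norm_subrX _ _ _) _.
- exact: lap_01 (ltW h0).
- by rewrite expR_ge0 expR_le1 oppr_le0 mulr_ge0// ltW.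
have d1 : `|lap th h - expR (- (h * g))| <= e' * h + (h * g) ^+ 2.
  rewrite (_ : _ - _ = (lap th h - (1 - h * g)) - (expR (- (h * g)) - (1 - h * g))); last by ring.
  by apply: le_trans (ler_normB _ _) _; exact: lerD.
apply: (@le_trans _ _ (n.+1%:R * (e' * h + (h * g) ^+ 2))); first by rewrite ler_wpM2l.
rewrite (_ : _ * _ = e' * (n.+1%:R * h) + (n.+1%:R * h) * h * g ^+ 2); last by ring.
rewrite -tE (_ : e' * t = e / 2); last by rewrite /e'; field; rewrite gt_eqF.
suff : t * h * g ^+ 2 <= e / 2 by lra.
apply: (@le_trans _ _ (t * h * (g ^+ 2 + 1))).
  by rewrite ler_wpM2l ?mulr_ge0 ?(ltW t0) ?(ltW h0)// lerDl.
have : h <= e / (2 * t * (g ^+ 2 + 1)) by apply: le_trans (ltW hm) _; rewrite ge_min lexx orbT.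
by rewrite ler_pdivlMr ?mulr_gt0//; lra.
Qed.

End counting_process.

(** Linearity for coefficients of any sign, the values staying in the extended reals. A single
    variable is treated by repeating it with coefficient 0. *)
Lemma integral_affine3 d (T : measurableType d) (R : realType) (P : probability T R)
    (X Y : T -> R) (a b c x y : R) :
  measurable_fun setT X -> measurable_fun setT Y ->
  (forall w, 0 <= X w) -> (forall w, 0 <= Y w) ->
  (\int[P]_w (X w)%:E = x%:E)%E -> (\int[P]_w (Y w)%:E = y%:E)%E ->
  (\int[P]_w (a + b * X w + c * Y w)%:E = (a + b * x + c * y)%:E)%E.
Proof.
move=> mX mY X0 Y0 iX iY.
have IX : P.-integrable setT (EFin \o X).
  apply/integrableP; split; first exact/measurable_EFinP.
  under eq_integral => w _ do rewrite /= ger0_norm//.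
  by rewrite iX ltry.
have IY : P.-integrable setT (EFin \o Y).
  apply/integrableP; split; first exact/measurable_EFinP.
  under eq_integral => w _ do rewrite /= ger0_norm//.
  by rewrite iY ltry.
have IbX : P.-integrable setT (fun w => b%:E * (X w)%:E)%E by exact: (integrableZl _ b IX).
have IcY : P.-integrable setT (fun w => c%:E * (Y w)%:E)%E by exact: (integrableZl _ c IY).
have Ia : P.-integrable setT (fun=> a%:E) by exact: (finite_measure_integrable_cst P a).
have -> : (fun w => (a + b * X w + c * Y w)%:E) =
    (fun w => (a%:E + b%:E * (X w)%:E) + c%:E * (Y w)%:E)%E.
  by apply/funext => w; rewrite !EFinD !EFinM.
rewrite integralD//; last exact: (integrableD _ Ia IbX).
rewrite integralD// (integralZl _ IX)// (integralZl _ IY)// iX iY.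
have -> : (\int[P]_w a%:E)%E = a%:E.
  by rewrite (integral_cst P measurableT a%:E) -[X in (_ * X)%E]/(P setT) probability_setT mule1.
by rewrite !EFinD !EFinM.
Qed.

Lemma cvg_sqr (R : realType) (u : nat -> R) (l : R) :
  u n @[n --> \oo] --> l -> u n ^+ 2 @[n --> \oo] --> l ^+ 2.
Proof. by move=> ul; under eq_fun do rewrite expr2; rewrite expr2; exact: cvgM. Qed.

(** * First and second moments of the counting process *)

Section counting_moments.
Context d (T : measurableType d) (R : realType) (P : probability T R).
Variables (k : nat) (lam : nat -> R) (M : R -> {RV P >-> R}).
Hypothesis hlam : forall j : nat, (1 <= j <= k)%N -> 0 < lam j.
Hypothesis hM : generalized_counting_process k lam M.

Let c1 : R := \sum_(1 <= j < k.+1) j%:R * lam j.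
Let c2 : R := \sum_(1 <= j < k.+1) j%:R ^+ 2 * lam j.
Let g := gcp_exponent k lam.

Let g_ge0 th : 0 <= th -> 0 <= g th.
Proof.
move=> th0; rewrite /g /gcp_exponent big_nat_cond sumr_ge0// => i; rewrite andbT => ik.
rewrite mulr_ge0//; first by rewrite ltW// hlam.
by rewrite subr_ge0 expR_le1 oppr_le0 mulr_ge0.
Qed.

Let cvg_sum_nat (u : nat -> nat -> R) (l : nat -> R) :
  (forall i, u i n @[n --> \oo] --> l i) ->
  \sum_(1 <= i < k.+1) u i n @[n --> \oo] --> \sum_(1 <= i < k.+1) l i.
Proof.
move=> ul; elim: k => [|m IH].
  by rewrite big_geq//; under eq_fun do rewrite big_geq//; exact: cvg_cst.
rewrite big_nat_recr//=; under eq_fun do rewrite big_nat_recr//=.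
by apply: cvgD.
Qed.

Let cvg_g : n.+1%:R * g n.+1%:R^-1 @[n --> \oo] --> c1.
Proof.
under eq_fun do rewrite /g /gcp_exponent mulr_sumr.
apply: cvg_sum_nat => i; rewrite mulrC.
under eq_fun do rewrite mulrCA.
by apply: cvgMr; exact: cvg_1BexpRN.
Qed.

(** Minus the second difference of [g] at 0. With th = 1/(n+1), exp(-t r) is the ratio of the
    squared mean of exp(-th M) to its second moment. *)
Let r n := 2 * g n.+1%:R^-1 - g (2 * n.+1%:R^-1).

Let rE n : r n = \sum_(1 <= i < k.+1) lam i * (1 - expR (- (i%:R * n.+1%:R^-1))) ^+ 2.
Proof.
rewrite /r /g /gcp_exponent mulr_sumr -sumrB; apply: eq_bigr => i _.
rewrite (_ : expR (- (i%:R * (2 * _))) = expR (- (i%:R * n.+1%:R^-1)) ^+ 2); first by ring.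
by rewrite -expRM_natl; congr expR; ring.
Qed.

Let cvg_r : n.+1%:R ^+ 2 * r n @[n --> \oo] --> c2.
Proof.
under eq_fun do rewrite rE mulr_sumr.
apply: cvg_sum_nat => i; rewrite mulrC.
under eq_fun do rewrite mulrCA -exprMn.
by apply: cvgMr; apply: cvg_sqr; exact: cvg_1BexpRN.
Qed.

Let cvg_inv0 (u : nat -> R) (l : R) : n.+1%:R * u n @[n --> \oo] --> l ->
  u n @[n --> \oo] --> 0.
Proof.
move=> ul; rewrite -(mul0r l).
rewrite (_ : u = fun n => n.+1%:R^-1 * (n.+1%:R * u n)); last first.
  by apply/funext => n; rewrite mulKf.
by apply: cvgM => //; exact: cvg_harmonic.
Qed.

Let measurable_exp th t : measurable_fun setT (fun w => expR (- (th * M t w))).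
Proof.
apply: (measurableT_comp (@measurable_expR R)); apply: measurableT_comp => //.
by apply: measurable_funM => //; exact: measurable_funP.
Qed.

(** Approximates M from below, and its moments are combinations of values of the Laplace
    transform. *)
Let fn t n w : R := n.+1%:R * (1 - expR (- (n.+1%:R^-1 * M t w))).

Let fn_bounds t n w : 0 < t -> 0 <= fn t n w <= M t w.
Proof.
move=> t0; have M0 := counting_ge0 hM w (ltW t0).
apply/andP; split.
  by rewrite mulr_ge0// subr_ge0 expR_le1 oppr_le0 mulr_ge0.
have := expRN_lower (n.+1%:R^-1 * M t w); rewrite lerBlDr -lerBlDl => h.
by rewrite -ler_pdivlMl.
Qed.

Let cvg_fn t w : 0 < t -> fn t n w @[n --> \oo] --> M t w.
Proof.
move=> t0; rewrite /fn; under eq_fun do rewrite [_^-1 * _]mulrC.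
by apply: cvg_1BexpRN; exact: (counting_ge0 hM w (ltW t0)).
Qed.

Let measurable_fn t n : measurable_fun setT (fn t n).
Proof. by apply: measurable_funM => //; apply: measurable_funB => //; exact: measurable_exp. Qed.

Lemma counting_mean t : 0 < t -> (\int[P]_w (M t w)%:E = (c1 * t)%:E)%E.
Proof.
move=> t0; apply: (integral_cvg_below (f_ := fun n w => (fn t n w)%:E)).
- by move=> n; apply/measurable_EFinP; exact: measurable_fn.
- by apply/measurable_EFinP; exact: measurable_funP.
- by move=> n w; rewrite !lee_fin fn_bounds.
- by move=> w; apply: cvg_EFin; [near=> n|exact: cvg_fn].
have E n : (\int[P]_w (fn t n w)%:E = (n.+1%:R * (1 - expR (- (t * g n.+1%:R^-1))))%:E)%E.
  transitivity (\int[P]_w (n.+1%:R + - n.+1%:R * expR (- (n.+1%:R^-1 * M t w))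
      + 0 * expR (- (n.+1%:R^-1 * M t w)))%:E)%E.
    by apply: eq_integral => w _; rewrite /fn; congr EFin; ring.
  have L : (\int[P]_w (expR (- (n.+1%:R^-1 * M t w)))%:E = (expR (- (t * g n.+1%:R^-1)))%:E)%E.
    by apply: laplace_counting.
  rewrite (integral_affine3 _ _ _ (measurable_exp _ t) (measurable_exp _ t) _ _ L L).
  - by congr EFin; ring.
  - by move=> w; exact: expR_ge0.
  - by move=> w; exact: expR_ge0.
under eq_fun do rewrite E.
apply: cvg_EFin; first by near=> n.
apply: cvg_scaled_1BexpRN => //.
- by move=> n; rewrite mulr_ge0 ?g_ge0// ltW.
- by rewrite -(mulr0 t); apply: cvgMr; exact: cvg_inv0 cvg_g.
- under eq_fun do rewrite mulrCA.
  by rewrite mulrC; apply: cvgMr; exact: cvg_g.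
Unshelve. all: by end_near. Qed.

Lemma counting_sqr t : 0 < t ->
  (\int[P]_w (M t w ^+ 2)%:E = (c2 * t + c1 ^+ 2 * t ^+ 2)%:E)%E.
Proof.
move=> t0; apply: (integral_cvg_below (f_ := fun n w => (fn t n w ^+ 2)%:E)).
- by move=> n; apply/measurable_EFinP; apply: measurable_funX; exact: measurable_fn.
- by apply/measurable_EFinP; apply: measurable_funX; exact: measurable_funP.
- move=> n w; rewrite !lee_fin sqr_ge0/=; have /andP[h1 h2] := fn_bounds n w t0.
  by rewrite ler_pXn2r// nnegrE (le_trans h1).
- by move=> w; apply: cvg_EFin; [near=> n|apply: cvg_sqr; exact: cvg_fn].
pose a n := t * g n.+1%:R^-1.
pose b n := t * g (2 * n.+1%:R^-1).
(* Squared mean plus variance of [fn], regrouped by exp(-b) exp(-t r) = exp(-a)^2. The first part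
   tends to (c1 t)^2 and the second to c2 t, with no difference of divergent terms left. *)
have E n : (\int[P]_w (fn t n w ^+ 2)%:E =
    ((n.+1%:R * (1 - expR (- a n))) ^+ 2
     + expR (- b n) * (n.+1%:R ^+ 2 * (1 - expR (- (t * r n)))))%:E)%E.
  transitivity (\int[P]_w (n.+1%:R ^+ 2 + - (2 * n.+1%:R ^+ 2) * expR (- (n.+1%:R^-1 * M t w))
      + n.+1%:R ^+ 2 * expR (- (2 * n.+1%:R^-1 * M t w)))%:E)%E.
    apply: eq_integral => w _; rewrite /fn; congr EFin.
    rewrite (_ : expR (- (2 * _ * _)) = expR (- (n.+1%:R^-1 * M t w)) ^+ 2); first by ring.
    by rewrite -expRM_natl; congr expR; ring.
  have L1 : (\int[P]_w (expR (- (n.+1%:R^-1 * M t w)))%:E = (expR (- a n))%:E)%E.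
    by apply: laplace_counting.
  have L2 : (\int[P]_w (expR (- (2 * n.+1%:R^-1 * M t w)))%:E = (expR (- b n))%:E)%E.
    by apply: laplace_counting => //; rewrite mulr_ge0.
  rewrite (integral_affine3 _ _ _ (measurable_exp _ t) (measurable_exp _ t) _ _ L1 L2).
  - have h : expR (- b n) * expR (- (t * r n)) = expR (- a n) ^+ 2.
      by rewrite -expRD -expRM_natl; congr expR; rewrite /a /b /r; ring.
    rewrite (_ : expR (- b n) * _ =
      n.+1%:R ^+ 2 * (expR (- b n) - expR (- b n) * expR (- (t * r n)))); last by ring.
    by rewrite h; congr EFin; ring.
  - by move=> w; exact: expR_ge0.
  - by move=> w; exact: expR_ge0.
under eq_fun do rewrite E.
apply: cvg_EFin; first by near=> n.
rewrite addrC -exprMn; apply: cvgD.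
  apply: cvg_sqr; apply: cvg_scaled_1BexpRN => //.
  - by move=> n; rewrite mulr_ge0 ?g_ge0// ltW.
  - by rewrite -(mulr0 t); apply: cvgMr; exact: cvg_inv0 cvg_g.
  - by under eq_fun do rewrite mulrCA; rewrite mulrC; apply: cvgMr; exact: cvg_g.
have cr0 : r n @[n --> \oo] --> 0.
  apply: (@cvg_inv0 _ 0); apply: (@cvg_inv0 _ c2).
  by under eq_fun do rewrite mulrA -expr2; exact: cvg_r.
rewrite -[X in _ --> X]mul1r; apply: cvgM.
  rewrite -(@expR0 R); apply: continuous_cvg; first exact: continuous_expR.
  rewrite -oppr0 -(mulr0 t); apply: cvgN; apply: cvgMr.
  rewrite (_ : (fun n => _) = fun n => 2 * g n.+1%:R^-1 - r n); last first.
    by apply/funext => n; rewrite /r; ring.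
  rewrite -(subr0 0) -[X in X - _](mulr0 2); apply: cvgB => //; apply: cvgMr.
  exact: cvg_inv0 cvg_g.
apply: cvg_scaled_1BexpRN.
- by move=> n; rewrite exprn_ge0.
- move=> n; rewrite mulr_ge0 ?(ltW t0)// rE big_nat_cond sumr_ge0// => i; rewrite andbT => ik.
  by rewrite mulr_ge0 ?sqr_ge0// ltW// hlam.
- by rewrite -(mulr0 t); apply: cvgMr.
- by under eq_fun do rewrite mulrCA; rewrite mulrC; apply: cvgMr; exact: cvg_r.
Unshelve. all: by end_near. Qed.

(** Writing M y as M x plus a fresh increment gives E (M x)^2 + c1 (y - x) E (M x). The cases x = 0
    and x = y are separate because [levy_split] asks for strict inequalities. *)
Lemma counting_prod x y : 0 <= x -> x <= y ->
  (\int[P]_w (M x w * M y w)%:E = (c2 * x + c1 ^+ 2 * (x * y))%:E)%E.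
Proof.
rewrite le_eqVlt => /predU1P[<-|x0].
  move=> y0; rewrite !mul0r !mulr0 addr0; rewrite -[RHS](@integral0 _ T _ P setT).
  apply: ge0_ae_integral => //.
  - by apply/measurable_EFinP; apply: measurable_funM; exact: measurable_funP.
  - by move=> w; rewrite lee_fin mulr_ge0// (counting_ge0 hM).
  - by apply: filterS (levy_start (gcp_levy hM)) => w ->; rewrite mul0r.
rewrite le_eqVlt => /predU1P[<-|xy].
  by under eq_integral do rewrite -expr2; rewrite counting_sqr// expr2.
pose h := y - x; have h0 : 0 < h by rewrite subr_gt0.
have yE : y = x + h by rewrite /h addrC subrK.
have x0' := ltW x0; have y0' : 0 <= y by rewrite (le_trans x0')// ltW.
(* The absolute value makes the integrand nonnegative on the whole plane. *)
pose phi (z : R * R) := `|z.1 * z.2|%:E.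
have mphi : measurable_fun setT phi.
  apply/measurable_EFinP; apply: measurableT_comp => //.
  by apply: measurable_funM; [exact: measurable_fst|exact: measurable_snd].
transitivity (\int[P]_w phi (M x w, M (x + h)%R w))%E.
  apply: eq_integral => w _; rewrite /phi /= -yE ger0_norm//.
  by rewrite mulr_ge0// (counting_ge0 hM).
rewrite (levy_split (gcp_levy hM) x0 h0 mphi); last by move=> z; rewrite lee_fin.
transitivity (\int[P]_w (0 + 1 * M x w ^+ 2 + c1 * h * M x w)%:E)%E.
  apply: eq_integral => w' _.
  have Mx := counting_ge0 hM w' x0'.
  transitivity (\int[P]_w (M x w' ^+ 2 + M x w' * M h w + 0 * M h w)%:E)%E.
    apply: eq_integral => w _; rewrite /phi /= ger0_norm; last first.
      by rewrite mulr_ge0// addr_ge0// (counting_ge0 hM)// ltW.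
    by congr EFin; ring.
  rewrite (integral_affine3 _ _ _ _ _ _ _ (counting_mean h0) (counting_mean h0)).
  - by congr EFin; ring.
  - exact: measurable_funP.
  - exact: measurable_funP.
  - by move=> w; rewrite (counting_ge0 hM)// ltW.
  - by move=> w; rewrite (counting_ge0 hM)// ltW.
rewrite (integral_affine3 _ _ _ _ _ _ _ (counting_sqr x0) (counting_mean x0)).
- by congr EFin; rewrite yE; ring.
- by apply: measurable_funX; exact: measurable_funP.
- exact: measurable_funP.
- by move=> w; exact: sqr_ge0.
- by move=> w; rewrite (counting_ge0 hM).
Qed.

Lemma counting_mean0 t : 0 <= t -> (\int[P]_w (M t w)%:E = (c1 * t)%:E)%E.
Proof.
rewrite le_eqVlt => /predU1P[<-|]; last exact: counting_mean.
rewrite mulr0 -[RHS](@integral0 _ T _ P setT); apply: ge0_ae_integral => //.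
- by apply/measurable_EFinP; exact: measurable_funP.
- by move=> w; rewrite lee_fin (counting_ge0 hM).
- by apply: filterS (levy_start (gcp_levy hM)) => w ->.
Qed.

End counting_moments.

(** * First passage times *)

Lemma right_continuous_rat (R : realType) (f : R -> R) (t x a : R) :
  f @ x^'+ --> f x -> t < f x -> x < a -> exists q : rat, x < ratr q < a /\ t < f (ratr q).
Proof.
move=> fx tx xa.
have : \forall y \near x^'+, t < f y by apply: (cvgr_gt _ fx).
move=> [del /= del0 hdel].
have xm : x < Num.min (x + del) a by rewrite lt_min xa ltrDl del0.
have [q] := rat_in_itvoo xm; rewrite in_itv/= lt_min => /andP[xq /andP[qd qa]].
exists q; split; first by rewrite xq.
by apply: hdel => //=; rewrite ltr0_norm ?subr_lt0// opprB ltrBlDl.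
Qed.

(** By monotonicity the sublevel set is an interval from 0 to the infimum; whether it contains its
    right end is immaterial for its length. Finiteness excludes a function that never exceeds s, for
    which the infimum would take the default value 0 instead of +oo. *)
Lemma integral_first_passage (R : realType) (f : R -> R) (s : R) :
  (forall x y, 0 <= x -> x <= y -> f x <= f y) ->
  (\int[@lebesgue_measure R]_x ((0 < x)%R%:R * (f `|x| <= s)%R%:R)%:E < +oo)%E ->
  (\int[@lebesgue_measure R]_x ((0 < x)%R%:R * (f `|x| <= s)%R%:R)%:E =
    (inf [set x | 0 < x /\ (s < f x)%R])%:E)%E.
Proof.
move=> ndf fin; set E := [set x | _].
have indE (A : set R) : measurable A -> (\int[lebesgue_measure]_x (\1_A x)%:E = lebesgue_measure A)%E.
  by move=> mA; rewrite integral_indic// setIT.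
have mind (A : set R) : measurable A -> measurable_fun setT (fun x => (\1_A x : R)%:E).
  by move=> mA; apply/measurable_EFinP; exact: measurable_indic.
set F := fun x : R => ((0 < x)%R%:R * (f `|x| <= s)%R%:R)%:E.
have F0 x : (0 <= F x)%E by rewrite lee_fin mulr_ge0.
have down x y : 0 < x -> x <= y -> f y <= s -> f x <= s.
  by move=> x0 xy; apply: le_trans; apply: ndf => //; exact: ltW.
have E0 : E !=set0.
  apply: contrapT => /forallNP En.
  move: fin; rewrite (_ : (fun _ => _) = fun x => (\1_(`]0, +oo[%classic) x)%:E).
    by rewrite indE// lebesgue_measure_itv/= ltry.
  apply/funext => x; congr EFin; rewrite indicE mem_setE in_itv/= andbT.
  have [x0|] := ltP 0 x; last by rewrite mul0r.
  rewrite gtr0_norm// mul1r leNgt; case: ltP => // sx.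
  by exfalso; apply: (En x).
have lbE : lbound E 0 by move=> x [/ltW].
have hlE : has_lbound E by exists 0.
set y := inf E.
have y0 : 0 <= y by exact: lb_le_inf.
have below x : 0 < x -> x < y -> f x <= s.
  move=> x0 xy; rewrite leNgt; apply/negP => sx.
  by move: xy; rewrite ltNge => /negP; apply; apply: ge_inf.
have above x : y < x -> s < f x.
  move=> yx; have [e [e0 se] ex] := inf_lt E0 yx.
  by apply: (lt_le_trans se); apply: ndf; exact: ltW.
have mF : measurable_fun setT F.
  have [yy|ny] := pselect (f y <= s /\ 0 < y).
    rewrite (_ : F = fun x => (\1_(`]0, y]%classic) x)%:E); first exact: mind.
    apply/funext => x; congr EFin; rewrite indicE mem_setE in_itv/=.
    have [x0|] := ltP 0 x; last by rewrite mul0r.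
    rewrite gtr0_norm// mul1r; congr (_%:R); congr nat_of_bool.
    have [xy|yx] := leP x y; first exact: down yy.1.
    by apply/negbTE; rewrite -ltNge above.
  rewrite (_ : F = fun x => (\1_(`]0, y[%classic) x)%:E); first exact: mind.
  apply/funext => x; congr EFin; rewrite indicE mem_setE in_itv/=.
  have [x0|] := ltP 0 x; last by rewrite mul0r.
  rewrite gtr0_norm// mul1r; congr (_%:R); congr nat_of_bool.
  have [xy|] := ltP x y; first exact: below.
  rewrite le_eqVlt => /predU1P[yx|yx]; last by apply/negbTE; rewrite -ltNge above.
  by apply/negbTE/negP => xs; apply: ny; rewrite yx.
apply/le_anti/andP; split.
  apply: (@le_trans _ _ (\int[lebesgue_measure]_x (\1_(`]0, y]%classic) x)%:E)%E).
    apply: ge0_le_integral => //; first exact: mind.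
    move=> x _; rewrite lee_fin indicE mem_setE in_itv/=.
    have [x0|] := ltP 0 x; last by rewrite mul0r.
    rewrite gtr0_norm// mul1r; have [xy|yx] := leP x y; first by case: (f x <= s).
    by rewrite [f x <= s]leNgt above.
  by rewrite indE// lebesgue_measure_itv/= lte_fin; case: ifP => _; rewrite ?lee_fin -?EFinD ?subr0.
apply: (@le_trans _ _ (\int[lebesgue_measure]_x (\1_(`]0, y[%classic) x)%:E)%E).
  rewrite indE// lebesgue_measure_itv/= lte_fin -EFinD subr0.
  by case: ltP.
apply: ge0_le_integral => //; first exact: mind.
move=> x _; rewrite lee_fin indicE mem_setE in_itv/=.
have [x0|] := ltP 0 x; last by rewrite mul0r.
rewrite gtr0_norm// mul1r; have [xy|yx] := ltP x y; last by [].
by rewrite below.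
Qed.

Section inverse_subordinator.
Context d (T : measurableType d) (R : realType) (P : probability T R).
Variable D : R -> {RV P >-> R}.
Hypothesis hD : levy_process D.
Local Notation Y := (inverse_subordinator D).

Lemma inverse_subordinator_ge0 t w : 0 <= Y t w.
Proof.
rewrite /inverse_subordinator; set E := [set x | _].
have [->|/set0P E0] := eqVneq E set0; first by rewrite inf0.
by apply: lb_le_inf => // x [/ltW].
Qed.

(** For a > 0, right continuity reduces Y < a to D exceeding t at some rational of ]0, a[. Paths
    that never exceed t also belong to the event, as the infimum of the empty set is 0; this is the
    complement in the union below. *)
Lemma measurable_inverse_subordinator_joint :
  measurable_fun setT (fun z : R * T => Y z.1 z.2).
Proof.
apply: (measurability _ (RGenInftyO.measurableE R)) => _ /= -[_ [a ->] <-].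
rewrite setTI.
pose A (q : rat) : set (R * T) := [set z | z.1 < D (ratr q) z.2].
have mA q : measurable (A q).
  have : measurable_fun setT (fun z : R * T => z.1 < D (ratr q) z.2).
    apply: measurable_fun_ltr; first exact: measurable_fst.
    by apply: measurableT_comp => //; exact: measurable_snd.
  by move=> /(_ measurableT [set true] I); rewrite setTI.
have mif (b : rat -> bool) : measurable (\bigcup_q (if b q then A q else set0)).
  by apply: bigcupT_measurable_rat => q; case: ifP.
have [a0|a0] := leP a 0.
  rewrite (_ : _ @^-1` _ = set0)//; apply/seteqP; split => // z /=.
  by rewrite in_itv/= ltNge (le_trans a0)// inverse_subordinator_ge0.
have -> : (fun z : R * T => Y z.1 z.2) @^-1` `]-oo, a[%classic =
    (\bigcup_(q : rat) (if (0 < ratr q :> R) && (ratr q < a) then A q else set0)) `|`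
    ~` (\bigcup_(q : rat) (if 0 < ratr q :> R then A q else set0)).
  apply/seteqP; split => -[t w] /=; rewrite in_itv/=.
    move=> Ya; have [[x [x0 tx]]|none] := pselect (exists x, 0 < x /\ t < D x w).
      left; have [y [y0 ty] ya] : exists2 y, (0 < y /\ t < D y w) & y < a.
        by apply: (inf_lt _ Ya); exists x.
      have [q [/andP[yq qa] tq]] :=
        right_continuous_rat (@levy_right_continuous _ _ _ _ _ hD w y (ltW y0)) ty ya.
      by exists q => //; rewrite qa (lt_trans y0 yq).
    right => -[q _]; case: ifPn => // q0 tq; apply: none.
    by exists (ratr q).
  move=> [[q _]|none].
    case: ifPn => // /andP[q0 qa] tq; apply: le_lt_trans qa.
    by apply: ge_inf => //; exists 0 => x [/ltW].
  rewrite /inverse_subordinator (_ : [set x | _] = set0) ?inf0//.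
  apply/seteqP; split => // x /= [x0 tx]; apply: none.
  have [q [/andP[xq _] tq]] := right_continuous_rat
    (@levy_right_continuous _ _ _ _ _ hD w x (ltW x0)) tx (ltr_pwDr ltr01 (lexx x)).
  by exists q => //; rewrite (lt_trans x0 xq).
by apply: measurableU; last apply: measurableC; exact: mif.
Qed.

Lemma measurable_inverse_subordinator t : measurable_fun setT (Y t).
Proof.
have mp : measurable_fun setT (fun w : T => (t, w)) by exact: measurable_fun_pair.
exact: (measurableT_comp measurable_inverse_subordinator_joint mp).
Qed.

End inverse_subordinator.

Lemma measurable_ltr_ind d (S : measurableType d) (R : realType) (f g : S -> R) :
  measurable_fun setT f -> measurable_fun setT g ->
  measurable_fun setT (fun z => (f z < g z)%R%:R : R).
Proof.
move=> mf mg; have mb : measurable_fun setT (fun b : bool => b%:R : R) by [].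
by apply: (measurableT_comp mb); exact: measurable_fun_ltr.
Qed.

Lemma measurable_ler_ind d (S : measurableType d) (R : realType) (f g : S -> R) :
  measurable_fun setT f -> measurable_fun setT g ->
  measurable_fun setT (fun z => (f z <= g z)%R%:R : R).
Proof.
move=> mf mg; have mb : measurable_fun setT (fun b : bool => b%:R : R) by [].
by apply: (measurableT_comp mb); exact: measurable_fun_ler.
Qed.

Lemma integral_prodE d1 d2 (T1 : measurableType d1) (T2 : measurableType d2) (R : realType)
    (m1 : {sigma_finite_measure set T1 -> \bar R})
    (m2 : {sigma_finite_measure set T2 -> \bar R}) (f : T1 * T2 -> \bar R) :
  measurable_fun setT f -> (forall z, (0 <= f z)%E) ->
  (\int[(m1 \x m2)%E]_z f z = \int[m1]_x \int[m2]_y f (x, y))%E.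
Proof. by move=> mf f0; rewrite fubini_tonelli1. Qed.

(** * The potential measure of the stable subordinator *)

Section potential.
Context d (T : measurableType d) (R : realType) (P : probability T R).
Variables (b : R) (D : R -> {RV P >-> R}).
Hypothesis b01 : 0 < b < 1.
Hypothesis hD : stable_subordinator b D.
Local Notation mu := (@lebesgue_measure R).
Local Notation muP := ((mu \x P)%E).

Let b0 : 0 < b. Proof. by case/andP: b01. Qed.

(* Right continuity is only assumed at nonnegative times, hence the absolute value. *)
Definition joint (z : R * T) : R := D `|z.1| z.2.

Lemma measurable_joint : measurable_fun setT joint.
Proof. exact: measurable_joint_levy (stable_levy hD). Qed.

Lemma measurable_pos : measurable_fun setT (fun z : R * T => (0 < z.1)%R%:R : R).
Proof. by apply: measurable_ltr_ind => //; exact: measurable_fst. Qed.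
Let mpos := measurable_pos.

Lemma stable_ge0 x : 0 <= x -> {ae P, forall w, 0 <= D x w}.
Proof.
move=> x0; apply: filterS2 (stable_nondecreasing hD) (levy_start (stable_levy hD)).
by move=> w nd D0; rewrite -D0; exact: nd.
Qed.

(** Makes exp(-D) lie in [0, 1] at every point, as [moments_unique] demands, although D >= 0 only
    almost surely. *)
Let clip (y : R) := Num.max 0 y.

Let measurable_expclip d' (S : measurableType d') (f : S -> R) : measurable_fun setT f ->
  measurable_fun setT (fun z => expR (- clip (f z))).
Proof.
move=> mf; apply: (measurableT_comp (@measurable_expR R)); apply: measurableT_comp => //.
exact: measurable_maxr.
Qed.

Let r1 (z : R * T) : R := (0 < z.1)%R%:R * (0 <= joint z)%R%:R.
Let u1 (z : R * T) : R := expR (- clip (joint z)).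
Let u2 (x : R) : R := expR (- clip x).

Let mr1 : measurable_fun setT r1.
Proof.
by apply: measurable_funM => //; apply: measurable_ler_ind => //; exact: measurable_joint.
Qed.

Let mu1 : measurable_fun setT u1.
Proof. by apply: measurable_expclip; exact: measurable_joint. Qed.

Let mu2 : measurable_fun setT u2.
Proof. exact: measurable_expclip. Qed.

Let expclip_01 y : 0 <= expR (- clip y) <= 1.
Proof. by rewrite expR_ge0 expR_le1 oppr_le0 /clip le_max lexx. Qed.

(** The powers of u = exp(-D) sample the Laplace transform of the potential at the positive
    integers: integrating exp(-x (n+1)^b) over x > 0 gives (n+1)^(-b). *)
Let moment1 n : (\int[muP]_z (r1 z * u1 z ^+ n.+1)%:E = (n.+1%:R `^ (- b))%:E)%E.
Proof.
have n0 : 0 < n.+1%:R :> R by rewrite ltr0n.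
rewrite integral_prodE; last 2 first.
- by apply/measurable_EFinP; apply: measurable_funM => //; exact: measurable_funX.
- by move=> z; rewrite lee_fin mulr_ge0// ?mulr_ge0// exprn_ge0// expR_ge0.
transitivity (\int[mu]_x (rlk 1 x * expR (- (n.+1%:R `^ b * x)))%:E)%E.
  apply: eq_integral => x _; rewrite rlk1.
  have [x0|x0] := ltP 0 x; last first.
    rewrite mul0r; apply: integral0_eq => w _.
    by rewrite /r1 /= ltNge x0 !mul0r.
  have := stable_laplace hD (ltW x0) n0; rewrite unlock mul1r mulrC => <-.
  apply: ge0_ae_integral.
  - apply/measurable_EFinP.
    have mp : measurable_fun setT (fun w : T => (x, w)) by exact: measurable_fun_pair.
    apply: measurable_funM; first exact: (measurableT_comp mr1 mp).
    by apply: measurable_funX; exact: (measurableT_comp mu1 mp).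
  - apply/measurable_EFinP; apply: (measurableT_comp (@measurable_expR R)).
    by apply: measurableT_comp => //; apply: measurable_funM => //; exact: measurable_funP.
  - by move=> w; rewrite lee_fin mulr_ge0// ?mulr_ge0// exprn_ge0// expR_ge0.
  - by move=> w; rewrite lee_fin expR_ge0.
  - apply: filterS (stable_ge0 (ltW x0)) => w Dw; congr EFin.
    rewrite /r1 /u1 /joint /= gtr0_norm// x0 Dw !mul1r -expRM_natl; congr expR.
    by rewrite /clip max_r// mulrN.
have l0 : 0 < n.+1%:R `^ b :> R by exact: powR_gt0.
by rewrite laplace_rlk// -powRrM mulrN1.
Qed.

Let moment2 n : (\int[mu]_x (rlk b x * u2 x ^+ n.+1)%:E = (n.+1%:R `^ (- b))%:E)%E.
Proof.
rewrite -laplace_rlk ?ltr0n//; apply: eq_integral => x _; congr EFin.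
have [x0|x0] := ltP 0 x; last by rewrite rlk_le0// !mul0r.
by rewrite /u2 /clip max_r ?(ltW x0)// -expRM_natl mulrN.
Qed.

Let lt_expclip r y : 0 < r -> (expR (- r) < expR (- clip y)) = (y < r).
Proof. by move=> r0; rewrite ltr_expR ltrN2 /clip gt_max r0. Qed.

Lemma integral_ae_muP (f g : R * T -> \bar R) :
  measurable_fun setT f -> measurable_fun setT g ->
  (forall z, 0 <= f z)%E -> (forall z, 0 <= g z)%E ->
  (forall x w, x <= 0 -> f (x, w) = g (x, w)) ->
  (forall x w, 0 < x -> 0 <= D x w -> f (x, w) = g (x, w)) ->
  (\int[muP]_z f z = \int[muP]_z g z)%E.
Proof.
move=> mf mg f0 g0 fgN fgP; rewrite !integral_prodE//.
apply: eq_integral => x _.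
have mp : measurable_fun setT (fun w : T => (x, w)) by exact: measurable_fun_pair.
have [x0|x0] := ltP 0 x; last by apply: eq_integral => w _; exact: fgN.
apply: ge0_ae_integral => //.
- exact: (measurableT_comp mf mp).
- exact: (measurableT_comp mg mp).
- by apply: filterS (stable_ge0 (ltW x0)) => w; exact: fgP.
Qed.

(** Uniqueness of moments yields the strict inequality, occupation lengths use the weak one; that
    they have equal potential expresses the absence of atoms. *)
Definition pos_lt r (z : R * T) : R := (0 < z.1)%R%:R * (joint z < r)%R%:R.
Definition pos_le r (z : R * T) : R := (0 < z.1)%R%:R * (joint z <= r)%R%:R.

Lemma measurable_pos_lt r : measurable_fun setT (EFin \o pos_lt r).
Proof.
apply/measurable_EFinP; apply: measurable_funM => //.
by apply: measurable_ltr_ind => //; exact: measurable_joint.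
Qed.
Let mpos_lt := measurable_pos_lt.

Lemma measurable_pos_le r : measurable_fun setT (EFin \o pos_le r).
Proof.
apply/measurable_EFinP; apply: measurable_funM => //.
by apply: measurable_ler_ind => //; exact: measurable_joint.
Qed.
Let mpos_le := measurable_pos_le.

Lemma rlkD1 a z : 0 < a ->
  (\int[mu]_y (rlk a y * (y < z)%R%:R)%:E = (rlk (a + 1) z)%:E)%E.
Proof.
move=> a0; rewrite -conv_rlk// /conv; apply: eq_integral => y _.
by rewrite rlk1 subr_gt0.
Qed.

(** For r > 0 the event D < r is exp(-D) > exp(-r), so this is [moments_unique] at the threshold
    exp(-r). *)
Let potential_lt_gt0 r : 0 < r -> (\int[muP]_z (pos_lt r z)%:E = (rlk (b + 1) r)%:E)%E.
Proof.
move=> r0.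
have mfin : (\int[muP]_z (r1 z * u1 z)%:E < +oo)%E.
  have := moment1 0; rewrite (_ : (fun z => _) = fun z => (r1 z * u1 z)%:E).
    by move=> ->; rewrite ltry.
  by apply/funext => z; rewrite expr1.
have meq n : (\int[muP]_z (r1 z * u1 z ^+ n.+1)%:E =
    \int[mu]_x (rlk b x * u2 x ^+ n.+1)%:E)%E by rewrite moment1 moment2.
have rb0 x : 0 <= rlk b x by exact: rlk_ge0.
have r10 z : 0 <= r1 z by rewrite mulr_ge0.
have := @moments_unique _ _ _ _ _ muP mu r1 u1 (rlk b) u2 mr1 (measurable_rlk b)
  mu1 mu2 r10 rb0 (fun z => expclip_01 _) (fun x => expclip_01 _) mfin meq _ (expR_gt0 (- r)).
rewrite (_ : (\int[mu]_x _)%E = (rlk (b + 1) r)%:E); last first.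
  rewrite -rlkD1//; apply: eq_integral => y _; congr EFin.
  by rewrite /u2 lt_expclip.
move=> <-; apply: integral_ae_muP.
- exact: measurable_pos_lt.
- apply/measurable_EFinP; apply: measurable_funM => //.
  exact: measurable_ltr_ind.
- by move=> z; rewrite lee_fin mulr_ge0.
- by move=> z; rewrite lee_fin mulr_ge0.
- by move=> x w x0; rewrite /pos_lt /r1/= ltNge x0 !mul0r.
- move=> x w x0 Dx; rewrite /pos_lt /r1 /u1 lt_expclip// /joint/= gtr0_norm//.
  by rewrite x0 Dx !mul1r.
Qed.

Lemma le_pos (f g : R * T -> R) :
  measurable_fun setT (EFin \o f) -> measurable_fun setT (EFin \o g) ->
  (forall z, 0 <= f z) -> (forall z, f z <= g z) ->
  (\int[muP]_z (f z)%:E <= \int[muP]_z (g z)%:E)%E.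
Proof.
move=> mf mg f0 fg; apply: ge0_le_integral => //.
- by move=> z _; rewrite lee_fin.
- by move=> z _; rewrite lee_fin.
Qed.

Let rlkSE r : 0 < r -> rlk (b + 1) r = r `^ b / Gamma (b + 1).
Proof. by move=> r0; rewrite /rlk pw_gt0E// addrK. Qed.

Let le_rlk r e : 0 <= r -> 0 < e -> (\int[muP]_z (pos_le r z)%:E <= (rlk (b + 1) (r + e))%:E)%E.
Proof.
move=> r0 e0; rewrite -potential_lt_gt0; last by rewrite ltr_wpDl.
apply: le_pos => //.
- by move=> z; rewrite mulr_ge0.
- move=> z; rewrite ler_wpM2l//; case: (leP (joint z)) => // zr.
  by rewrite (le_lt_trans zr)// ltrDl.
Qed.

Let cvg_rlkS r : 0 <= r -> rlk (b + 1) (r + n.+1%:R^-1) @[n --> \oo] --> rlk (b + 1) r.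
Proof.
move=> r0.
have rn n : 0 < r + n.+1%:R^-1 by rewrite ltr_wpDl// invr_gt0.
have cr : r + n.+1%:R^-1 @[n --> \oo] --> r.
  by rewrite -[X in _ --> X]addr0; apply: cvgD; [exact: cvg_cst|exact: cvg_harmonic].
under eq_fun do rewrite rlkSE//.
move: r0; rewrite le_eqVlt => /predU1P[r0|r0].
  subst r; have -> : rlk (b + 1) 0 = 0 * (Gamma (b + 1))^-1 by rewrite rlk_le0// mul0r.
  by apply: cvgMl; have /cvg_at_rightP := powR_cvg0 b0; exact.
rewrite rlkSE//; apply: cvgMl.
by apply: (@cvg_comp _ _ _ _ (@powR R ^~ b) _ _ _ cr); exact: derivable_cvg_powR.
Qed.

(** D <= r implies D < r + 1/(n+1); let n grow, using the right continuity of [rlk (b + 1)], also at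
    r = 0. *)
Let potential_le_ge0 r : 0 <= r -> (\int[muP]_z (pos_le r z)%:E <= (rlk (b + 1) r)%:E)%E.
Proof.
move=> r0.
have c : ((rlk (b + 1) (r + n.+1%:R^-1))%:E @[n --> \oo] --> (rlk (b + 1) r)%:E)%E.
  by apply: cvg_EFin; [near=> n|exact: cvg_rlkS].
by apply: (cvge_ge _ c); near=> n; exact: le_rlk.
Unshelve. all: by end_near. Qed.

Lemma potential_le r : (\int[muP]_z (pos_le r z)%:E = (rlk (b + 1) r)%:E)%E.
Proof.
have [r0|r0] := ltP 0 r; last first.
  rewrite (rlk_le0 _ r0); apply/le_anti/andP; split.
    rewrite -(rlk_le0 (b + 1) (lexx 0)); apply: le_trans (potential_le_ge0 (lexx 0)).
    apply: le_pos => //; first by move=> z; rewrite mulr_ge0.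
    move=> z; rewrite ler_wpM2l//; case: (leP (joint z) r) => // zr.
    by rewrite (le_trans zr).
  by apply: integral_ge0 => z _; rewrite lee_fin mulr_ge0.
apply/le_anti/andP; split; first exact: potential_le_ge0 (ltW r0).
rewrite -potential_lt_gt0//; apply: le_pos => //; first by move=> z; rewrite mulr_ge0.
by move=> z; rewrite ler_wpM2l//; case: (ltP (joint z) r) => // /ltW ->.
Qed.

Lemma potential_lt r : (\int[muP]_z (pos_lt r z)%:E = (rlk (b + 1) r)%:E)%E.
Proof.
have [r0|r0] := ltP 0 r; first exact: potential_lt_gt0.
apply/le_anti/andP; split.
  rewrite -potential_le; apply: le_pos => //; first by move=> z; rewrite mulr_ge0.
  by move=> z; rewrite ler_wpM2l//; case: (ltP (joint z) r) => // /ltW ->.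
rewrite (rlk_le0 _ r0).
by apply: integral_ge0 => z _; rewrite lee_fin mulr_ge0.
Qed.

End potential.

(* [tonelli] does not apply to [m1 \x m2] as its first measure: the canonical
   sigma-finiteness of a product is only found for subprobabilities. *)
Lemma tonelli_prod d1 d2 d3 (T1 : measurableType d1) (T2 : measurableType d2)
    (T3 : measurableType d3) (R : realType)
    (m1 : {sigma_finite_measure set T1 -> \bar R})
    (m2 : {sigma_finite_measure set T2 -> \bar R})
    (m3 : {sigma_finite_measure set T3 -> \bar R}) (G : T1 * T2 -> T3 -> \bar R) :
  measurable_fun setT (fun q : (T1 * T2) * T3 => G q.1 q.2) ->
  (forall z y, (0 <= G z y)%E) ->
  (\int[(m1 \x m2)%E]_z \int[m3]_y G z y = \int[m3]_y \int[(m1 \x m2)%E]_z G z y)%E.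
Proof.
move=> mG G0.
have mG' d' (S : measurableType d') (f : S -> T1) (g : S -> T2) (h : S -> T3) :
    measurable_fun setT f -> measurable_fun setT g -> measurable_fun setT h ->
    measurable_fun setT (fun q => G (f q, g q) (h q)).
  move=> mf mg mh; have mp : measurable_fun setT (fun q => ((f q, g q), h q)).
    by apply: measurable_fun_pair => //; exact: measurable_fun_pair.
  exact: (measurableT_comp mG mp).
rewrite integral_prodE; last 2 first.
- exact: (measurable_fun_fubini_tonelli_F (fun q : (T1 * T2) * T3 => G q.1 q.2)).
- by move=> z; exact: integral_ge0.
transitivity (\int[m1]_x \int[m3]_y \int[m2]_w G (x, w) y)%E.
  apply: eq_integral => x _; rewrite tonelli//.
  exact: mG'.
rewrite (@tonelli _ _ _ _ _ m1 m3 (fun x y => \int[m2]_w G (x, w) y)%E); last 2 first.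
- apply: (measurable_fun_fubini_tonelli_F
    (fun q : (T1 * T3) * T2 => G (q.1.1, q.2) q.1.2)) => //.
  apply: mG'.
  + exact: (measurableT_comp measurable_fst measurable_fst).
  + exact: measurable_snd.
  + exact: (measurableT_comp measurable_snd measurable_fst).
- by move=> x y; exact: integral_ge0.
apply: eq_integral => y _; rewrite integral_prodE//.
have mp : measurable_fun setT (fun z : T1 * T2 => (z, y)) by exact: measurable_fun_pair.
exact: (measurableT_comp mG mp).
Qed.

(** * The potential at two times *)

Section inverse_moments.
Context d (T : measurableType d) (R : realType) (P : probability T R).
Variables (b : R) (D : R -> {RV P >-> R}).
Hypothesis b01 : 0 < b < 1.
Hypothesis hD : stable_subordinator b D.
Local Notation mu := (@lebesgue_measure R).
Local Notation muP := ((mu \x P)%E).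
Let b0 : 0 < b. Proof. by case/andP: b01. Qed.
Let b10 : 0 < b + 1. Proof. by rewrite addr_gt0. Qed.
Let mrlk a := @measurable_rlk R a.
Let rlkb0 y : 0 <= rlk b y. Proof. exact: rlk_ge0. Qed.
Let pl0 s (z : R * T) : 0 <= pos_le D s z. Proof. by rewrite mulr_ge0. Qed.
Let rlkS0 y : 0 <= rlk (b + 1) y. Proof. exact: rlk_ge0. Qed.

(* The event [D x <= s, D (x + h) <= t] for [h > 0], integrated over [h]. *)
Lemma potential_after x s t : 0 < x ->
  (\int[mu]_y \int[P]_w ((x < y)%R%:R * ((D x w <= s)%R%:R * (D `|y| w <= t)%R%:R))%:E =
   \int[P]_w ((D x w <= s)%R%:R * rlk (b + 1) (t - D x w))%:E)%E.
Proof.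
move=> x0.
have mD y : measurable_fun setT (D y) by exact: measurable_funP.
pose F y := (\int[P]_w ((x < y)%R%:R * ((D x w <= s)%R%:R * (D `|y| w <= t)%R%:R))%:E)%E.
have mjD : measurable_fun setT (fun z : R * T => D `|z.1| z.2).
  exact: (measurable_joint hD).
have mF : measurable_fun setT F.
  apply: (@measurable_fun_fubini_tonelli_F _ _ _ _ R P (fun z : R * T =>
    ((x < z.1)%R%:R * ((D x z.2 <= s)%R%:R * (D `|z.1| z.2 <= t)%R%:R))%:E)).
    apply/measurable_EFinP; apply: measurable_funM.
      by apply: measurable_ltr_ind => //; exact: measurable_fst.
    apply: measurable_funM; last exact: measurable_ler_ind.
    by apply: measurable_ler_ind => //; exact: (measurableT_comp (mD x) measurable_snd).
  by move=> z; rewrite lee_fin !mulr_ge0.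
rewrite -[LHS]/(\int[mu]_y F y)%E -(ge0_integral_shift x)//; last first.
  by move=> y; apply: integral_ge0 => w _; rewrite lee_fin !mulr_ge0.
transitivity (\int[mu]_h \int[P]_w \int[P]_w'
    ((D x w' <= s)%R%:R * pos_le D (t - D x w') (h, w))%:E)%E.
  apply: eq_integral => h _; rewrite /F ltrDr.
  have [h0|h0] := ltP 0 h; last first.
    rewrite !integral0_eq// => w _; first by rewrite integral0_eq// => w' _;
      rewrite /pos_le /= ltNge h0 mul0r mulr0.
    by rewrite mul0r.
  pose phi (z : R * R) : \bar R := ((z.1 <= s)%R%:R * (z.2 <= t)%R%:R)%:E.
  have mphi : measurable_fun setT phi.
    have m1 : measurable_fun setT (fun z : R * R => z.1) by exact: measurable_fst.
    have m2 : measurable_fun setT (fun z : R * R => z.2) by exact: measurable_snd.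
    apply/measurable_EFinP; apply: measurable_funM.
      by apply: (@measurable_ler_ind _ _ _ (fun z : R * R => z.1) (fun=> s)).
    by apply: (@measurable_ler_ind _ _ _ (fun z : R * R => z.2) (fun=> t)).
  transitivity (\int[P]_w phi (D x w, D (x + h)%R w))%E.
    apply: eq_integral => w _; rewrite mul1r gtr0_norm ?addr_gt0// [h + x]addrC.
    by [].
  rewrite (levy_split (stable_levy hD) x0 h0 mphi); last by move=> z; rewrite lee_fin mulr_ge0.
  rewrite tonelli; last 2 first.
  - apply: (measurableT_comp mphi); apply: measurable_fun_pair.
      exact: (measurableT_comp (mD x) measurable_fst).
    apply: measurable_funD; first exact: (measurableT_comp (mD x) measurable_fst).
    exact: (measurableT_comp (mD h) measurable_snd).
  - by move=> w w'; rewrite lee_fin mulr_ge0.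
  apply: eq_integral => w _; apply: eq_integral => w' _.
  by rewrite /phi /pos_le /joint /= h0 mul1r gtr0_norm// lerBrDl.
pose G (z : R * T) (w' : T) : \bar R :=
  ((D x w' <= s)%R%:R * pos_le D (t - D x w') z)%:E.
have mG : measurable_fun setT (fun q : (R * T) * T => G q.1 q.2).
  have mD2 : measurable_fun setT (fun q : (R * T) * T => D x q.2).
    exact: (measurableT_comp (mD x) measurable_snd).
  apply/measurable_EFinP; apply: measurable_funM; first exact: measurable_ler_ind.
  apply: measurable_funM.
    apply: measurable_ltr_ind => //.
    exact: (measurableT_comp measurable_fst measurable_fst).
  apply: measurable_ler_ind; first exact: (measurableT_comp (measurable_joint hD) measurable_fst).
  exact: measurable_funB.
have G0 z w' : (0 <= G z w')%E by rewrite lee_fin !mulr_ge0.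
transitivity (\int[muP]_z \int[P]_w' G z w')%E.
  rewrite integral_prodE//.
  - exact: (measurable_fun_fubini_tonelli_F (fun q : (R * T) * T => G q.1 q.2)).
  - by move=> z; exact: integral_ge0.
rewrite tonelli_prod//; apply: eq_integral => w' _.
rewrite EFinM -(potential_le b01 hD) -ge0_integralZl//.
- exact: (measurable_pos_le hD).
- by move=> z _; rewrite lee_fin mulr_ge0.
Qed.

(** The integrand lies between the indicators of D < min(s, t) and D <= min(s, t), which have the
    same potential. *)
Lemma potential_min s t :
  (\int[muP]_z (pos_le D s z * (joint D z < t)%R%:R)%:E =
   (rlk (b + 1) (Num.min s t))%:E)%E.
Proof.
have mf : measurable_fun setT (fun z => (pos_le D s z * (joint D z < t)%R%:R)%:E).
  apply/measurable_EFinP; apply: measurable_funM; first by apply/measurable_EFinP; exact: (measurable_pos_le hD).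
  by apply: measurable_ltr_ind => //; exact: (measurable_joint hD).
apply/le_anti/andP; split.
  rewrite -(potential_le b01 hD); apply: ge0_le_integral => //.
  - by move=> z _; rewrite lee_fin !mulr_ge0.
  - exact: (measurable_pos_le hD).
  - move=> z _; rewrite lee_fin /pos_le -mulrA ler_wpM2l// le_min.
    have [zt|_] := ltP (joint D z) t; last by rewrite mulr0 ler0n.
    by rewrite mulr1 (ltW zt) andbT.
rewrite -(potential_lt b01 hD); apply: ge0_le_integral => //.
- by move=> z _; rewrite lee_fin !mulr_ge0.
- exact: (measurable_pos_lt hD).
- move=> z _; rewrite lee_fin /pos_le /pos_lt -mulrA ler_wpM2l// lt_min.
  case: (ltP (joint D z) s) => [/ltW ->|_] /=; first by rewrite mul1r.
  by rewrite mulr_ge0.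
Qed.

Definition earlier_later s t x y w : R :=
  (0 < x)%R%:R * ((x < y)%R%:R * ((D `|x| w <= s)%R%:R * (D `|y| w <= t)%R%:R)).

(** [potential_after] integrates out y and leaves [rlk (b + 1)] at t - D x, to be integrated against
    the potential, which is known on half-lines only. So this factor is expanded as an integral of
    [rlk b] up to t - D x, the potential of D x <= min(s, t - y) is inserted, expanded in turn, and
    the integrals are exchanged back. *)
Lemma pair_potential s t :
  (\int[mu]_x \int[mu]_y \int[P]_w (earlier_later s t x y w)%:E =
   \int[mu]_y (rlk b y * (y < s)%R%:R * rlk (b + 1) (t - y))%:E)%E.
Proof.
have mj := measurable_joint hD.
pose G (z : R * T) (y : R) : \bar R :=
  (pos_le D s z * (rlk b y * (y < t - joint D z)%R%:R))%:E.
have mG : measurable_fun setT (fun q : (R * T) * R => G q.1 q.2).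
  have m1 : measurable_fun setT (fun q : (R * T) * R => joint D q.1).
    exact: (measurableT_comp mj measurable_fst).
  apply/measurable_EFinP; apply: measurable_funM.
    have mp : measurable_fun setT (pos_le D s) by apply/measurable_EFinP; exact: (measurable_pos_le hD).
    exact: (measurableT_comp mp measurable_fst).
  apply: measurable_funM; first exact: (measurableT_comp (mrlk b) measurable_snd).
  by apply: measurable_ltr_ind; [exact: measurable_snd|exact: measurable_funB].
have G0 z y : (0 <= G z y)%E.
  by rewrite lee_fin; apply: mulr_ge0; [exact: pl0|apply: mulr_ge0].
transitivity (\int[muP]_z (pos_le D s z * rlk (b + 1) (t - joint D z))%:E)%E.
  rewrite integral_prodE; last 2 first.
  - apply/measurable_EFinP; apply: measurable_funM.
      by apply/measurable_EFinP; exact: (measurable_pos_le hD).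
    by apply: (measurableT_comp (mrlk (b + 1))); exact: measurable_funB.
  - by move=> z; rewrite lee_fin mulr_ge0.
  apply: eq_integral => x _.
  have [x0|x0] := ltP 0 x; last first.
    rewrite !integral0_eq// => w _; first by rewrite /pos_le /= ltNge x0 !mul0r.
    by rewrite integral0_eq// => w' _; rewrite /earlier_later ltNge x0 mul0r.
  rewrite /earlier_later /pos_le /joint/= x0 gtr0_norm//.
  under eq_integral => y _ do under eq_integral => w _ do rewrite mul1r.
  rewrite potential_after//.
  by apply: eq_integral => w _; rewrite mul1r.
transitivity (\int[muP]_z \int[mu]_y G z y)%E.
  apply: eq_integral => z _; rewrite EFinM -rlkD1// -ge0_integralZl//.
  - apply/measurable_EFinP; apply: measurable_funM; first exact: mrlk.
    exact: measurable_ltr_ind.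
  - by move=> y _; rewrite lee_fin mulr_ge0.
  - by rewrite lee_fin mulr_ge0.
rewrite tonelli_prod//.
transitivity (\int[mu]_y (rlk b y * rlk (b + 1) (Num.min s (t - y)))%:E)%E.
  apply: eq_integral => y _; rewrite EFinM -potential_min -ge0_integralZl//.
  - apply: eq_integral => z _; rewrite /G -EFinM; congr EFin.
    by rewrite ltrBrDr -ltrBrDl mulrCA.
  - apply/measurable_EFinP; apply: measurable_funM; first by apply/measurable_EFinP; exact: (measurable_pos_le hD).
    exact: measurable_ltr_ind.
  - by move=> z _; rewrite lee_fin mulr_ge0.
  - by rewrite lee_fin.
pose H (y x : R) : \bar R := (rlk b y * (rlk b x * (x < Num.min s (t - y))%R%:R))%:E.
transitivity (\int[mu]_y \int[mu]_x H y x)%E.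
  apply: eq_integral => y _; rewrite EFinM -(rlkD1 (Num.min s (t - y)) b0) -ge0_integralZl//.
  - apply/measurable_EFinP; apply: measurable_funM; first exact: mrlk.
    exact: measurable_ltr_ind.
  - by move=> x _; rewrite lee_fin mulr_ge0.
  - by rewrite lee_fin.
rewrite tonelli; last 2 first.
- apply/measurable_EFinP; apply: measurable_funM.
    exact: (measurableT_comp (mrlk b) measurable_fst).
  apply: measurable_funM; first exact: (measurableT_comp (mrlk b) measurable_snd).
  apply: measurable_ltr_ind; first exact: measurable_snd.
  by apply: measurable_minr => //; apply: measurable_funB => //; exact: measurable_fst.
- by move=> y x; rewrite lee_fin; apply: mulr_ge0 => //; exact: mulr_ge0.
apply: eq_integral => x _; rewrite EFinM -(rlkD1 (t - x) b0) -ge0_integralZl//.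
- apply: eq_integral => y _; rewrite /H -EFinM; congr EFin.
  rewrite lt_min ltrBrDr -ltrBrDl; case: (x < s); case: (y < t - x); rewrite /=; ring.
- apply/measurable_EFinP; apply: measurable_funM; first exact: mrlk.
  exact: measurable_ltr_ind.
- by move=> y _; rewrite lee_fin mulr_ge0.
- by rewrite lee_fin mulr_ge0.
Qed.

End inverse_moments.

Lemma tonelli_rot d1 d2 d3 (T1 : measurableType d1) (T2 : measurableType d2)
    (T3 : measurableType d3) (R : realType)
    (m1 : {sigma_finite_measure set T1 -> \bar R})
    (m2 : {sigma_finite_measure set T2 -> \bar R})
    (m3 : {sigma_finite_measure set T3 -> \bar R}) (f : T1 -> T2 -> T3 -> \bar R) :
  measurable_fun setT (fun q : (T1 * T2) * T3 => f q.1.1 q.1.2 q.2) ->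
  (forall w x y, (0 <= f w x y)%E) ->
  (\int[m1]_w \int[m2]_x \int[m3]_y f w x y =
   \int[m2]_x \int[m3]_y \int[m1]_w f w x y)%E.
Proof.
move=> mf f0.
rewrite (@tonelli _ _ _ _ _ m1 m2 (fun w x => \int[m3]_y f w x y)%E); last 2 first.
- exact: (measurable_fun_fubini_tonelli_F (fun q : (T1 * T2) * T3 => f q.1.1 q.1.2 q.2)).
- by move=> w x; exact: integral_ge0.
apply: eq_integral => x _; rewrite tonelli//.
have mp : measurable_fun setT (fun z : T1 * T3 => ((z.1, x), z.2)).
  apply: measurable_fun_pair => //; apply: measurable_fun_pair => //.
exact: (measurableT_comp mf mp).
Qed.

(** * Moments of the inverse subordinator *)

Section inverse_product.
Context d (T : measurableType d) (R : realType) (P : probability T R).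
Variables (b : R) (D : R -> {RV P >-> R}).
Hypothesis b01 : 0 < b < 1.
Hypothesis hD : stable_subordinator b D.
Local Notation mu := (@lebesgue_measure R).
Local Notation Y := (inverse_subordinator D).

Let b0 : 0 < b. Proof. by case/andP: b01. Qed.
Let b10 : 0 < b + 1. Proof. by rewrite addr_gt0. Qed.

Let a s w x : R := (0 < x)%R%:R * (D `|x| w <= s)%R%:R.
(** The occupation length, almost surely equal to Y s; being an integral, it is open to Tonelli. *)
Let L s w : \bar R := (\int[mu]_x (a s w x)%:E)%E.

Let a0 s w x : 0 <= a s w x. Proof. by rewrite mulr_ge0. Qed.

Let L0 s w : (0 <= L s w)%E.
Proof. by apply: integral_ge0 => x _; rewrite lee_fin a0. Qed.

Let ma s : measurable_fun setT (fun z : R * T => (a s z.2 z.1)%:E).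
Proof. exact: (measurable_pos_le hD). Qed.

Let mL s : measurable_fun setT (L s).
Proof.
have H := @measurable_fun_fubini_tonelli_G _ _ _ _ R mu (fun z : R * T => (a s z.2 z.1)%:E) (ma s).
by apply: H => z; rewrite lee_fin a0.
Qed.

Let max' s w : measurable_fun setT (fun x => (a s w x)%:E).
Proof.
have mp : measurable_fun setT (fun x : R => (x, w)) by exact: measurable_fun_pair.
exact: (measurableT_comp (ma s) mp).
Qed.

Let integral_L s : (\int[P]_w L s w = (rlk (b + 1) s)%:E)%E.
Proof.
rewrite -(potential_le b01 hD) integral_prodE; last 2 first.
- exact: (measurable_pos_le hD).
- by move=> z; rewrite lee_fin mulr_ge0.
rewrite (@tonelli _ _ _ _ _ mu P (fun x w => (pos_le D s (x, w))%:E))//.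
- exact: (measurable_pos_le hD).
- by move=> x w; rewrite lee_fin mulr_ge0.
Qed.

(** The finite mean of L makes it finite almost surely, which is the condition of
    [integral_first_passage]. *)
Let ae_L s : {ae P, forall w, L s w = (Y s w)%:E}.
Proof.
have iL : P.-integrable setT (L s).
  apply/integrableP; split; first exact: mL.
  under eq_integral do rewrite gee0_abs//.
  by rewrite integral_L ltry.
apply: filterS2 (integrable_ae measurableT iL) (stable_nondecreasing hD) => w Lfin nd.
have {}Lfin : (L s w < +oo)%E by rewrite -ge0_fin_numE//; exact: Lfin.
exact: (integral_first_passage nd Lfin).
Qed.

Let mY s : measurable_fun setT (Y s).
Proof. exact: measurable_inverse_subordinator (stable_levy hD) _. Qed.

Lemma inverse_mean s : (\int[P]_w (Y s w)%:E = (rlk (b + 1) s)%:E)%E.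
Proof.
rewrite -integral_L; apply: ge0_ae_integral => //.
- exact/measurable_EFinP.
- by move=> w; rewrite lee_fin inverse_subordinator_ge0.
- by apply: filterS (ae_L s) => w ->.
Qed.

Lemma inverse_ae_le s t : s <= t -> {ae P, forall w, Y s w <= Y t w}.
Proof.
move=> st; apply: filterS2 (ae_L s) (ae_L t) => w Ls Lt.
rewrite -lee_fin -Ls -Lt; apply: (@ge0_le_integral _ _ _ mu _ measurableT _ _ _ (max' s w) (max' t w)) => x _.
  by rewrite lee_fin a0.
rewrite lee_fin /a ler_wpM2l//.
by have [Ds|//] := leP (D `|x| w) s; rewrite (le_trans Ds st).
Qed.

Let A s t w x y : \bar R := (earlier_later D s t x y w)%:E.

Let A0 s t w x y : (0 <= A s t w x y)%E.
Proof. by rewrite lee_fin /earlier_later !mulr_ge0. Qed.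

Let mA s t : measurable_fun setT (fun q : (T * R) * R => A s t q.1.1 q.1.2 q.2).
Proof.
have mw : measurable_fun setT (fun q : (T * R) * R => q.1.1).
  exact: (measurableT_comp measurable_fst measurable_fst).
have mx : measurable_fun setT (fun q : (T * R) * R => q.1.2).
  exact: (measurableT_comp measurable_snd measurable_fst).
have my : measurable_fun setT (fun q : (T * R) * R => q.2) by exact: measurable_snd.
have mD (z : (T * R) * R -> R) (mz : measurable_fun setT z) : measurable_fun setT (fun q : (T * R) * R => D `|z q| q.1.1).
  have mp : measurable_fun setT (fun q : (T * R) * R => (z q, q.1.1)).
    exact: measurable_fun_pair.
  exact: (measurableT_comp (measurable_joint hD) mp).
apply/measurable_EFinP; apply: measurable_funM; first exact: measurable_ltr_ind.
apply: measurable_funM; first exact: measurable_ltr_ind.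
by apply: measurable_funM; apply: measurable_ler_ind => //; exact: mD.
Qed.

Let mAxy s t w : measurable_fun setT (fun z : R * R => A s t w z.1 z.2).
Proof.
have mp : measurable_fun setT (fun z : R * R => ((w, z.1), z.2)).
  by apply: measurable_fun_pair => //; exact: measurable_fun_pair.
exact: (measurableT_comp (mA s t) mp).
Qed.

Let K s t : \bar R := (\int[mu]_y (rlk b y * (y < s)%R%:R * rlk (b + 1) (t - y))%:E)%E.

Let mA2 s t w x : measurable_fun setT (fun y => A s t w x y).
Proof.
have mp : measurable_fun setT (fun y : R => (x, y)) by exact: measurable_fun_pair.
exact: (measurableT_comp (mAxy s t w) mp).
Qed.

Let mA1 s t w y : measurable_fun setT (fun x => A s t w x y).
Proof.
have mp : measurable_fun setT (fun x : R => (x, y)) by exact: measurable_fun_pair.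
exact: (measurableT_comp (mAxy s t w) mp).
Qed.

(** A product of two integrals is a double integral, cut along the null diagonal: one half has x <
    y, the other becomes the same expression with s and t exchanged. *)
Let L_mul s t w :
  (L s w * L t w = \int[mu]_x \int[mu]_y A s t w x y + \int[mu]_x \int[mu]_y A t s w x y)%E.
Proof.
rewrite [X in (_ + X)%E](@tonelli _ _ _ _ _ mu mu (A t s w) (mAxy t s w) (A0 t s w)).
rewrite -ge0_integralD//; last 4 first.
- by move=> x _; exact: integral_ge0.
- exact: (@measurable_fun_fubini_tonelli_F _ _ _ _ R mu (fun z : R * R => A s t w z.1 z.2)
    (mAxy s t w) (fun z => A0 s t w z.1 z.2)).
- by move=> x _; exact: integral_ge0.
- exact: (@measurable_fun_fubini_tonelli_G _ _ _ _ R mu (fun z : R * R => A t s w z.1 z.2)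
    (mAxy t s w) (fun z => A0 t s w z.1 z.2)).
have a0E s' x : (0 <= (a s' w x)%:E)%E by rewrite lee_fin.
rewrite muleC -[LHS](ge0_integralZl mu measurableT (max' s w) (fun x _ => a0E s x) (L0 t w)).
apply: eq_integral => x _.
rewrite -[RHS](ge0_integralD mu measurableT (fun y _ => A0 s t w x y) (mA2 s t w x)
  (fun y _ => A0 t s w y x) (mA1 t s w x)).
rewrite muleC -[LHS](ge0_integralZl mu measurableT (max' t w) (fun y _ => a0E t y) (a0E s x)).
apply: ge0_ae_integral.
- by apply: emeasurable_funM; [exact: measurable_cst|exact: max'].
- by apply: emeasurable_funD; [exact: mA2|exact: mA1].
- by move=> y; apply: mule_ge0; exact: a0E.
- by move=> y; apply: adde_ge0; exact: A0.
exists [set x]; split; [exact: measurable_set1|exact: lebesgue_measure_set1|].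
move=> y /= ne; apply: contrapT => yx; apply: ne.
rewrite /A /a /earlier_later -EFinD -EFinM; congr EFin.
have [xy|yx'|xy] := ltgtP x y; last by case: yx.
- have [x0|x0] := ltP 0 x; last by rewrite !(mul0r, mulr0, addr0).
  by rewrite (lt_trans x0 xy) !(mul1r, mul0r, mulr0, addr0).
- have [y0|y0] := ltP 0 y; last by rewrite !(mul0r, mulr0, addr0).
  by rewrite (lt_trans y0 yx') !(mul1r, mul0r, mulr0, add0r) mulrC.
Qed.

Let integral_A s t : (\int[P]_w \int[mu]_x \int[mu]_y A s t w x y = K s t)%E.
Proof.
rewrite (@tonelli_rot _ _ _ _ _ _ _ P mu mu (A s t) (mA s t) (A0 s t)).
exact: (pair_potential b01 hD).
Qed.

Lemma inverse_prod s t : s <= t ->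
  (\int[P]_w (Y s w * Y t w)%:E = (rlk (2 * b + 1) s)%:E +
   \int[mu]_y (rlk b y * (y < s)%R%:R * rlk (b + 1) (t - y))%:E)%E.
Proof.
move=> st.
transitivity (\int[P]_w (L s w * L t w))%E.
  apply: ge0_ae_integral.
  - by apply/measurable_EFinP; exact: measurable_funM.
  - exact: emeasurable_funM.
  - by move=> w; rewrite lee_fin mulr_ge0// inverse_subordinator_ge0.
  - by move=> w; rewrite mule_ge0.
  - by apply: filterS2 (ae_L s) (ae_L t) => w -> ->; rewrite EFinM.
under eq_integral do rewrite L_mul.
have mAA s' t' : measurable_fun setT (fun w => \int[mu]_x \int[mu]_y A s' t' w x y)%E.
  have m1 := @measurable_fun_fubini_tonelli_F _ _ _ _ R mu
    (fun q : (T * R) * R => A s' t' q.1.1 q.1.2 q.2) (mA s' t') (fun q => A0 s' t' q.1.1 q.1.2 q.2).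
  apply: (@measurable_fun_fubini_tonelli_F _ _ _ _ R mu _ m1).
  by move=> q; apply: integral_ge0 => y _; exact: A0.
have A00 s' t' w : (0 <= \int[mu]_x \int[mu]_y A s' t' w x y)%E.
  by apply: integral_ge0 => x _; exact: integral_ge0.
rewrite (ge0_integralD P measurableT (fun w _ => A00 s t w) (mAA s t)
  (fun w _ => A00 t s w) (mAA t s)) !integral_A addeC; congr (_ + _)%E.
(* For the exchanged half, s - y > 0 already forces y < t, so the integral is a full convolution. *)
rewrite (_ : 2 * b + 1 = b + (b + 1)); last by ring.
rewrite -(conv_rlk s b0 b10) /conv /K; apply: eq_integral => y _; congr EFin.
have [_|ty] := ltP y t; first by rewrite mulr1.
by rewrite mulr0 mul0r [rlk (b + 1) (s - y)]rlk_le0 ?mulr0// subr_le0 (le_trans st).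
Qed.

End inverse_product.

(** * Time change *)

Section sub_sigma_algebra.
Context d (T : measurableType d) (R : realType) (P : probability T R).
Variable X : R -> T -> R.

Let G : set (set T) :=
  \bigcup_(t in [set t : R | 0 <= t]) preimage_set_system setT (X t) measurable.

(** The identity, with values in [T] under the sigma-algebra of the process, serves as a random
    variable that carries the whole path. *)
Lemma measurable_process_id : (forall t, 0 <= t -> measurable_fun setT (X t)) ->
  measurable_fun setT (id : T -> g_sigma_algebraType G).
Proof.
move=> mX _ B mB; rewrite setTI.
move: B mB; apply: smallest_sub; first exact: sigma_algebra_measurable.
by move=> A [t t0 [B mB <-]]; apply: mX.
Qed.

Lemma measurable_process_at t : 0 <= t ->
  measurable_fun setT (X t : g_sigma_algebraType G -> R).
Proof.
move=> t0 _ B mB; apply: sub_gen_smallest; exists t => //.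
by exists B.
Qed.

End sub_sigma_algebra.

Section rlk_bounds.
Context (R : realType) (b : R).
Hypothesis b0 : 0 < b.
Local Notation mu := (@lebesgue_measure R).

Let b10 : 0 < b + 1. Proof. by rewrite addr_gt0. Qed.

Lemma rlkS_le z t : z <= t -> rlk (b + 1) z <= rlk (b + 1) t.
Proof.
move=> zt; have [z0|z0] := ltP 0 z; last by rewrite (rlk_le0 _ z0) rlk_ge0.
have t0 := lt_le_trans z0 zt.
rewrite /rlk ler_wpM2r ?invr_ge0 ?(ltW (Gamma_gt0 b10))// !pw_gt0E// addrK.
by apply: ge0_ler_powR; rewrite ?nnegrE ?(ltW b0) ?(ltW z0) ?(ltW t0).
Qed.

Definition rlk_tail s t : R :=
  \int[mu]_y (rlk b y * (y < s)%R%:R * rlk (b + 1) (t - y)).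

Lemma measurable_rlk_tail s t :
  measurable_fun setT (fun y => rlk b y * (y < s)%R%:R * rlk (b + 1) (t - y)).
Proof.
apply: measurable_funM.
  by apply: measurable_funM; [exact: measurable_rlk|exact: measurable_ltr_ind].
by apply: (measurableT_comp (measurable_rlk (b + 1))); exact: measurable_funB.
Qed.

Let tail_ge0 s t y : 0 <= rlk b y * (y < s)%R%:R * rlk (b + 1) (t - y).
Proof. by rewrite mulr_ge0 ?rlk_ge0// mulr_ge0 ?rlk_ge0. Qed.

(** On y > 0 the increasing factor [rlk (b + 1)] is at most its value at t; what remains integrates
    to [rlk (b + 1) s]. *)
Let tail_le s t :
  (\int[mu]_y (rlk b y * (y < s)%R%:R * rlk (b + 1) (t - y))%:E <=
   (rlk (b + 1) t * rlk (b + 1) s)%:E)%E.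
Proof.
rewrite EFinM -(rlkD1 s b0) -ge0_integralZl//; last 3 first.
- apply/measurable_EFinP; apply: measurable_funM; first exact: measurable_rlk.
  exact: measurable_ltr_ind.
- by move=> y _; rewrite lee_fin mulr_ge0 ?rlk_ge0.
- by rewrite lee_fin rlk_ge0.
apply: ge0_le_integral => //.
- by move=> y _; rewrite lee_fin tail_ge0.
- by apply/measurable_EFinP; exact: measurable_rlk_tail.
- apply/measurable_EFinP; apply: measurable_funM => //; apply: measurable_funM.
    exact: measurable_rlk.
  exact: measurable_ltr_ind.
move=> y _; rewrite -EFinM lee_fin mulrC.
have [y0|y0] := ltP 0 y; last by rewrite (rlk_le0 _ y0) !mul0r !mulr0.
rewrite ler_wpM2r//; first by rewrite mulr_ge0 ?rlk_ge0.
by apply: rlkS_le; rewrite gerBl ltW.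
Qed.

Lemma rlk_tailE s t :
  (\int[mu]_y (rlk b y * (y < s)%R%:R * rlk (b + 1) (t - y))%:E = (rlk_tail s t)%:E)%E.
Proof.
rewrite /rlk_tail /Rintegral fineK// ge0_fin_numE.
  by rewrite (le_lt_trans (tail_le s t))// ltry.
by apply: integral_ge0 => y _; rewrite lee_fin tail_ge0.
Qed.

Lemma rlk_tail_ge0 s t : 0 <= rlk_tail s t.
Proof.
by rewrite -lee_fin -rlk_tailE; apply: integral_ge0 => y _; rewrite lee_fin tail_ge0.
Qed.

Lemma rlk_tail_le s t : rlk_tail s t <= rlk (b + 1) t * rlk (b + 1) s.
Proof. by rewrite -lee_fin -rlk_tailE tail_le. Qed.

Lemma measurable_rlk_tail2 : measurable_fun setT (fun z : R * R => rlk_tail z.1 z.2).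
Proof.
apply/measurable_EFinP.
rewrite (_ : _ \o _ = fun z : R * R =>
  (\int[mu]_y (rlk b y * (y < z.1)%R%:R * rlk (b + 1) (z.2 - y))%:E)%E); last first.
  by apply/funext => z /=; rewrite rlk_tailE.
apply: (@measurable_fun_fubini_tonelli_F _ _ _ _ R mu (fun q : (R * R) * R =>
  (rlk b q.2 * (q.2 < q.1.1)%R%:R * rlk (b + 1) (q.1.2 - q.2))%:E)); last first.
  by move=> q; rewrite lee_fin tail_ge0.
have m2 : measurable_fun setT (fun q : (R * R) * R => q.2) by exact: measurable_snd.
apply/measurable_EFinP; apply: measurable_funM.
  apply: measurable_funM; first exact: (measurableT_comp (measurable_rlk b) m2).
  by apply: measurable_ltr_ind => //; exact: (measurableT_comp measurable_fst measurable_fst).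
have mB : measurable_fun setT (fun q : (R * R) * R => q.1.2 - q.2).
  by apply: measurable_funB => //; exact: (measurableT_comp measurable_snd measurable_fst).
exact: (measurableT_comp (measurable_rlk (b + 1)) mB).
Qed.

End rlk_bounds.

Section time_changed_moments.
Context d (T : measurableType d) (R : realType) (P : probability T R).
Variables (k : nat) (lam : nat -> R) (b : R) (M D : R -> {RV P >-> R}).
Hypothesis hlam : forall j : nat, (1 <= j <= k)%N -> 0 < lam j.
Hypothesis b01 : 0 < b < 1.
Hypothesis hM : generalized_counting_process k lam M.
Hypothesis hD : stable_subordinator b D.
Hypothesis hind : independent_processes P M (inverse_subordinator D).
Local Notation mu := (@lebesgue_measure R).
Local Notation Y := (inverse_subordinator D).
Local Notation Mb := (time_changed M Y).

Let c1 : R := \sum_(1 <= j < k.+1) j%:R * lam j.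
Let c2 : R := \sum_(1 <= j < k.+1) j%:R ^+ 2 * lam j.

Let b0 : 0 < b. Proof. by case/andP: b01. Qed.
Let b10 : 0 < b + 1. Proof. by rewrite addr_gt0. Qed.

Let mY s : measurable_fun setT (Y s).
Proof. exact: measurable_inverse_subordinator (stable_levy hD) _. Qed.

Let Y0 s w : 0 <= Y s w. Proof. exact: inverse_subordinator_ge0. Qed.

Lemma time_changed_ge0 s w : 0 <= Mb s w.
Proof. by rewrite /time_changed (counting_ge0 hM). Qed.

Lemma measurable_time_changed : measurable_fun setT (fun z : R * T => Mb z.1 z.2).
Proof.
have mp : measurable_fun setT (fun z : R * T => (Y z.1 z.2, z.2)).
  apply: measurable_fun_pair; last exact: measurable_snd.
  exact: measurable_inverse_subordinator_joint (stable_levy hD).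
have := measurableT_comp (measurable_joint_levy (gcp_levy hM)) mp.
apply: eq_measurable_fun => z _ /=.
by rewrite /time_changed ger0_norm.
Qed.

Let GM : set (set T) :=
  \bigcup_(t in [set t : R | 0 <= t]) preimage_set_system setT (M t) measurable.
Let GY : set (set T) :=
  \bigcup_(t in [set t : R | 0 <= t]) preimage_set_system setT (Y t) measurable.

(** Joint measurability for the sigma-algebra of M alone, since independence is formulated with that
    one. *)
Let mjM : measurable_fun setT (fun z : R * g_sigma_algebraType GM => M `|z.1| z.2).
Proof.
apply: (@measurable_right_continuous _ (g_sigma_algebraType GM) _ (fun t => M t : T -> R)).
  move=> t t0; have H := @measurable_process_at _ _ _ (fun t => M t : T -> R) t t0. exact: H.
exact: levy_right_continuous (gcp_levy hM).
Qed.

(** Conditioning on the path of Y: with both paths as independent variables, the times Y s, Y t are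
    frozen at w' while M runs over w. *)
Let cond_integral (s t : R) (phi : R * R -> \bar R) : 0 <= s -> 0 <= t ->
  measurable_fun setT phi -> (forall z, 0 <= phi z)%E ->
  (\int[P]_w phi (Mb s w, Mb t w) =
   \int[P]_w' \int[P]_w phi (M (Y s w') w, M (Y t w') w))%E.
Proof.
move=> s0 t0 mphi phi0.
have mIM : measurable_fun setT (id : T -> g_sigma_algebraType GM).
  by apply: measurable_process_id => t' _; exact: measurable_funP.
have mIY : measurable_fun setT (id : T -> g_sigma_algebraType GY).
  by apply: measurable_process_id => t' _; exact: mY.
pose IM : {mfun T >-> g_sigma_algebraType GM} := HB.pack (id : T -> g_sigma_algebraType GM)
  (isMeasurableFun.Build _ _ _ _ _ mIM).
pose IY : {mfun T >-> g_sigma_algebraType GY} := HB.pack (id : T -> g_sigma_algebraType GY)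
  (isMeasurableFun.Build _ _ _ _ _ mIY).
pose psi (z : g_sigma_algebraType GM * g_sigma_algebraType GY) : \bar R :=
  phi (M `|Y s z.2| z.1, M `|Y t z.2| z.1).
have mpsi : measurable_fun setT psi.
  have mYs r : 0 <= r -> measurable_fun setT
      (fun z : g_sigma_algebraType GM * g_sigma_algebraType GY => (Y r z.2, z.1)).
    move=> r0; apply: measurable_fun_pair; last exact: measurable_fst.
    have H := @measurable_process_at _ _ _ Y r r0.
    exact: (measurableT_comp H measurable_snd).
  apply: (measurableT_comp mphi); apply: measurable_fun_pair.
    exact: (measurableT_comp mjM (mYs _ s0)).
  exact: (measurableT_comp mjM (mYs _ t0)).
have h := @indep_integral _ _ _ _ _ _ _ P IM IY psi hind mpsi (fun z => phi0 _).
transitivity (\int[P]_w psi (IM w, IY w))%E.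
  by apply: eq_integral => w _; rewrite /psi /= !ger0_norm.
rewrite h; apply: eq_integral => w' _; apply: eq_integral => w _.
by rewrite /psi /= !ger0_norm.
Qed.

Lemma time_changed_mean s : 0 <= s ->
  (\int[P]_w (Mb s w)%:E = (c1 * rlk (b + 1) s)%:E)%E.
Proof.
move=> s0.
transitivity (\int[P]_w `|Mb s w|%:E)%E.
  by apply: eq_integral => w _; rewrite ger0_norm// time_changed_ge0.
rewrite (cond_integral s0 s0 (phi := fun z => `|z.1|%:E)); last 2 first.
- apply/measurable_EFinP; apply: measurableT_comp => //; exact: measurable_fst.
- by move=> z; rewrite lee_fin.
transitivity (\int[P]_w' (c1 * Y s w')%:E)%E.
  apply: eq_integral => w' _ /=; rewrite -(counting_mean0 hlam hM)//.
  by apply: eq_integral => w _; rewrite ger0_norm// (counting_ge0 hM).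
have L := inverse_mean b01 hD s.
have E := integral_affine3 0 c1 0 (mY s) (mY s) (Y0 s) (Y0 s) L L.
rewrite (_ : c1 * rlk (b + 1) s = 0 + c1 * rlk (b + 1) s + 0 * rlk (b + 1) s); last by ring.
by rewrite -E; apply: eq_integral => w _; congr EFin; ring.
Qed.

Lemma time_changed_prod s t : 0 <= s -> s <= t ->
  (\int[P]_w (Mb s w * Mb t w)%:E =
   (c2 * rlk (b + 1) s + c1 ^+ 2 * (rlk (2 * b + 1) s + rlk_tail b s t))%:E)%E.
Proof.
move=> s0 st; have t0 := le_trans s0 st.
transitivity (\int[P]_w `|Mb s w * Mb t w|%:E)%E.
  by apply: eq_integral => w _; rewrite ger0_norm// mulr_ge0// time_changed_ge0.
rewrite (cond_integral s0 t0 (phi := fun z => `|z.1 * z.2|%:E)); last 2 first.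
- apply/measurable_EFinP; apply: measurableT_comp => //; apply: measurable_funM.
    exact: measurable_fst.
  exact: measurable_snd.
- by move=> z; rewrite lee_fin.
have mYY : measurable_fun setT (fun w => Y s w * Y t w) by exact: measurable_funM.
have YY0 w : 0 <= Y s w * Y t w by rewrite mulr_ge0.
have L1 := inverse_mean b01 hD s.
have L2 : (\int[P]_w (Y s w * Y t w)%:E = (rlk (2 * b + 1) s + rlk_tail b s t)%:E)%E.
  by rewrite (inverse_prod b01 hD st) rlk_tailE.
rewrite -[X in X%:E](add0r) addrA.
rewrite -(integral_affine3 0 c2 (c1 ^+ 2) (mY s) mYY (Y0 s) YY0 L1 L2).
pose F w' : \bar R :=
  (\int[P]_w `|M (Y s w') w * M (Y t w') w|%:E)%E.
have c20 : 0 <= c2.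
  rewrite /c2 big_nat_cond sumr_ge0// => i; rewrite andbT => ik.
  by rewrite mulr_ge0 ?sqr_ge0// ltW// hlam.
(* The minimum makes the formula valid at every w'; it is replaced by Y s only almost surely, at the
   end. *)
have FE w' : F w' = (c2 * Num.min (Y s w') (Y t w') + c1 ^+ 2 * (Y s w' * Y t w'))%:E.
  rewrite /F.
  transitivity (\int[P]_w (M (Y s w') w * M (Y t w') w)%:E)%E.
    by apply: eq_integral => w _; rewrite ger0_norm// mulr_ge0// (counting_ge0 hM).
  have [xy|/ltW yx] := leP (Y s w') (Y t w'); first by rewrite (counting_prod hlam hM).
  under eq_integral do rewrite mulrC.
  by rewrite (counting_prod hlam hM)// [Y t w' * _]mulrC.
rewrite -[LHS]/(\int[P]_w' F w')%E; under eq_integral do rewrite FE.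
apply: ge0_ae_integral.
- apply/measurable_EFinP; apply: measurable_funD; last exact: measurable_funM.
  by apply: measurable_funM => //; exact: measurable_minr.
- apply/measurable_EFinP; apply: measurable_funD; last exact: measurable_funM.
  by apply: measurable_funD => //; exact: measurable_funM.
- by move=> w; rewrite lee_fin addr_ge0// mulr_ge0 ?sqr_ge0// le_min !Y0.
- by move=> w; rewrite lee_fin !addr_ge0// mulr_ge0 ?sqr_ge0.
- by apply: filterS (inverse_ae_le b01 hD st) => w h; rewrite min_l// add0r.
Qed.

End time_changed_moments.

(** * Kernels as complete and incomplete beta integrals *)

Section kernel_integrals.
Context (R : realType).
Local Notation mu := (@lebesgue_measure R).
Implicit Types a b s t u : R.

(** Substitute y = u x: the powers of u add up to 1 + (b - 1) + b = 2b, and the cut y < s becomes x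
    < s/u. *)
Lemma rlk_tail_incomplete_Beta b s u : 0 < b -> 0 < s -> s < u ->
  rlk_tail b s u =
  u `^ (2 * b) * incomplete_Beta b (b + 1) (s / u) / (Gamma b * Gamma (b + 1)).
Proof.
move=> b0 s0 su; have u0 := lt_trans s0 su.
have b10 : 0 < b + 1 by rewrite addr_gt0.
have gb := Gamma_gt0 b0; have gb1 := Gamma_gt0 b10.
pose f x := pw b x * pw (b + 1) (1 - x) * (x < s / u)%R%:R.
have f0 x : 0 <= f x by rewrite !mulr_ge0 ?pw_ge0.
have mf : measurable_fun setT f.
  apply: measurable_funM; first by apply: measurable_convf; exact: measurable_pw.
  exact: measurable_ltr_ind.
have IE : incomplete_Beta b (b + 1) (s / u) = fine (\int[mu]_x (f x)%:E)%E.
  rewrite /incomplete_Beta /Rintegral; congr fine.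
  rewrite integral_mkcond; apply: eq_integral => x _.
  rewrite patchE mem_setE in_itv/= /f /pw subr_gt0.
  have su1 : s / u < 1 by rewrite ltr_pdivrMr// mul1r.
  have [x0|x0] := ltP 0 x; last by rewrite !mul0r.
  have [xs|xs] := ltP x (s / u); last by rewrite mulr0.
  by rewrite (lt_trans xs su1) mulr1.
set C := u `^ (2 * b) / (Gamma b * Gamma (b + 1)).
have C0 : 0 <= C.
  by apply: divr_ge0; [exact: powR_ge0|apply: mulr_ge0; exact: ltW].
have TE : ((rlk_tail b s u)%:E = C%:E * \int[mu]_x (f x)%:E)%E.
  rewrite -rlk_tailE// (@ge0_integral_affine _ u 0)//; last 2 first.
  - by apply/measurable_EFinP; exact: measurable_rlk_tail.
  - by move=> y; rewrite lee_fin; apply: mulr_ge0; [apply: mulr_ge0|]; rewrite ?rlk_ge0.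
  rewrite -!ge0_integralZl//; last 5 first.
  - exact/measurable_EFinP.
  - by move=> y _; rewrite lee_fin.
  - apply/measurable_EFinP.
    have ml : measurable_fun setT (fun x : R => u * x + 0) by exact: measurable_funD.
    exact: (measurableT_comp (measurable_rlk_tail b s u) ml).
  - by move=> y _; rewrite lee_fin; apply: mulr_ge0; [apply: mulr_ge0|]; rewrite ?rlk_ge0.
  - by rewrite lee_fin ltW.
  apply: eq_integral => x _; rewrite -!EFinM addr0; congr EFin.
  rewrite (_ : u - u * x = u * (1 - x)); last by ring.
  have -> : (u * x < s) = (x < s / u) by rewrite ltr_pdivlMr// mulrC.
  rewrite /rlk !pwM// addrK /C /f.
  have -> : u `^ (2 * b) = u * u `^ (b - 1) * u `^ b.
    rewrite mulr_powRB1 ?(ltW u0)// -powRD; last by rewrite (gt_eqF u0) implybT.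
    by congr (_ `^ _); ring.
  move: (Gamma b) (Gamma (b + 1)) gb gb1 => A B A0 B0.
  by field; rewrite !gt_eqF.
have : (rlk_tail b s u)%:E = (C%:E * \int[mu]_x (f x)%:E)%E := TE.
have If0 : (0 <= \int[mu]_x (f x)%:E)%E by apply: integral_ge0 => x _; rewrite lee_fin.
have Cp : 0 < C by apply: divr_gt0; [exact: powR_gt0|exact: mulr_gt0].
(* Since C > 0, the finite left side rules out an infinite integral, which [fine] would send to
   0. *)
move: If0; rewrite IE; case: (\int[mu]_x (f x)%:E)%E => [r| |]//= _.
  by rewrite -EFinM => -[->]; rewrite /C mulrAC.
by rewrite gt0_muley// lte_fin.
Qed.

(** At z = t - s this is the kernel at s times the integral of the kernel over ]s, t[. Hence the
    parameter 2a of the beta functions and the factor a in their denominators. *)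
Lemma rlkM a z : 0 < a ->
  rlk a z * rlk (a + 1) z = pw (2 * a) z / (Gamma a ^+ 2 * a).
Proof.
move=> a0; rewrite /rlk GammaD1//; have ga := Gamma_gt0 a0.
have [z0|z0] := ltP 0 z; last by rewrite !pw_le0// !mul0r.
rewrite !pw_gt0E// addrK.
have -> : z `^ (2 * a - 1) = z `^ (a - 1) * z `^ a.
  rewrite -powRD; last by rewrite (gt_eqF z0) implybT.
  by congr (_ `^ _); ring.
move: (Gamma a) ga => A A0.
by field; rewrite !gt_eqF.
Qed.

Lemma integral_rlkM a c t : 0 < a -> 0 < c ->
  (\int[mu]_s (rlk c s * (rlk a (t - s) * rlk (a + 1) (t - s)))%:E =
   (Beta c (2 * a) / (Gamma a ^+ 2 * Gamma c * a) * pw (c + 2 * a) t)%:E)%E.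
Proof.
move=> a0 c0; have a20 : 0 < 2 * a by rewrite mulr_gt0.
have ga := Gamma_gt0 a0; have gc := Gamma_gt0 c0.
have cE := conv_pw c (2 * a) t.
rewrite (betaE_Gamma c0 a20) -(Beta_Gamma c0 a20) in cE.
under eq_integral => s _.
  rewrite (rlkM _ a0) /rlk (_ : _ * _ = (Gamma a ^+ 2 * Gamma c * a)^-1 * (pw c s * pw (2 * a) (t - s))); last first.
    move: (Gamma a) (Gamma c) ga gc => A C A0 C0; by field; rewrite !gt_eqF.
  rewrite EFinM; over.
rewrite ge0_integralZl//; last 3 first.
- by apply/measurable_EFinP; apply: measurable_convf; exact: measurable_pw.
- by move=> s _; rewrite lee_fin mulr_ge0// pw_ge0.
- by rewrite lee_fin invr_ge0 mulr_ge0 ?(ltW a0)// mulr_ge0 ?sqr_ge0// ltW.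
rewrite [X in (_ * X)%E]cE -!EFinM; congr EFin.
by rewrite mulrA [_^-1 * _]mulrC.
Qed.

End kernel_integrals.

(** * The variance of the Riemann-Liouville integral *)

Lemma integral_itv_cc_oo (R : realType) (x y : R) (f : R -> \bar R) :
  measurable_fun `]x, y[ f ->
  (\int[@lebesgue_measure R]_(u in `[x, y]) f u =
   \int[@lebesgue_measure R]_(u in `]x, y[) f u)%E.
Proof.
move=> mf; rewrite integral_itv_bndo_bndc//; apply/esym/integral_itv_obnd_cbnd.
exact/emeasurable_fun_itv_bndo_bndcP.
Qed.

Lemma pw_powR (R : realType) (e t : R) : 0 <= t -> 0 < e -> pw (e + 1) t = t `^ e.
Proof.
rewrite le_eqVlt => /predU1P[<-|t0] e0; last by rewrite pw_gt0E// addrK.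
by rewrite pw_le0// powR0// gt_eqF.
Qed.

Lemma variance_moments d (T : measurableType d) (R : realType) (P : probability T R)
    (X : T -> R) (m v : R) :
  measurable_fun setT X -> (forall w, 0 <= X w) ->
  (\int[P]_w (X w)%:E = m%:E)%E -> (\int[P]_w (X w ^+ 2)%:E = v%:E)%E ->
  ('V_P[X] = (v - m ^+ 2)%:E)%E.
Proof.
move=> mX X0 iX iX2; rewrite /variance covariance.unlock expectation.unlock iX /=.
have -> : v - m ^+ 2 = m ^+ 2 + (- (2 * m)) * m + 1 * v by ring.
rewrite -(integral_affine3 (m ^+ 2) (- (2 * m)) 1 mX (measurable_funX 2 mX) X0
  (fun w => sqr_ge0 (X w)) iX iX2).
have E (x : R) : (x - m) * (x - m) = m ^+ 2 + (- (2 * m)) * x + 1 * x ^+ 2 by ring.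
by apply: eq_integral => w _; congr EFin; exact: E.
Qed.

Section riemann_liouville_moments.
Local Opaque Gamma incomplete_Beta powR.
Context d (T : measurableType d) (R : realType) (P : probability T R).
Variables (k : nat) (lam : nat -> R) (a b : R) (M D : R -> {RV P >-> R}).
Hypothesis hlam : forall j : nat, (1 <= j <= k)%N -> 0 < lam j.
Hypothesis a0 : 0 < a.
Hypothesis b01 : 0 < b < 1.
Hypothesis hM : generalized_counting_process k lam M.
Hypothesis hD : stable_subordinator b D.
Hypothesis hind : independent_processes P M (inverse_subordinator D).
Variable t : R.
Hypothesis t0 : 0 <= t.
Local Notation mu := (@lebesgue_measure R).
Local Notation Mb := (time_changed M (inverse_subordinator D)).

Let c1 : R := \sum_(1 <= j < k.+1) j%:R * lam j.
Let c2 : R := \sum_(1 <= j < k.+1) j%:R ^+ 2 * lam j.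

Let b0 : 0 < b. Proof. by case/andP: b01. Qed.
Let b10 : 0 < b + 1. Proof. by rewrite addr_gt0. Qed.
Let b21 : 0 < 2 * b + 1. Proof. by rewrite addr_gt0// mulr_gt0. Qed.
Let a10 : 0 < a + 1. Proof. by rewrite addr_gt0. Qed.

Let c10 : 0 <= c1.
Proof.
rewrite /c1 big_nat_cond sumr_ge0// => i; rewrite andbT => ik.
by rewrite mulr_ge0// ltW// hlam.
Qed.

Let c20 : 0 <= c2.
Proof.
rewrite /c2 big_nat_cond sumr_ge0// => i; rewrite andbT => ik.
by rewrite mulr_ge0 ?sqr_ge0// ltW// hlam.
Qed.

(** The weight of the Riemann-Liouville integral at time t, zero outside ]0, t[. *)
Definition kap s : R := (0 < s)%R%:R * rlk a (t - s).

Let kapE s : kap s = (0 < s)%R%:R * rlk a (t - s). Proof. by []. Qed.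

Let kap0 s : 0 <= kap s.
Proof. by apply: mulr_ge0 => //; exact: rlk_ge0. Qed.

Let mkap : measurable_fun setT kap.
Proof.
apply: measurable_funM; first exact: measurable_ltr_ind.
by apply: (measurableT_comp (measurable_rlk a)); exact: measurable_funB.
Qed.

Local Opaque kap.

Let mkapM : measurable_fun setT (fun z : R * T => kap z.1 * Mb z.1 z.2).
Proof.
apply: measurable_funM; first exact: (measurableT_comp mkap measurable_fst).
exact: (measurable_time_changed hM hD).
Qed.

Let mkapMw w : measurable_fun setT (fun s => kap s * Mb s w).
Proof.
have mp : measurable_fun setT (fun s : R => (s, w)) by exact: measurable_fun_pair.
exact: (measurableT_comp mkapM mp).
Qed.

Let Mb0 s w : 0 <= Mb s w. Proof. exact: (time_changed_ge0 _ hM). Qed.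

Let J w : \bar R := (\int[mu]_s (kap s * Mb s w)%:E)%E.

Let J0 w : (0 <= J w)%E.
Proof. by apply: integral_ge0 => s _; rewrite lee_fin mulr_ge0. Qed.

Let mJ : measurable_fun setT J.
Proof.
have mf : measurable_fun setT (fun z : R * T => (kap z.1 * Mb z.1 z.2)%:E).
  by apply/measurable_EFinP; exact: mkapM.
have H := @measurable_fun_fubini_tonelli_G _ _ _ _ R mu _ mf.
by apply: H => z; rewrite lee_fin mulr_ge0.
Qed.

Let X w : R := RL_integral a (fun s => Mb s w) t.

(** True for every w: if the integral is infinite, both sides take the default value 0. *)
Let XE w : X w = fine (J w).
Proof.
have ga := Gamma_gt0 a0.
rewrite /X /RL_integral /Rintegral.
have mf : measurable_fun setT (fun s : R => ((t - s) `^ (a - 1) * Mb s w)%:E).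
  apply/measurable_EFinP; apply: measurable_funM.
    by apply: (measurableT_comp (measurable_powR (a - 1))); exact: measurable_funB.
  have mp : measurable_fun setT (fun s : R => (s, w)) by exact: measurable_fun_pair.
  exact: (measurableT_comp (measurable_time_changed hM hD) mp).
rewrite -integral_itv_obnd_cbnd; last exact: measurable_funTS.
rewrite -integral_itv_bndo_bndc; last exact: measurable_funTS.
have -> : J w = ((Gamma a)^-1%:E *
    \int[mu]_(s in `]0%R, t[) ((t - s) `^ (a - 1) * Mb s w)%:E)%E.
  rewrite -ge0_integralZl//; last 3 first.
  - exact: measurable_funTS.
  - by move=> s _; rewrite lee_fin mulr_ge0 ?powR_ge0.
  - by rewrite lee_fin invr_ge0 ltW.
  rewrite [RHS]integral_mkcond; apply: eq_integral => s _.
  rewrite patchE mem_setE in_itv/= kapE /rlk /pw subr_gt0.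
  case: (0 < s); case: (s < t); rewrite /= ?(mul0r, mulr0)//.
  by rewrite mul1r -EFinM mulrAC mulrC.
have : (0 <= \int[mu]_(s in `]0%R, t[) ((t - s) `^ (a - 1) * Mb s w)%:E)%E.
  by apply: integral_ge0 => s _; rewrite lee_fin mulr_ge0 ?powR_ge0.
case: (integral _ _ _) => [r| |]//= _.
by rewrite gt0_muley ?lte_fin ?invr_gt0//= mulr0.
Qed.

Let rlkE c x : rlk c x = pw c x / Gamma c :> R. Proof. by []. Qed.

Local Opaque rlk rlk_tail pw.

Let integral_kap_rlk c : 0 < c -> (\int[mu]_s (kap s * rlk c s)%:E = (rlk (a + c) t)%:E)%E.
Proof.
move=> c0; rewrite addrC -[RHS](conv_rlk t c0 a0) /conv; apply: eq_integral => s _; congr EFin.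
have [s0|s0] := ltP 0 s; last by rewrite rlk_le0// mulr0 mul0r.
rewrite kapE s0 mul1r; exact: mulrC.
Qed.

Lemma RL_mean0 : (\int[P]_w J w = (c1 * rlk (a + (b + 1)) t)%:E)%E.
Proof.
rewrite /J (@tonelli _ _ _ _ _ P mu (fun w s => (kap s * Mb s w)%:E)); last 2 first.
- have mp : measurable_fun setT (fun z : T * R => (z.2, z.1)).
    by apply: measurable_fun_pair; [exact: measurable_snd|exact: measurable_fst].
  by apply/measurable_EFinP; exact: (measurableT_comp mkapM mp).
- by move=> w s; rewrite lee_fin mulr_ge0.
have mf : measurable_fun setT (fun s : R => (kap s * rlk (b + 1) s)%:E).
  by apply/measurable_EFinP; apply: measurable_funM => //; exact: measurable_rlk.
have f0 s : (0 <= (kap s * rlk (b + 1) s)%:E)%E.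
  by rewrite lee_fin mulr_ge0// rlk_ge0.
have c1E : (0 <= c1%:E)%E by rewrite lee_fin.
rewrite EFinM -(integral_kap_rlk b10).
rewrite -[RHS](ge0_integralZl mu measurableT mf (fun s _ => f0 s) c1E).
apply: eq_integral => s _.
have [s0|s0] := ltP 0 s; last first.
  by rewrite (kapE s) ltNge s0 mul0r mul0r mule0 integral0_eq// => w _; rewrite mul0r.
under eq_integral do rewrite EFinM.
rewrite ge0_integralZl//.
- rewrite (time_changed_mean hlam b01 hM hD hind (ltW s0)).
  by rewrite -!EFinM mulrCA.
- have mp : measurable_fun setT (fun w : T => (s, w)) by exact: measurable_fun_pair.
  apply/measurable_EFinP.
  exact: (measurableT_comp (measurable_time_changed hM hD) mp).
- by move=> w _; rewrite lee_fin.
- by rewrite lee_fin.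
Qed.

(* [E (Mb s * Mb u)] for [s <= u]. *)
Let S s u : R := c2 * rlk (b + 1) s + c1 ^+ 2 * (rlk (2 * b + 1) s + rlk_tail b s u).

Let B w s u : \bar R := ((s < u)%R%:R * ((kap s * Mb s w) * (kap u * Mb u w)))%:E.

Let B0 w s u : (0 <= B w s u)%E.
Proof. by rewrite lee_fin; apply: mulr_ge0 => //; apply: mulr_ge0; apply: mulr_ge0. Qed.

Let mB : measurable_fun setT (fun q : (T * R) * R => B q.1.1 q.1.2 q.2).
Proof.
have mw : measurable_fun setT (fun q : (T * R) * R => q.1.1).
  exact: (measurableT_comp measurable_fst measurable_fst).
have mx : measurable_fun setT (fun q : (T * R) * R => q.1.2).
  exact: (measurableT_comp measurable_snd measurable_fst).
have my : measurable_fun setT (fun q : (T * R) * R => q.2) by exact: measurable_snd.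
have mz (z : (T * R) * R -> R) : measurable_fun setT z ->
    measurable_fun setT (fun q => kap (z q) * Mb (z q) q.1.1).
  move=> mz; have mp : measurable_fun setT (fun q : (T * R) * R => (z q, q.1.1)).
    exact: measurable_fun_pair.
  exact: (measurableT_comp mkapM mp).
apply/measurable_EFinP; apply: measurable_funM; first exact: measurable_ltr_ind.
by apply: measurable_funM; exact: mz.
Qed.

Let mBw w : measurable_fun setT (fun z : R * R => B w z.1 z.2).
Proof.
have mp : measurable_fun setT (fun z : R * R => ((w, z.1), z.2)).
  by apply: measurable_fun_pair => //; exact: measurable_fun_pair.
exact: (measurableT_comp mB mp).
Qed.

(** The diagonal is null and the integrand symmetric, so the two halves of the square contribute
    equally. *)
Let J_sqr w : (J w * J w = 2%:E * \int[mu]_s \int[mu]_u B w s u)%E.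
Proof.
have mBs s : measurable_fun setT (fun u => B w s u).
  have mp : measurable_fun setT (fun u : R => (s, u)) by exact: measurable_fun_pair.
  exact: (measurableT_comp (mBw w) mp).
have mBu u : measurable_fun setT (fun s => B w s u).
  have mp : measurable_fun setT (fun s : R => (s, u)) by exact: measurable_fun_pair.
  exact: (measurableT_comp (mBw w) mp).
rewrite mule_natl mule2n.
rewrite [X in (_ + X)%E](@tonelli _ _ _ _ _ mu mu (B w) (mBw w) (B0 w)).
have m1 : measurable_fun setT (fun s : R => \int[mu]_u B w s u)%E.
  exact: (@measurable_fun_fubini_tonelli_F _ _ _ _ R mu
    (fun z : R * R => B w z.1 z.2) (mBw w) (fun z => B0 w z.1 z.2)).
have m2 : measurable_fun setT (fun u : R => \int[mu]_s B w s u)%E.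
  exact: (@measurable_fun_fubini_tonelli_G _ _ _ _ R mu
    (fun z : R * R => B w z.1 z.2) (mBw w) (fun z => B0 w z.1 z.2)).
have I1 s : (0 <= \int[mu]_u B w s u)%E by apply: integral_ge0 => u _; exact: B0.
have I2 u : (0 <= \int[mu]_s B w s u)%E by apply: integral_ge0 => s _; exact: B0.
rewrite -[RHS](ge0_integralD mu measurableT (fun s _ => I1 s) m1 (fun s _ => I2 s) m2).
have mf : measurable_fun setT (fun s : R => (kap s * Mb s w)%:E).
  by apply/measurable_EFinP; exact: (mkapMw w).
have f0 s : (0 <= (kap s * Mb s w)%:E)%E by rewrite lee_fin mulr_ge0.
rewrite -[LHS](ge0_integralZl mu measurableT mf (fun s _ => f0 s) (J0 w)).
apply: eq_integral => s _.
rewrite -[RHS](ge0_integralD mu measurableT (fun u _ => B0 w s u) (mBs s)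
  (fun u _ => B0 w u s) (mBu s)).
rewrite muleC -[LHS](ge0_integralZl mu measurableT mf (fun s _ => f0 s) (f0 s)).
apply: ge0_ae_integral.
- by apply: emeasurable_funM => //; exact: measurable_cst.
- by apply: emeasurable_funD; [exact: mBs|exact: mBu].
- by move=> u; apply: mule_ge0; exact: f0.
- by move=> u; apply: adde_ge0; exact: B0.
exists [set s]; split; [exact: measurable_set1|exact: lebesgue_measure_set1|].
move=> u /= ne; apply: contrapT => us; apply: ne.
rewrite /B -EFinD -EFinM; congr EFin.
have [xy|yx|xy] := ltgtP s u; last by case: us.
- by rewrite mul1r mul0r addr0.
- by rewrite mul1r mul0r add0r mulrC.
Qed.

Let Phi s u : \bar R := ((s < u)%R%:R * (kap s * kap u * S s u))%:E.

Let J_sqr_mean : (\int[P]_w (J w * J w) = 2%:E * \int[mu]_s \int[mu]_u Phi s u)%E.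
Proof.
under eq_integral do rewrite J_sqr.
have m1 := @measurable_fun_fubini_tonelli_F _ _ _ _ R mu
  (fun q : (T * R) * R => B q.1.1 q.1.2 q.2) mB (fun q => B0 q.1.1 q.1.2 q.2).
have I0 w s : (0 <= \int[mu]_u B w s u)%E by apply: integral_ge0 => u _; exact: B0.
have m2 := @measurable_fun_fubini_tonelli_F _ _ _ _ R mu _ m1 (fun q => I0 q.1 q.2).
rewrite ge0_integralZl//; last by move=> w _; apply: integral_ge0.
congr (_ * _)%E; rewrite (@tonelli_rot _ _ _ _ _ _ _ P mu mu B mB B0).
apply: eq_integral => s _; apply: eq_integral => u _.
rewrite /B /Phi.
have [su|su] := ltP s u; last first.
  by rewrite mul0r integral0_eq// => w _; rewrite mul0r.
have [s0|s0] := ltP 0 s; last first.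
  by rewrite (kapE s) ltNge s0 !(mul0r, mulr0) integral0_eq// => w _; rewrite !(mul0r, mulr0).
rewrite mul1r EFinM /S -(time_changed_prod hlam b01 hM hD hind (ltW s0) (ltW su)).
rewrite -ge0_integralZl//.
- by apply: eq_integral => w _; rewrite -EFinM; congr EFin; rewrite mul1r; ring.
- have mp (r : R) : measurable_fun setT (fun w : T => (r, w)) by exact: measurable_fun_pair.
  apply/measurable_EFinP; apply: measurable_funM;
    exact: (measurableT_comp (measurable_time_changed hM hD) (mp _)).
- by move=> w _; rewrite lee_fin mulr_ge0.
- by rewrite lee_fin mulr_ge0.
Qed.

(** Reflecting u to t - u turns the tail of the kernel into an integral from 0, which raises the
    order by one. *)
Let tail_from s : 0 < s ->
  (\int[mu]_u ((s < u)%R%:R * kap u)%:E = (rlk (a + 1) (t - s))%:E)%E.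
Proof.
move=> s0; rewrite -(rlkD1 (t - s) a0) -[RHS](ge0_integral_reflect t); last 2 first.
- apply/measurable_EFinP; apply: measurable_funM; first exact: measurable_rlk.
  exact: measurable_ltr_ind.
- by move=> u; rewrite lee_fin mulr_ge0// rlk_ge0.
apply: eq_integral => u _; congr EFin; rewrite ltrD2l ltrN2.
have [su|su] := ltP s u; last by rewrite mul0r mulr0.
by rewrite kapE (lt_trans s0 su) !mul1r mulr1.
Qed.

(** The only part of [Phi], up to a constant, whose product moment depends on u as well; it remains
    a double integral in the result. *)
Let Psi s u : \bar R := ((s < u)%R%:R * (kap s * kap u * rlk_tail b s u))%:E.

Let Psi0 s u : (0 <= Psi s u)%E.
Proof.
rewrite lee_fin; apply: mulr_ge0 => //; apply: mulr_ge0; first exact: mulr_ge0.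
exact: rlk_tail_ge0.
Qed.

Let mk1 : measurable_fun setT (fun z : R * R => kap z.1).
Proof. exact: (measurableT_comp mkap measurable_fst). Qed.

Let mk2 : measurable_fun setT (fun z : R * R => kap z.2).
Proof. exact: (measurableT_comp mkap measurable_snd). Qed.

Let mPsi : measurable_fun setT (fun z : R * R => Psi z.1 z.2).
Proof.
apply/measurable_EFinP; apply: measurable_funM.
  by apply: measurable_ltr_ind; [exact: measurable_fst|exact: measurable_snd].
apply: measurable_funM; first exact: measurable_funM.
exact: measurable_rlk_tail2.
Qed.

Let mPsi2 s : measurable_fun setT (Psi s).
Proof.
have mp : measurable_fun setT (fun u : R => (s, u)) by exact: measurable_fun_pair.
exact: (measurableT_comp mPsi mp).
Qed.

Let G s : \bar R := (\int[mu]_u Psi s u)%E.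

Let G0 s : (0 <= G s)%E.
Proof. by apply: integral_ge0 => u _; exact: Psi0. Qed.

Let mG : measurable_fun setT G.
Proof.
exact: (@measurable_fun_fubini_tonelli_F _ _ _ _ R mu
    (fun z : R * R => Psi z.1 z.2) mPsi (fun z => Psi0 z.1 z.2)).
Qed.

Let Q : R := rlk (b + 1) t * rlk (b + 1) t.

Let Q0 : 0 <= Q. Proof. by apply: mulr_ge0; exact: rlk_ge0. Qed.

Let integral_kap : (\int[mu]_s (kap s)%:E = (rlk (a + 1) t)%:E)%E.
Proof.
rewrite -(integral_kap_rlk ltr01); apply: eq_integral => s _; congr EFin.
by rewrite rlk1 (kapE s); case: (0 < s); rewrite ?mulr1// !mul0r.
Qed.

Let mkE : measurable_fun setT (fun s : R => (kap s)%:E).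
Proof. exact/measurable_EFinP. Qed.

Let kE0 s : (0 <= (kap s)%:E)%E. Proof. exact: (kap0 s). Qed.

(** For s < u < t the tail is at most Q by monotonicity. The bound makes [G] and its integral
    finite, as the real-valued iterated integral in the result requires. *)
Let G_le s : (G s <= (Q * rlk (a + 1) t * kap s)%:E)%E.
Proof.
have QK0 : (0 <= (Q * kap s)%:E)%E by exact: (mulr_ge0 Q0 (kap0 s)).
rewrite mulrAC EFinM -integral_kap.
rewrite -(ge0_integralZl mu measurableT mkE (fun s _ => kE0 s) QK0).
have mQ : measurable_fun setT (fun u : R => (Q * kap s)%:E * (kap u)%:E)%E.
  by apply: emeasurable_funM; [exact: measurable_cst|exact: mkE].
apply: (ge0_le_integral mu measurableT (fun u _ => Psi0 s u) (mPsi2 s) mQ).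
move=> u _; rewrite -EFinM lee_fin.
have [su|su] := ltP s u; last first.
  by rewrite mul0r; exact: (mulr_ge0 (mulr_ge0 Q0 (kap0 s)) (kap0 u)).
have QE (x y z : R) : x * y * z = y * z * x by ring.
rewrite mul1r (QE Q (kap s) (kap u)).
have [ut|tu] := ltP u t; last first.
  have ku : kap u = 0 by rewrite kapE rlk_le0 ?subr_le0// mulr0.
  by rewrite ku mulr0 !mul0r.
apply: (ler_wpM2l (mulr_ge0 (kap0 s) (kap0 u))).
apply: le_trans (rlk_tail_le b0 s u) _.
apply: ler_pM; rewrite ?rlk_ge0//; apply: rlkS_le => //; first exact: ltW.
exact: ltW (lt_trans su ut).
Qed.

Let G_fin s : G s \is a fin_num.
Proof. by rewrite ge0_fin_numE// (le_lt_trans (G_le s))// ltry. Qed.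

Let IG_fin : (\int[mu]_s G s)%E \is a fin_num.
Proof.
rewrite ge0_fin_numE; last by apply: integral_ge0.
apply: (@le_lt_trans _ _ ((Q * rlk (a + 1) t)%:E * (rlk (a + 1) t)%:E)%E); last first.
  by rewrite -EFinM ltry.
have C0 : (0 <= (Q * rlk (a + 1) t)%:E)%E by rewrite lee_fin mulr_ge0// rlk_ge0.
rewrite -integral_kap -(ge0_integralZl mu measurableT mkE (fun s _ => kE0 s) C0).
have mQ : measurable_fun setT (fun s : R => (Q * rlk (a + 1) t)%:E * (kap s)%:E)%E.
  by apply: emeasurable_funM; [exact: measurable_cst|exact: mkE].
apply: (ge0_le_integral mu measurableT (fun s _ => G0 s) mG mQ) => s _.
by rewrite -EFinM; exact: G_le.
Qed.

Let mc (c : R) (f : R -> \bar R) : measurable_fun setT f ->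
  measurable_fun setT (fun s => c%:E * f s)%E.
Proof. by move=> mf; apply: emeasurable_funM => //; exact: measurable_cst. Qed.

Let coef c : R := Beta c (2 * a) / (Gamma a ^+ 2 * Gamma c * a) * pw (c + 2 * a) t.

(** The terms of [S] that depend on s alone meet the tail of the kernel and become the integrals of
    [integral_rlkM]; the tail term is [G]. *)
Let integral_Phi : (\int[mu]_s \int[mu]_u Phi s u =
  (c2 * coef (b + 1) + c1 ^+ 2 * coef (2 * b + 1) + c1 ^+ 2 * fine (\int[mu]_s G s))%:E)%E.
Proof.
pose N c s : \bar R := (rlk c s * (rlk a (t - s) * rlk (a + 1) (t - s)))%:E.
have N0 c s : 0 < c -> (0 <= N c s)%E.
  by move=> c0; rewrite lee_fin; apply: mulr_ge0; [|apply: mulr_ge0]; exact: rlk_ge0.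
have mN c : measurable_fun setT (N c).
  apply/measurable_EFinP; apply: measurable_funM; first exact: measurable_rlk.
  have mB' : measurable_fun setT (fun s : R => t - s) by exact: measurable_funB.
  by apply: measurable_funM; [exact: (measurableT_comp (measurable_rlk a) mB')|
    exact: (measurableT_comp (measurable_rlk (a + 1)) mB')].
have c2E : (0 <= c2%:E)%E by rewrite lee_fin.
have c1E : (0 <= (c1 ^+ 2)%:E)%E by rewrite lee_fin sqr_ge0.
transitivity (\int[mu]_s (c2%:E * N (b + 1)%R s + (c1 ^+ 2)%:E * N (2 * b + 1)%R s + (c1 ^+ 2)%:E * G s))%E.
  apply: eq_integral => s _.
  have [s0|s0] := ltP 0 s; last first.
    rewrite /N !(rlk_le0 _ s0) !mul0r !mule0 !add0e.
    have ks : kap s = 0 by rewrite (kapE s) ltNge s0 mul0r.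
    rewrite /G /Phi /Psi ks !integral0_eq ?mule0// => u _; by rewrite !mul0r mulr0.
  pose V := kap s * (c2 * rlk (b + 1) s + c1 ^+ 2 * rlk (2 * b + 1) s).
  have V0 : (0 <= V%:E)%E.
    apply: (mulr_ge0 (kap0 s)); apply: addr_ge0; apply: mulr_ge0.
    - exact: c20.
    - exact: rlk_ge0.
    - exact: sqr_ge0.
    - exact: rlk_ge0.
  have mt : measurable_fun setT (fun u : R => ((s < u)%R%:R * kap u)%:E).
    by apply/measurable_EFinP; apply: measurable_funM => //; exact: measurable_ltr_ind.
  have t0' u : (0 <= ((s < u)%R%:R * kap u)%:E)%E.
    exact: (mulr_ge0 (ler0n _ _) (kap0 u)).
  transitivity (\int[mu]_u (V%:E * ((s < u)%R%:R * kap u)%:E + (c1 ^+ 2)%:E * Psi s u))%E.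
    have E (i x y p q z v : R) :
        i * (x * y * (p + q * (z + v))) = x * (p + q * z) * (i * y) + q * (i * (x * y * v)).
      by ring.
    by apply: eq_integral => u _; rewrite /Phi /Psi /S /V -!EFinM -EFinD E.
  rewrite (ge0_integralD mu measurableT (fun u _ => mule_ge0 V0 (t0' u)) (mc _ mt)
    (fun u _ => mule_ge0 c1E (Psi0 s u)) (mc _ (mPsi2 s))).
  rewrite (ge0_integralZl mu measurableT mt (fun u _ => t0' u) V0) tail_from//.
  rewrite (ge0_integralZl mu measurableT (mPsi2 s) (fun u _ => Psi0 s u) c1E).
  congr (_ + _)%E; rewrite -!EFinM -EFinD; congr EFin.
  have E (x y z p q v : R) : x * (y * p + z * q) * v = y * (p * (x * v)) + z * (q * (x * v)).
    by ring.
  by rewrite /V (kapE s) s0 mul1r E.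
rewrite (ge0_integralD mu measurableT
  (fun s _ => adde_ge0 (mule_ge0 c2E (N0 _ s b10)) (mule_ge0 c1E (N0 _ s b21)))
  (emeasurable_funD (mc _ (mN _)) (mc _ (mN _)))
  (fun s _ => mule_ge0 c1E (G0 s)) (mc _ mG)).
rewrite (ge0_integralD mu measurableT (fun s _ => mule_ge0 c2E (N0 _ s b10)) (mc _ (mN _))
  (fun s _ => mule_ge0 c1E (N0 _ s b21)) (mc _ (mN _))).
rewrite (ge0_integralZl mu measurableT (mN _) (fun s _ => N0 _ s b10) c2E).
rewrite (ge0_integralZl mu measurableT (mN _) (fun s _ => N0 _ s b21) c1E).
rewrite (ge0_integralZl mu measurableT mG (fun s _ => G0 s) c1E).
rewrite (integral_rlkM t a0 b10) (integral_rlkM t a0 b21).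
by rewrite -(fineK IG_fin) !EFinD !EFinM.
Qed.

Let h s u : R := (t - s) `^ (a - 1) * (t - u) `^ (a - 1) * u `^ (2 * b)
  * incomplete_Beta b (b + 1) (s / u).

(** Collects the normalisations: one Gamma a from each of the two weights, the others from
    [rlk_tail]. *)
Let K0 : R := (Gamma a ^+ 2 * (Gamma b * Gamma (b + 1)))^-1.

Let K0_gt0 : 0 < K0.
Proof.
have ga := Gamma_gt0 a0; have gb := Gamma_gt0 b0; have gb1 := Gamma_gt0 b10.
by rewrite invr_gt0 (mulr_gt0 (exprn_gt0 2 ga) (mulr_gt0 gb gb1)).
Qed.

Let PsiE s u : 0 < s -> s < u -> u < t -> Psi s u = (K0 * h s u)%:E.
Proof.
move=> s0 su ut; rewrite /Psi; congr EFin.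
have u0 := lt_trans s0 su; have st := lt_trans su ut.
rewrite su mul1r (rlk_tail_incomplete_Beta b0 s0 su) !kapE s0 u0 !mul1r !rlkE.
rewrite !pw_gt0E ?subr_gt0// /K0 /h.
have ga := Gamma_gt0 a0; have gb := Gamma_gt0 b0; have gb1 := Gamma_gt0 b10.
move: (Gamma a) (Gamma b) (Gamma (b + 1)) ga gb gb1 => x y z x0 y0 z0.
by field; rewrite !gt_eqF.
Qed.

Let Psi_out s u : ~~ (s < u < t) -> Psi s u = 0%E.
Proof.
rewrite negb_and -!leNgt => /orP[us|tu]; rewrite /Psi.
  by rewrite ltNge us mul0r.
by rewrite [kap u]kapE [rlk a (t - u)]rlk_le0 ?subr_le0// !(mulr0, mul0r).
Qed.

(** [h] and [Psi] are compared on the open interval only: the endpoints form a null set, and outside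
    it [Psi] vanishes. *)
Let inner s : 0 < s -> (\int[mu]_(u in `[s, t]) (h s u)%:E = K0^-1%:E * G s)%E.
Proof.
move=> s0.
have hE u : u \in `]s, t[%classic -> (K0^-1%:E * Psi s u)%E = (h s u)%:E.
  rewrite mem_setE in_itv/= => /andP[su ut].
  by rewrite PsiE// -EFinM mulKf// gt_eqF.
have mh : measurable_fun `]s, t[ (fun u => (h s u)%:E).
  apply: (eq_measurable_fun _ hE); apply: measurable_funTS; exact: (mc _ (mPsi2 s)).
rewrite (integral_itv_cc_oo mh).
transitivity (\int[mu]_(u in `]s, t[) (K0^-1%:E * Psi s u))%E.
  by apply: eq_integral => u /hE ->.
rewrite integral_mkcond.
have K0E : (0 <= K0^-1%:E)%E by rewrite lee_fin invr_ge0 ltW.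
rewrite -(ge0_integralZl mu measurableT (mPsi2 s) (fun u _ => Psi0 s u) K0E).
apply: eq_integral => u _; rewrite patchE; case: ifPn => //.
by rewrite mem_setE in_itv/= => /Psi_out ->; rewrite mule0.
Qed.

Let fine_IG : fine (\int[mu]_s G s)%E =
  K0 * \int[mu]_(s in `[0, t]) \int[mu]_(u in `[s, t]) h s u.
Proof.
have gE s : s \in `]0, t[%classic -> (K0^-1%:E * G s)%E = (\int[mu]_(u in `[s, t]) h s u)%:E.
  rewrite mem_setE in_itv/= => /andP[s0 st].
  by rewrite /Rintegral inner// fineK// fin_numM.
have K0E : (0 <= K0^-1%:E)%E by rewrite lee_fin invr_ge0 ltW.
rewrite [X in K0 * X]/Rintegral integral_itv_cc_oo; last first.
  apply: (eq_measurable_fun _ gE); apply: measurable_funTS; exact: (mc _ mG).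
rewrite (_ : (\int[mu]_(s in `]0%R, t[) _)%E = (K0^-1%:E * \int[mu]_s G s)%E); last first.
  transitivity (\int[mu]_(s in `]0%R, t[) (K0^-1%:E * G s))%E.
    by apply: eq_integral => s st; rewrite (gE s st).
  rewrite integral_mkcond.
  rewrite -(ge0_integralZl mu measurableT mG (fun s _ => G0 s) K0E).
  apply: eq_integral => s _; rewrite patchE; case: ifPn => //.
  rewrite mem_setE in_itv/= negb_and -!leNgt => /orP[s0|ts].
    rewrite /G integral0_eq ?mule0// => u _.
    by rewrite /Psi {1}(kapE s) [0 < s]ltNge s0 !(mul0r, mulr0).
  rewrite /G integral0_eq ?mule0// => u _; apply: Psi_out.
  by rewrite negb_and -!leNgt; case: (leP u s) => //= su; rewrite (le_trans ts)// ltW.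
by rewrite fineM//= mulVKf// gt_eqF.
Qed.

Let ae_J : {ae P, forall w, (X w)%:E = J w}.
Proof.
have iJ : P.-integrable setT J.
  apply/integrableP; split; first exact: mJ.
  under eq_integral do rewrite (gee0_abs (J0 _)).
  by rewrite RL_mean0 ltry.
apply: filterS (integrable_ae measurableT iJ) => w Jfin.
by rewrite XE fineK//; exact: Jfin.
Qed.

Let mX : measurable_fun setT X.
Proof.
rewrite (_ : X = fine \o J); last by apply/funext => w; rewrite XE.
exact: (measurableT_comp (fine_measurable measurableT) mJ).
Qed.

Let X0 w : 0 <= X w. Proof. by rewrite XE; exact: (fine_ge0 (J0 w)). Qed.

Lemma RL_variance : ('V_P[X] =
  (2 * c2 * Beta (b + 1) (2 * a) / (Gamma a ^+ 2 * Gamma (b + 1) * a) * t `^ (2 * a + b)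
   + (2 * Beta (2 * b + 1) (2 * a) / (Gamma a ^+ 2 * Gamma (2 * b + 1) * a)
      - 1 / Gamma (a + b + 1) ^+ 2) * c1 ^+ 2 * t `^ (2 * a + 2 * b)
   + 2 * c1 ^+ 2 * b / (Gamma a * Gamma (b + 1)) ^+ 2
     * \int[mu]_(s in `[0, t]) \int[mu]_(w in `[s, t]) h s w)%:E)%E.
Proof.
have iX : (\int[P]_w (X w)%:E = (c1 * rlk (a + (b + 1)) t)%:E)%E.
  rewrite -RL_mean0; apply: (ge0_ae_integral _ mJ _ J0 ae_J); first exact/measurable_EFinP.
  by move=> w; exact: (X0 w).
have iX2 : (\int[P]_w (X w ^+ 2)%:E = (2 * (c2 * coef (b + 1) + c1 ^+ 2 * coef (2 * b + 1)
    + c1 ^+ 2 * fine (\int[mu]_s G s)%E))%:E)%E.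
  rewrite EFinM -integral_Phi -J_sqr_mean; apply: ge0_ae_integral.
  - by apply/measurable_EFinP; exact: measurable_funX.
  - exact: (emeasurable_funM mJ mJ).
  - by move=> w; exact: (sqr_ge0 (X w)).
  - by move=> w; exact: (mule_ge0 (J0 w) (J0 w)).
  by apply: filterS ae_J => w <-; rewrite -EFinM expr2.
rewrite (variance_moments mX X0 iX iX2) fine_IG /coef /K0 rlkE.
have ab0 : 0 < a + b by rewrite addr_gt0.
have e1 : pw (b + 1 + 2 * a) t = t `^ (2 * a + b).
  by rewrite -(pw_powR t0) ?addr_gt0 ?mulr_gt0//; congr pw; ring.
have e2 : pw (2 * b + 1 + 2 * a) t = t `^ (2 * a + 2 * b).
  by rewrite -(pw_powR t0) ?addr_gt0 ?mulr_gt0//; congr pw; ring.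
have e3 : pw (a + (b + 1)) t = t `^ (a + b) by rewrite addrA pw_powR.
have e4 : t `^ (2 * a + 2 * b) = (t `^ (a + b)) ^+ 2.
  by rewrite -powR_mulrn ?powR_ge0// -powRrM; congr (_ `^ _); ring.
(* With Gamma (b + 1) = b Gamma b, [K0] becomes b / (Gamma a Gamma (b + 1))^2, the source of the
   factor b in the last term. Writing t^(2a + 2b) as a square lets the squared mean merge with the
   second coefficient. *)
rewrite e1 e2 e3 e4 (addrA a) (GammaD1 b0).
have ga := Gamma_gt0 a0; have gb := Gamma_gt0 b0; have g2b := Gamma_gt0 b21.
have gab : 0 < Gamma (a + b + 1) by apply: Gamma_gt0; rewrite addr_gt0.
move: (Gamma a) (Gamma b) (Gamma (2 * b + 1)) (Gamma (a + b + 1)) ga gb g2b gab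
  (Beta (b + 1) (2 * a)) (Beta (2 * b + 1) (2 * a)) (t `^ (2 * a + b)) (t `^ (a + b))
  (\int[mu]_(s in `[0, t]) _) c1 c2 => x y z v x0 y0 z0 v0 B1 B2 p q I d1 d2.
by congr EFin; field; rewrite !gt_eqF.
Qed.

End riemann_liouville_moments.

Theorem theorem6p1 (d : measure_display) (T : measurableType d) (R : realType)
    (P : probability T R) (k : nat) (lam : nat -> R) (alpha beta : R)
    (M D : R -> {RV P >-> R})
    (hk : (1 <= k)%N)
    (hlam : forall j : nat, (1 <= j <= k)%N -> 0 < lam j)
    (halpha : 0 < alpha) (hbeta : 0 < beta < 1)
    (hM : generalized_counting_process k lam M)
    (hD : stable_subordinator beta D)
    (hind : independent_processes P M (inverse_subordinator D)) :
  let mu := @lebesgue_measure R in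
  let Mbeta := time_changed M (inverse_subordinator D) in
  let c1 := \sum_(1 <= j < k.+1) j%:R * lam j in
  let c2 := \sum_(1 <= j < k.+1) j%:R ^+ 2 * lam j in
  forall t : R, 0 <= t ->
  ('V_P[fun w => RL_integral alpha (fun s => Mbeta s w) t])%E =
  (2 * c2 * Beta (beta + 1) (2 * alpha)
     / (Gamma alpha ^+ 2 * Gamma (beta + 1) * alpha)
     * t `^ (2 * alpha + beta)
   + (2 * Beta (2 * beta + 1) (2 * alpha)
        / (Gamma alpha ^+ 2 * Gamma (2 * beta + 1) * alpha)
      - 1 / Gamma (alpha + beta + 1) ^+ 2)
     * c1 ^+ 2 * t `^ (2 * alpha + 2 * beta)
   + 2 * c1 ^+ 2 * beta / (Gamma alpha * Gamma (beta + 1)) ^+ 2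
     * \int[mu]_(s in `[0, t]) \int[mu]_(w in `[s, t])
         ((t - s) `^ (alpha - 1) * (t - w) `^ (alpha - 1) * w `^ (2 * beta)
          * incomplete_Beta beta (beta + 1) (s / w)))%:E.
Proof.
by move=> mu Mbeta c1 c2 t t0; exact: (RL_variance hlam halpha hbeta hM hD hind t0).
Qed.
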